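(* For $(p,p')=(3,8)$ (level $N=2/3$) and $r\in\{0,1,2,3\}$, \begin{align*} (q)_{\infty}^3\,\mathcal{C}_{0,2r}^{2/3}(q) &=(-1)^{\lfloor (r+1)/2\rfloor}\cdot\frac{q^{-r}}{2}\,\frac{J_{1}^2J_{2}}{J_{4}^2J_{8}}\,j(-q^{7-2r};q^{16})\,j(q^{1+2r};q^{8})\\ &\quad - q^{3-2r}\,\frac{j(q^{7-2r};q^{16})\,j(q^{30-4r};q^{32})}{J_{32}}\,\omega_{3}(-q^{2}) + q^{-r}\,\frac{j(q^{1+2r};q^{16})\,j(q^{18+4r};q^{32})}{J_{32}}\cdot\frac{1}{2}f_{3}(q^4). \end{align*}
   Context: Throughout $q=e^{2\pi i\tau}$ with $\operatorname{Im}\tau>0$, $q^{a}:=e^{2\pi i a\tau}$ for rational $a$, and $z=e^{2\pi i w}$, $z^{a}:=e^{2\pi i a w}$. Notation: $(x;q)_n=\prod_{i=0}^{n-1}(1-q^ix)$, $(x)_n=(x;q)_n$, $(q)_\infty=\prod_{n\ge1}(1-q^n)$, $J_a=\prod_{i\ge1}(1-q^{ai})$, $j(x;q):=\sum_{n\in\mathbb{Z}}(-1)^nq^{n(n-1)/2}x^n$, and $\lfloor\cdot\rfloor$ is the floor function. Ramanujan's third-order mock theta functions are $$f_3(q)=\sum_{n\ge0}\frac{q^{n^2}}{(-q)_n^2},\qquad \omega_3(q)=\sum_{n\ge0}\frac{q^{2n(n+1)}}{(q;q^2)_{n+1}^2}.$$ Characters: for coprime integers $p\ge1$, $p'\ge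 2$ put $N=p'/p-2$, and let $0\le\ell\le p'-2$. The character of the admissible irreducible highest weight $A_1^{(1)}$-module of level $N$ and spin $\ell$ is (Weyl–Kac formula) $$\chi_{\ell}^{N}(z;q)=\chi_{\ell}^{(p,p')}(z;q)=\frac{\Theta_{\ell+1,p'}(z;q^p)-\Theta_{-(\ell+1),p'}(z;q^p)}{\Theta_{1,2}(z;q)-\Theta_{-1,2}(z;q)},\qquad \Theta_{n,m}(z;q)=\sum_{k\in\mathbb{Z}+n/(2m)}q^{mk^2}z^{-mk}.$$ It is holomorphic in the annulus $|q|<|z|<|q|^{-1}$. String functions: for $N\neq0$ and $m\in2\mathbb{Z}+\ell$, $C^N_{m,\ell}(q)$ is defined by the expansion in that annulus $$\chi_\ell^{N}(z;q)=\sum_{m\in2\mathbb{Z}+\ell}C_{m,\ell}^{N}(q)\,q^{\frac{m^2}{4N}}z^{-\frac m2},$$ and the normalized string function is $$\mathcal{C}_{m,\ell}^{N}(q):=q^{-s_{\lambda,\mu}}C_{m,\ell}^{N}(q),\qquad s_{\lambda,\mu}=-\frac18+\frac{p(\ell+1)^2}{4p'}-\frac{m^2}{4N}.$$ *)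

(* Defs.v *)
From Stdlib Require Import Reals ZArith Lra Lia.
From Coquelicot Require Import Coquelicot.

Open Scope C_scope.

(* As with Coquelicot's [RInt], infinite sums and products are total operators:
   [iota] selects the unique value of the corresponding convergence predicate. *)

Definition Cseries (a : nat -> C) : C :=
  @iota C_CompleteNormedModule (@is_series C_AbsRing C_NormedModule a).

Definition is_Zseries (a : Z -> C) (s : C) : Prop :=
  exists s1 s2 : C,
    @is_series C_AbsRing C_NormedModule (fun n => a (Z.of_nat n)) s1 /\
    @is_series C_AbsRing C_NormedModule (fun n => a (- Z.of_nat (S n))%Z) s2 /\
    s = s1 + s2.

Definition Zseries (a : Z -> C) : C :=
  @iota C_CompleteNormedModule (is_Zseries a).

(* u 0 * ... * u (n - 1) *)
Fixpoint Cprod (u : nat -> C) (n : nat) : C :=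
  match n with
  | O => 1
  | S k => Cprod u k * u k
  end.

Definition Cprod_inf (u : nat -> C) : C :=
  @iota C_CompleteNormedModule
    (fun l : C => filterlim (Cprod u) eventually (locally l)).

Definition Cpowz (x : C) (n : Z) : C :=
  match n with
  | Z0 => 1
  | Zpos k => x ^ Pos.to_nat k
  | Zneg k => / x ^ Pos.to_nat k
  end.

Definition Cexp (x : C) : C :=
  (exp (Re x) * cos (Im x), exp (Re x) * sin (Im x))%R.

(* e^(2 pi i a t).  This is q^a for t = tau and z^a for t = w: fractional powers
   of q and z are functions of tau and w, not of the numbers q and z. *)
Definition epow (t : C) (a : R) : C := Cexp (RtoC (2 * PI) * Ci * RtoC a * t).

Definition qpoch (x q : C) (n : nat) : C := Cprod (fun i => 1 - q ^ i * x) n.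

Definition J (a : nat) (q : C) : C := Cprod_inf (fun i => 1 - q ^ (a * S i)).

Definition qinf (q : C) : C := Cprod_inf (fun i => 1 - q ^ S i).

Definition jtheta (x q : C) : C :=
  Zseries (fun n => Cpowz (-(1)) n * Cpowz q (n * (n - 1) / 2) * Cpowz x n).

Definition f3 (q : C) : C :=
  Cseries (fun n => q ^ (n * n) / qpoch (- q) q n ^ 2).

Definition omega3 (q : C) : C :=
  Cseries (fun n => q ^ (2 * n * (n + 1)) / qpoch q (q ^ 2) (n + 1) ^ 2).

(* Theta_{n,m}(z;q), summed over k = i + n/(2m) with i in Z, where
   z = e^(2 pi i w) and q = e^(2 pi i tau). *)
Definition Theta (n : Z) (m : nat) (w tau : C) : C :=
  Zseries (fun i : Z =>
    let k := (IZR i + IZR n / (2 * INR m))%R in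
    epow tau (INR m * k ^ 2) * epow w (- (INR m * k))).

Definition char_num (p p' l : nat) (w tau : C) : C :=
  let n := Z.of_nat (l + 1) in
  Theta n p' w (RtoC (INR p) * tau) - Theta (- n) p' w (RtoC (INR p) * tau).

Definition char_den (w tau : C) : C := Theta 1 2 w tau - Theta (-1) 2 w tau.

Definition character (p p' l : nat) (w tau : C) : C :=
  char_num p p' l w tau / char_den w tau.

Definition level (p p' : nat) : R := (INR p' / INR p - 2)%R.

(* The family c consists of the coefficients of the expansion of the character
   in |q| < |z| < 1/|q|, the sum being over m = 2 k + l with k in Z.  The points
   where the denominator of the Weyl-Kac formula vanishes (there z = 1) are
   removable singularities of the quotient; the formula gives no value there, so
   they are left out, which does not affect the coefficients. *)
Definition string_expansion (p p' l : nat) (tau : C) (c : Z -> C) : Prop :=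
  forall w : C,
    (Cmod (epow tau 1) < Cmod (epow w 1) < / Cmod (epow tau 1))%R ->
    char_den w tau <> 0 ->
    is_Zseries
      (fun k : Z =>
         let m := (2 * k + Z.of_nat l)%Z in
         c m * epow tau (IZR m ^ 2 / (4 * level p p')) * epow w (- (IZR m / 2)))
      (character p p' l w tau).

(* Meaningful for level p p' <> 0 and m congruent to l modulo 2. *)
Definition string_function (p p' l : nat) (m : Z) (tau : C) : C :=
  @iota C_CompleteNormedModule
    (fun v : C => exists c : Z -> C, string_expansion p p' l tau c /\ c m = v).

Definition string_exponent (p p' l : nat) (m : Z) : R :=
  (- (1 / 8) + INR p * (INR l + 1) ^ 2 / (4 * INR p')
   - IZR m ^ 2 / (4 * level p p'))%R.

Definition norm_string_function (p p' l : nat) (m : Z) (tau : C) : C :=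
  epow tau (- string_exponent p p' l m) * string_function p p' l m tau.

(* Main.v *)
Require Import Defs.
From Stdlib Require Import Reals ZArith Lra Lia List Permutation ClassicalEpsilon FunctionalExtensionality.
From Coquelicot Require Import Coquelicot.
From Stdlib Require Import ssreflect.
Import ListNotations.
Open Scope general_if_scope.
Open Scope C_scope.
Set Implicit Arguments.
Unset Strict Implicit.
Unset Printing Implicit Defensive.

(* By the partial fractions (q)^3/j(z;q) = sum_k (-1)^k q^(k(k+1)/2)/(1 - z q^k)
   and geometric expansion in the annulus, (q)^3 C_(0,2r) is a Hecke-type double
   sum over the cone i, N >= 0 minus the cone i, N < 0, with y = q^(r+1/2) as
   elliptic variable.  Summing first over i along the lines u = N + 4i leaves a
   Lambert sum over u, which partial fractions of 1/(1 - T^4) reduce to theta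
   quotients, and Appell sums of level three.  An Appell sum times j lies in a
   two-dimensional space of theta-like functions, so it is determined by its
   values at two points: one of them is elementary, the other one is a multiple
   of omega_3(-q^2) or f_3(q^4).  At y = q^(r+1/2) all remaining theta values are expressed through
   the four numbers j(+-q^(1/2);q^4), j(+-q^(3/2);q^4), and the theta part follows
   from four algebraic relations between them. *)

(** * Unconditional sums *)

(** Two difficulties shape the development. First, [string_function] is an [iota], so the expansion
    of the character must be shown to be unique, although it is only known to converge as two
    one-sided series; an Abel-type bound makes it absolutely convergent on an inner circle, and
    averaging over rotations replaces Fourier integrals. Second, the Appell sums have poles, among
    them the comparison point x = 1; dividing j by 1 - x termwise gives Laurent series on the whole
    punctured plane, and theta-like functions are then studied through recurrences of their
    coefficients, without residues or Liouville's theorem. Degree four leaves four free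
    coefficients, the symmetry under inversion two. The lines u = N + 4i are those along which the
    form 48 i^2 + 16 i N + N^2, in powers of q^(1/2), becomes u^2 + 8 u i, linear in i, so that the
    inner sums are finite geometric ones. Since y is an odd power of q^(1/2) and the partial
    fractions of 1/(1 - T^4) call for a square root of y, everything is written in p = q^(1/4) and P
    = p^2. *)

Definition eqd {I : Type} (x y : I) : {x = y} + {x <> y} :=
  excluded_middle_informative (x = y).

Fixpoint lsum {I : Type} (f : I -> C) (l : list I) : C :=
  match l with nil => 0 | i :: l' => f i + lsum f l' end.

Fixpoint lsumR {I : Type} (f : I -> R) (l : list I) : R :=
  match l with nil => 0%R | i :: l' => (f i + lsumR f l')%R end.

Definition summable {I : Type} (f : I -> C) : Prop :=
  exists M : R, forall l, NoDup l -> (lsumR (fun i => Cmod (f i)) l <= M)%R.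

(** Limit along the directed family of finite duplicate-free lists, so that no enumeration of the
    index type is chosen. *)
Definition has_sum {I : Type} (f : I -> C) (s : C) : Prop :=
  forall eps : R, (0 < eps)%R -> exists l0 : list I, forall l,
    NoDup l -> incl l0 l -> (Cmod (lsum f l - s) < eps)%R.

(* Unconditional summation over an arbitrary index type, so that families may
   be reindexed and regrouped freely. *)
Definition HS {I : Type} (f : I -> C) (s : C) : Prop := summable f /\ has_sum f s.

Lemma lsum_app {I} (f : I -> C) l1 l2 : lsum f (l1 ++ l2) = lsum f l1 + lsum f l2.
Proof. elim: l1 => [|i l IH] /=; [by rewrite Cplus_0_l | by rewrite IH Cplus_assoc]. Qed.

Lemma lsum_plus {I} (f g : I -> C) l :
  lsum (fun i => f i + g i) l = lsum f l + lsum g l.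
Proof. elim: l => [|i l IH] /=; [ring | rewrite IH; ring]. Qed.

Lemma lsum_scal {I} (c : C) (f : I -> C) l : lsum (fun i => c * f i) l = c * lsum f l.
Proof. elim: l => [|i l IH] /=; [ring | rewrite IH; ring]. Qed.

Lemma lsum_map {I K} (f : K -> C) (phi : I -> K) l :
  lsum f (map phi l) = lsum (fun i => f (phi i)) l.
Proof. elim: l => [|i l IH] //=; by rewrite IH. Qed.

Lemma lsum_zero {I} (f : I -> C) l : (forall i, In i l -> f i = 0) -> lsum f l = 0.
Proof.
  elim: l => [|i l IH] //= H. rewrite (H i (or_introl eq_refl)) (IH (fun k Hk => H k (or_intror Hk))).
  ring.
Qed.

Lemma lsum_perm {I} (f : I -> C) l1 l2 : Permutation l1 l2 -> lsum f l1 = lsum f l2.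
Proof.
  elim => [|x a b _ /= ->|x y a|a b c _ -> _ ->] //=. ring.
Qed.

Lemma lsumR_app {I} (f : I -> R) l1 l2 : lsumR f (l1 ++ l2) = (lsumR f l1 + lsumR f l2)%R.
Proof. elim: l1 => [|i l IH] /=; [by rewrite Rplus_0_l | by rewrite IH Rplus_assoc]. Qed.

Lemma lsumR_map {I K} (f : K -> R) (phi : I -> K) l :
  lsumR f (map phi l) = lsumR (fun i => f (phi i)) l.
Proof. elim: l => [|i l IH] //=; by rewrite IH. Qed.

Lemma lsumR_plus {I} (f g : I -> R) l :
  lsumR (fun i => (f i + g i)%R) l = (lsumR f l + lsumR g l)%R.
Proof. elim: l => [|i l IH] /=; [ring | rewrite IH; ring]. Qed.

Lemma lsumR_scal {I} (c : R) (f : I -> R) l :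
  lsumR (fun i => (c * f i)%R) l = (c * lsumR f l)%R.
Proof. elim: l => [|i l IH] /=; [ring | rewrite IH; ring]. Qed.

Lemma lsumR_le {I} (f g : I -> R) l :
  (forall i, In i l -> (f i <= g i)%R) -> (lsumR f l <= lsumR g l)%R.
Proof.
  elim: l => [|i l IH] H /=; first lra.
  have H1 := H i (or_introl eq_refl).
  have := IH (fun k Hk => H k (or_intror Hk)). lra.
Qed.

Lemma lsumR_pos {I} (f : I -> R) l : (forall i, (0 <= f i)%R) -> (0 <= lsumR f l)%R.
Proof. move=> H; elim: l => [|i l IH] /=; first lra. have := H i; lra. Qed.

Lemma lsumR_incl {I} (f : I -> R) l1 l2 : (forall i, (0 <= f i)%R) ->
  NoDup l1 -> incl l1 l2 -> (lsumR f l1 <= lsumR f l2)%R.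
Proof.
  move=> Hf; elim: l1 l2 => [|i l1 IH] l2 Hn Hi; first exact: lsumR_pos.
  inversion_clear Hn as [|? ? Hni Hn1].
  have [a [b Eb]] := in_split i l2 (Hi i (or_introl eq_refl)).
  have H : (lsumR f l1 <= lsumR f (a ++ b))%R.
  { apply: IH => // k Hk. have := Hi k (or_intror Hk).
    rewrite Eb !in_app_iff /= => -[?|[E|?]]; auto. by subst. }
  rewrite Eb lsumR_app /=; rewrite lsumR_app in H; lra.
Qed.

Lemma Cmod_lsum {I} (f : I -> C) l : (Cmod (lsum f l) <= lsumR (fun i => Cmod (f i)) l)%R.
Proof.
  elim: l => [|i l IH] /=; first (rewrite Cmod_0; lra).
  have := Cmod_triangle (f i) (lsum f l); lra.
Qed.

Lemma nodup_super {I} (l : list I) : exists l', NoDup l' /\ incl l l'.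
Proof.
  exists (nodup eqd l); split; first exact: NoDup_nodup.
  by move=> x Hx; apply/nodup_In.
Qed.

Lemma NoDup_map_inj {I K} (phi : I -> K) l :
  (forall i i', phi i = phi i' -> i = i') -> NoDup l -> NoDup (map phi l).
Proof.
  move=> inj; elim: l => [|i l IH] H /=; first by constructor.
  inversion_clear H as [|? ? Hni Hn]. constructor; last exact: IH.
  by move=> /in_map_iff [k [/inj E Hk]]; subst.
Qed.

Lemma has_sum_unique {I} (f : I -> C) s t : has_sum f s -> has_sum f t -> s = t.
Proof.
  move=> Hs Ht; apply: Classical_Prop.NNPP => Hne.
  have Hp : (0 < Cmod (s - t))%R.
  { apply/Cmod_gt_0 => E; apply: Hne. have -> : s = s - t + t by ring. rewrite E; ring. }
  have Hh : (0 < Cmod (s - t) / 2)%R by lra.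
  have [l1 H1] := Hs _ Hh. have [l2 H2] := Ht _ Hh.
  have [l [Hn Hi]] := nodup_super (l1 ++ l2).
  have I1 := H1 l Hn (fun x Hx => Hi x (in_or_app _ _ _ (or_introl Hx))).
  have I2 := H2 l Hn (fun x Hx => Hi x (in_or_app _ _ _ (or_intror Hx))).
  have E : s - t = (lsum f l - t) - (lsum f l - s) by ring.
  have := Cmod_triangle (lsum f l - t) (- (lsum f l - s)).
  rewrite Cmod_opp -/(Cminus _ _) -E. lra.
Qed.

Lemma HS_unique {I} (f : I -> C) s t : HS f s -> HS f t -> s = t.
Proof. move=> [_ H1] [_ H2]; exact: has_sum_unique H1 H2. Qed.

Lemma HS_ext {I} (f g : I -> C) s : (forall i, f i = g i) -> HS f s -> HS g s.
Proof. by move=> /functional_extensionality ->. Qed.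

Lemma summable_le {I} (f g : I -> C) :
  (forall i, (Cmod (f i) <= Cmod (g i))%R) -> summable g -> summable f.
Proof.
  move=> H [M HM]; exists M => l Hl.
  apply: Rle_trans (HM l Hl). by apply: lsumR_le => i _.
Qed.

Lemma summable_scal {I} (c : C) (f : I -> C) : summable f -> summable (fun i => c * f i).
Proof.
  move=> [M HM]; exists (Cmod c * M)%R => l Hl.
  have := HM l Hl => H1.
  apply: Rle_trans (Rmult_le_compat_l _ _ _ (Cmod_ge_0 c) H1).
  rewrite -lsumR_scal; apply: lsumR_le => i _; rewrite Cmod_mult; lra.
Qed.

Lemma summable_plus {I} (f g : I -> C) :
  summable f -> summable g -> summable (fun i => f i + g i).
Proof.
  move=> [M HM] [M' HM']; exists (M + M')%R => l Hl.
  have := HM l Hl; have := HM' l Hl => H1 H2.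
  apply: Rle_trans (_ : (lsumR (fun i => (Cmod (f i) + Cmod (g i))%R) l <= _)%R).
  - apply: lsumR_le => i _; exact: Cmod_triangle.
  - rewrite lsumR_plus; lra.
Qed.

Lemma has_sum_scal {I} (c : C) (f : I -> C) s :
  has_sum f s -> has_sum (fun i => c * f i) (c * s).
Proof.
  move=> H eps He.
  have Hc := Cmod_ge_0 c.
  have He' : (0 < eps / (Cmod c + 1))%R by apply: Rdiv_lt_0_compat; lra.
  have [l0 H0] := H _ He'. exists l0 => l Hn Hi.
  rewrite lsum_scal -(_ : c * (lsum f l - s) = c * lsum f l - c * s); last ring.
  rewrite Cmod_mult. have H1 := H0 l Hn Hi. have H2 := Cmod_ge_0 (lsum f l - s).
  apply: Rle_lt_trans (_ : (Cmod c * (eps / (Cmod c + 1)) < eps)%R); first nra.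
  apply: (Rmult_lt_reg_r (Cmod c + 1)); first lra.
  have -> : (Cmod c * (eps / (Cmod c + 1)) * (Cmod c + 1) = Cmod c * eps)%R by field; lra.
  nra.
Qed.

Lemma has_sum_plus {I} (f g : I -> C) s t :
  has_sum f s -> has_sum g t -> has_sum (fun i => f i + g i) (s + t).
Proof.
  move=> Hf Hg eps He. have He2 : (0 < eps / 2)%R by lra.
  have [l1 H1] := Hf _ He2. have [l2 H2] := Hg _ He2.
  exists (l1 ++ l2) => l Hn Hi.
  have I1 := H1 l Hn (fun x Hx => Hi x (in_or_app _ _ _ (or_introl Hx))).
  have I2 := H2 l Hn (fun x Hx => Hi x (in_or_app _ _ _ (or_intror Hx))).
  rewrite lsum_plus.
  have -> : lsum f l + lsum g l - (s + t) = (lsum f l - s) + (lsum g l - t) by ring.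
  have := Cmod_triangle (lsum f l - s) (lsum g l - t). lra.
Qed.

Lemma HS_scal {I} (c : C) (f : I -> C) s : HS f s -> HS (fun i => c * f i) (c * s).
Proof. by move=> [H1 H2]; split; [exact: summable_scal | exact: has_sum_scal]. Qed.

Lemma HS_plus {I} (f g : I -> C) s t :
  HS f s -> HS g t -> HS (fun i => f i + g i) (s + t).
Proof.
  by move=> [H1 H2] [H3 H4]; split; [exact: summable_plus | exact: has_sum_plus].
Qed.

Lemma HS_opp {I} (f : I -> C) s : HS f s -> HS (fun i => - f i) (- s).
Proof.
  move=> H; have -> : - s = -(1) * s by ring.
  apply: HS_ext (HS_scal (-(1)) H) => i; ring.
Qed.

Lemma HS_minus {I} (f g : I -> C) s t :
  HS f s -> HS g t -> HS (fun i => f i - g i) (s - t).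
Proof. move=> Hf Hg; exact: (HS_plus Hf (HS_opp Hg)). Qed.

Lemma HS_zero {I : Type} : HS (fun _ : I => 0) 0.
Proof.
  have E (l : list I) : lsum (fun _ : I => 0) l = 0 by apply: lsum_zero.
  split.
  - exists 0%R => l _; rewrite Cmod_0; elim: l => [|i l IH] /=; lra.
  - move=> eps He; exists nil => l _ _; rewrite E.
    have -> : 0 - 0 = 0 by ring. by rewrite Cmod_0.
Qed.

Lemma HS_finite {I} (f : I -> C) (l0 : list I) :
  NoDup l0 -> (forall i, ~ In i l0 -> f i = 0) -> HS f (lsum f l0).
Proof.
  move=> Hn0 Hz.
  (* A list containing [l0] is, up to permutation, [l0] followed by indices at which [f]
     vanishes. *)
  have key l : NoDup l -> incl l0 l -> lsum f l = lsum f l0.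
  { move=> Hn Hi.
    have [l' [Hp Hnot]] : exists l', Permutation l (l0 ++ l') /\ forall i, In i l' -> ~ In i l0.
    { exists (filter (fun i => if in_dec eqd i l0 then false else true) l); split.
      - apply: NoDup_Permutation => //.
        + apply: NoDup_app => //; first exact: NoDup_filter.
          move=> i Hi0 /filter_In [_]; case: in_dec => //.
        + move=> i; rewrite in_app_iff filter_In; split.
          * move=> H; case: (in_dec eqd i l0) => H'; [by left | by right].
          * by move=> [/Hi|[]].
      - move=> i /filter_In [_]; case: in_dec => //. }
    rewrite (lsum_perm _ Hp) lsum_app (_ : lsum f l' = 0); first ring.
    apply: lsum_zero => i Hi'; apply: Hz; exact: Hnot. }
  split.
  - exists (lsumR (fun i => Cmod (f i)) l0) => l Hn.
    (* Here [l'] and [Hp] are the parts of [l] inside and outside [l0], and [Hin] is the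
       permutation. *)
    have [l' [Hp [Hin Hnot]]] : exists l1 l2, Permutation l (l1 ++ l2) /\ NoDup l1 /\ (incl l1 l0 /\ forall i, In i l2 -> ~ In i l0).
    { exists (filter (fun i => if in_dec eqd i l0 then true else false) l),
             (filter (fun i => if in_dec eqd i l0 then false else true) l); split; [|split;[|split]].
      - apply: NoDup_Permutation => //.
        + apply: NoDup_app; try exact: NoDup_filter.
          move=> i /filter_In [_ H] /filter_In [_]; move: H; case: in_dec => //.
        + move=> i; rewrite in_app_iff !filter_In; case: in_dec; tauto.
      - exact: NoDup_filter.
      - move=> i /filter_In [_]; case: in_dec => //.
      - move=> i /filter_In [_]; case: in_dec => //. }
    have E2 : lsumR (fun i => Cmod (f i)) Hp = 0%R.
    { case: Hnot => _ [_]. elim: (Hp) => [|i k IH] //= H.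
      rewrite Hz ?Cmod_0 ?IH ?Rplus_0_l //; first by move=> x Hx; apply: H; right.
      by apply: H; left. }
    have PR : lsumR (fun i => Cmod (f i)) l = lsumR (fun i => Cmod (f i)) (l' ++ Hp).
    { elim: Hin => [|x a b _ /= ->|x y a|a b c _ -> _ ->] //=. ring. }
    rewrite PR lsumR_app E2 Rplus_0_r.
    apply: lsumR_incl; [move=> i; exact: Cmod_ge_0 | tauto | tauto].
  - move=> eps He; exists l0 => l Hn Hi; rewrite key //.
    have -> : lsum f l0 - lsum f l0 = 0 by ring. by rewrite Cmod_0.
Qed.

Lemma HS_single {I} (f : I -> C) (i0 : I) : (forall i, i <> i0 -> f i = 0) -> HS f (f i0).
Proof.
  move=> H. have := @HS_finite _ f [i0]. rewrite /= Cplus_0_r; apply.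
  - constructor; [auto | constructor].
  - by move=> i Hi; apply: H => E; apply: Hi; left.
Qed.

(** Finite sums of nonnegative terms grow with the list, so their supremum is the limit. *)
Lemma nonneg_has_sum {I} (g : I -> R) (M : R) : (forall i, (0 <= g i)%R) ->
  (forall l, NoDup l -> (lsumR g l <= M)%R) ->
  exists s, forall eps, (0 < eps)%R -> exists l0, forall l, NoDup l -> incl l0 l ->
    (Rabs (lsumR g l - s) < eps)%R.
Proof.
  move=> Hg HM.
  have [s [Hub Hlub]] : {m | is_lub (fun x => exists l, NoDup l /\ x = lsumR g l) m}.
  { apply: completeness.
    - by exists M => x [l [Hl ->]]; exact: HM.
    - by exists 0%R, nil; split; first constructor. }
  exists s => eps He.
  have [l0 [Hn0 H0]] : exists l0, NoDup l0 /\ (s - eps < lsumR g l0)%R.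
  { apply: Classical_Prop.NNPP => Hno.
    have : (s <= s - eps)%R.
    { apply: Hlub => x [l [Hl ->]]. apply: Rnot_lt_le => H; apply: Hno; by exists l. }
    lra. }
  exists l0 => l Hn Hi.
  have H1 := lsumR_incl Hg Hn0 Hi.
  have H2 : (lsumR g l <= s)%R by apply: Hub; exists l.
  rewrite Rabs_left1; lra.
Qed.

Lemma Cmod_le_RI (z : C) : (Cmod z <= Rabs (Re z) + Rabs (Im z))%R.
Proof.
  have {1}-> : z = RtoC (Re z) + Ci * RtoC (Im z).
  { case: z => a b; rewrite /RtoC /Ci /Cmult /Cplus /=; f_equal; ring. }
  apply: Rle_trans (Cmod_triangle _ _) _.
  rewrite Cmod_mult Cmod_Ci !Cmod_R; lra.
Qed.

Lemma im_le_Cmod (z : C) : (Rabs (Im z) <= Cmod z)%R.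
Proof. exact: Rle_trans (Rmax_r _ _) (Rmax_Cmod z). Qed.

Lemma lsum_Re {I} (f : I -> C) l : Re (lsum f l) = lsumR (fun i => Re (f i)) l.
Proof. by elim: l => [|i l IH] //=; rewrite -IH. Qed.

Lemma lsum_Im {I} (f : I -> C) l : Im (lsum f l) = lsumR (fun i => Im (f i)) l.
Proof. by elim: l => [|i l IH] //=; rewrite -IH. Qed.

Lemma summable_has_sum {I} (f : I -> C) : summable f -> exists s, has_sum f s.
Proof.
  move=> [M HM].
  (* For [u] the real or the imaginary part, both |f| and |f| + u(f) are nonnegative with bounded
     sums; the difference of their limits sums u(f). *)
  have part (u : C -> R) : (forall z, (Rabs (u z) <= Cmod z)%R) ->
    exists s, forall eps, (0 < eps)%R -> exists l0, forall l, NoDup l -> incl l0 l ->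
      (Rabs (lsumR (fun i => u (f i)) l - s) < eps)%R.
  { move=> Hu.
    have [s1 H1] := @nonneg_has_sum I (fun i => Cmod (f i)) M (fun i => Cmod_ge_0 _) HM.
    have [s2 H2] : exists s, forall eps, (0 < eps)%R -> exists l0, forall l, NoDup l -> incl l0 l ->
      (Rabs (lsumR (fun i => (Cmod (f i) + u (f i))%R) l - s) < eps)%R.
    { apply: (@nonneg_has_sum I _ (2 * M)%R) => [i|l Hl].
      - have := Hu (f i); split_Rabs; lra.
      - apply: Rle_trans (_ : (lsumR (fun i => (2 * Cmod (f i))%R) l <= _)%R).
        + apply: lsumR_le => i _; have := Hu (f i); split_Rabs; lra.
        + rewrite lsumR_scal; have := HM l Hl; lra. }
    exists (s2 - s1)%R => eps He. have He2 : (0 < eps / 2)%R by lra.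
      have [l1 I1] := H1 _ He2. have [l2 I2] := H2 _ He2.
      exists (l1 ++ l2) => l Hn Hi.
      have J1 := I1 l Hn (fun x Hx => Hi x (in_or_app _ _ _ (or_introl Hx))).
      have J2 := I2 l Hn (fun x Hx => Hi x (in_or_app _ _ _ (or_intror Hx))).
      move: J2; rewrite lsumR_plus => J2. move: J1 J2; split_Rabs; lra. }
  have [s H1] := part Re re_le_Cmod. have [t H2] := part Im im_le_Cmod.
  exists (s, t) => eps He. have He2 : (0 < eps / 2)%R by lra.
  have [l1 I1] := H1 _ He2. have [l2 I2] := H2 _ He2.
  exists (l1 ++ l2) => l Hn Hi.
  have J1 := I1 l Hn (fun x Hx => Hi x (in_or_app _ _ _ (or_introl Hx))).
  have J2 := I2 l Hn (fun x Hx => Hi x (in_or_app _ _ _ (or_intror Hx))).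
  apply: Rle_lt_trans (Cmod_le_RI _) _.
  have -> : Re (lsum f l - (s, t)) = (lsumR (fun i => Re (f i)) l - s)%R by rewrite -lsum_Re.
  have -> : Im (lsum f l - (s, t)) = (lsumR (fun i => Im (f i)) l - t)%R by rewrite -lsum_Im.
  lra.
Qed.

Lemma summable_HS {I} (f : I -> C) : summable f -> exists s, HS f s.
Proof. by move=> H; have [s Hs] := summable_has_sum H; exists s. Qed.

Lemma HS_le {I} (f : I -> C) s (M : R) :
  (forall l, NoDup l -> (lsumR (fun i => Cmod (f i)) l <= M)%R) -> has_sum f s ->
  (Cmod s <= M)%R.
Proof.
  move=> HM Hs; apply: Rnot_lt_le => Hlt.
  have [l0 H0] := Hs (Cmod s - M)%R ltac:(lra).
  have [l [Hn Hi]] := nodup_super l0.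
  have H1 := H0 l Hn Hi. have H2 := HM l Hn. have H3 := Cmod_lsum f l.
  have E : s = lsum f l - (lsum f l - s) by ring.
  have := Cmod_triangle (lsum f l) (- (lsum f l - s)).
  rewrite Cmod_opp -/(Cminus _ _) -E; lra.
Qed.

Lemma summable_inj {I K} (f : K -> C) (phi : I -> K) :
  (forall i i', phi i = phi i' -> i = i') -> summable f -> summable (fun i => f (phi i)).
Proof.
  move=> inj [M HM]; exists M => l Hl.
  have := HM (map phi l) (NoDup_map_inj inj Hl). by rewrite lsumR_map.
Qed.

(** Only the elements of [l] in the range of [phi] contribute, and injectivity lets them be pulled
    back to a duplicate-free list. *)
Lemma lsum_inj_split {I K} (f : K -> C) (phi : I -> K) (l : list K) :
  (forall i i', phi i = phi i' -> i = i') ->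
  (forall k, (forall i, phi i <> k) -> f k = 0) -> NoDup l ->
  exists l', NoDup l' /\ (forall i, In i l' <-> In (phi i) l) /\
    lsum f l = lsum (fun i => f (phi i)) l' /\
    lsumR (fun k => Cmod (f k)) l = lsumR (fun i => Cmod (f (phi i))) l'.
Proof.
  move=> inj Hz; elim: l => [|k l IH] Hn.
  - by exists nil; split; [constructor | split].
  - inversion_clear Hn as [|? ? Hk Hn1]. have [l' [H1 [H2 [H3 H4]]]] := IH Hn1.
    case: (excluded_middle_informative (exists i, phi i = k)) => [[i Ei]|Hne].
    + exists (i :: l'); split; [|split; [|split]] => /=.
      * constructor => //. by move=> /H2; rewrite Ei.
      * move=> i'; rewrite H2; split; move=> [E|?]; try (by right); left.
        -- by rewrite -E. -- by apply: inj; rewrite Ei.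
      * by rewrite H3 Ei.
      * by rewrite H4 Ei.
    + have Z : f k = 0 by apply: Hz => i E; apply: Hne; exists i.
      exists l'; split => //; split; [|split] => /=.
      * move=> i; rewrite H2; split; first by right.
        move=> [E|] //. by case: Hne; exists i.
      * by rewrite Z H3 Cplus_0_l.
      * by rewrite Z H4 Cmod_0 Rplus_0_l.
Qed.

Lemma HS_inj {I K} (f : K -> C) (phi : I -> K) s :
  (forall i i', phi i = phi i' -> i = i') ->
  (forall k, (forall i, phi i <> k) -> f k = 0) ->
  HS (fun i => f (phi i)) s <-> HS f s.
Proof.
  move=> inj Hz; split; move=> [Hs Hh]; split.
  - case: Hs => M HM; exists M => l Hl.
    have [l' [H1 [_ [_ ->]]]] := lsum_inj_split inj Hz Hl. exact: HM.
  - move=> eps He; have [l0 H0] := Hh _ He. exists (map phi l0) => l Hn Hi.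
    have [l' [H1 [H2 [-> _]]]] := lsum_inj_split inj Hz Hn.
    apply: H0 => // i Hi0; apply/H2; apply: Hi; exact: in_map.
  - exact: summable_inj.
  - move=> eps He; have [l0 H0] := Hh _ He.
    have [l1 [Hn1 Hi1]] := nodup_super l0.
    have [l1' [_ [H2 _]]] := lsum_inj_split inj Hz Hn1.
    exists l1' => l Hn Hi.
    (* Appending these elements to [map phi l] yields a list containing [l0] with the same sum: [l]
       already has all preimages of [l1], so [f] vanishes on [l2]. *)
    set l2 := filter (fun k => if in_dec eqd k (map phi l) then false else true) l1.
    have Z2 : forall k, In k l2 -> f k = 0.
    { move=> k /filter_In [Hk]; case: in_dec => // Hnk _. apply: Hz => i E; apply: Hnk.
      rewrite -E; apply: in_map; apply: Hi; apply/H2; by rewrite E. }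
    have := H0 (map phi l ++ l2). rewrite lsum_app lsum_map (lsum_zero Z2) Cplus_0_r; apply.
    + apply: NoDup_app; [exact: NoDup_map_inj | exact: NoDup_filter |].
      move=> k Hk /filter_In [_]; case: in_dec => //.
    + move=> k /Hi1 Hk; apply/in_app_iff.
      case: (in_dec eqd k (map phi l)) => Hd; [by left | right].
      apply/filter_In; split => //; by case: in_dec.
Qed.

Lemma HS_bij {I K} (f : K -> C) (phi : I -> K) (psi : K -> I) s :
  (forall i, psi (phi i) = i) -> (forall k, phi (psi k) = k) ->
  HS f s -> HS (fun i => f (phi i)) s.
Proof.
  move=> H1 H2; apply: (proj2 (HS_inj _ _ _)).
  - by move=> i i' E; rewrite -(H1 i) E H1.
  - by move=> k Hk; case: (Hk (psi k)).
Qed.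

(** Each fibre over [l] is replaced by a finite part, with the allowed error halved from one fibre
    to the next. Keeping the prescribed pairs [l0] makes the resulting list large enough for the
    convergence of the double sum. *)
Lemma approx_fibres {I K} (f : I * K -> C) (g : I -> C) (l0 : list (I * K)) (l : list I) eps :
  (0 < eps)%R -> (forall i, has_sum (fun k => f (i, k)) (g i)) -> NoDup l ->
  exists L, NoDup L /\ (forall i k, In (i, k) L -> In i l) /\
    (forall i k, In (i, k) l0 -> In i l -> In (i, k) L) /\
    (Cmod (lsum f L - lsum g l) <= eps)%R /\
    (lsumR (fun i => Cmod (g i)) l <= lsumR (fun p => Cmod (f p)) L + eps)%R.
Proof.
  move=> He Hg; elim: l eps He => [|i l IH] eps He Hn.
  - exists nil; split; first constructor. split => //; split => //=.
    have -> : 0 - 0 = 0 by ring. rewrite Cmod_0; lra.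
  - inversion_clear Hn as [|? ? Hi Hn1].
    have He2 : (0 < eps / 2)%R by lra.
    have [L [H1 [H2 [H3 [H4 H5]]]]] := IH _ He2 Hn1.
    have [k0 Hk0] := Hg i _ He2.
    have [lk [Hnk Hik]] := nodup_super (k0 ++ map snd l0).
    exists (map (fun k => (i, k)) lk ++ L); split; [|split; [|split]].
    + apply: NoDup_app => //.
      * by apply: NoDup_map_inj => // a b [].
      * move=> p /in_map_iff [k [<- _]] /H2 //.
    + move=> i' k /in_app_iff [/in_map_iff [k' [[<- _] _]]|/H2 ?]; [by left | by right].
    + move=> i' k Hp [E|Hl]; apply/in_app_iff; last by right; exact: H3.
      left; subst i'. apply/in_map_iff; exists k; split => //. apply: Hik; apply/in_app_iff; right.
      apply/in_map_iff; by exists (i, k).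
    + have Hb := Hk0 lk Hnk (fun x Hx => Hik x (in_or_app _ _ _ (or_introl Hx))).
      rewrite lsum_app lsum_map lsumR_app lsumR_map /=; split.
      * have -> : lsum (fun k => f (i, k)) lk + lsum f L - (g i + lsum g l)
          = (lsum (fun k => f (i, k)) lk - g i) + (lsum f L - lsum g l) by ring.
        have := Cmod_triangle (lsum (fun k => f (i, k)) lk - g i) (lsum f L - lsum g l). lra.
      * have E : g i = lsum (fun k => f (i, k)) lk - (lsum (fun k => f (i, k)) lk - g i) by ring.
        have := Cmod_triangle (lsum (fun k => f (i, k)) lk) (- (lsum (fun k => f (i, k)) lk - g i)).
        rewrite Cmod_opp -/(Cminus _ _) -E.
        have := Cmod_lsum (fun k => f (i, k)) lk. lra.
Qed.

(** By [approx_fibres], a partial sum of [g] is close to a partial sum of [f] over a large list,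
    which is close to [s]; with error 1 the same argument bounds the moduli. *)
Lemma HS_fubini {I K} (f : I * K -> C) (g : I -> C) s :
  HS f s -> (forall i, HS (fun k => f (i, k)) (g i)) -> HS g s.
Proof.
  move=> [[M HM] Hs] Hg; have Hg' i := proj2 (Hg i); split.
  - exists (M + 1)%R => l Hl.
    have [L [H1 [_ [_ [_ H5]]]]] := approx_fibres nil Rlt_0_1 Hg' Hl.
    have := HM L H1; lra.
  - move=> eps He. have He2 : (0 < eps / 2)%R by lra.
    have [l0 H0] := Hs _ He2.
    exists (map fst l0) => l Hn Hi.
    have [L [H1 [_ [H3 [H4 _]]]]] := approx_fibres l0 (ltac:(lra) : (0 < eps / 4)%R) Hg' Hn.
    have H6 : (Cmod (lsum f L - s) < eps / 2)%R.
    { apply: H0 => // [[i k]] Hp; apply: H3 => //; apply: Hi. apply/in_map_iff; by exists (i, k). }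
    have -> : lsum g l - s = (lsum f L - s) - (lsum f L - lsum g l) by ring.
    have := Cmod_triangle (lsum f L - s) (- (lsum f L - lsum g l)).
    rewrite Cmod_opp -/(Cminus _ _); lra.
Qed.

Lemma summable_fibre {I K} (f : I * K -> C) i : summable f -> summable (fun k => f (i, k)).
Proof. by apply: summable_inj => a b []. Qed.

Lemma HS_swap {I K} (f : I * K -> C) s : HS f s -> HS (fun p => f (snd p, fst p)) s.
Proof. apply: (HS_bij (phi := fun p => (snd p, fst p)) (psi := fun p => (snd p, fst p))); by case. Qed.

Lemma HS_regroup {I K} (f : K -> C) (phi : K -> I) s : HS f s ->
  exists g, (forall i, HS (fun k => if eqd (phi k) i then f k else 0) (g i)) /\ HS g s.
Proof.
  move=> Hf.
  (* The family lives on the graph of [phi], extended by zero; its fibre over [i] is the group of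
     terms belonging to [i], so Fubini applies. *)
  pose F := fun p : I * K => if eqd (phi (snd p)) (fst p) then f (snd p) else 0.
  have HF : HS F s.
  { apply: (proj1 (HS_inj (phi := fun k => (phi k, k)) _ _ _)).
    - by move=> k k' [].
    - move=> [i k] Hk; rewrite /F /=; case: eqd => // E. by case: (Hk k); rewrite E.
    - apply: HS_ext Hf => k; rewrite /F /=. by case: eqd. }
  have Hi i : exists t, HS (fun k => F (i, k)) t.
  { apply: summable_HS; exact: summable_fibre (proj1 HF). }
  exists (fun i => proj1_sig (constructive_indefinite_description _ (Hi i))).
  have Hg i : HS (fun k => F (i, k)) (proj1_sig (constructive_indefinite_description _ (Hi i)))
    by case: constructive_indefinite_description.
  split; first exact: Hg. exact: HS_fubini HF Hg.
Qed.

(** Every finite set of pairs sits in a rectangle, where the sum of moduli factors. *)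
Lemma summable_prod {I K} (a : I -> C) (b : K -> C) :
  summable a -> summable b -> summable (fun p => a (fst p) * b (snd p)).
Proof.
  move=> [M HM] [M' HM']. exists (M * M')%R => l Hl.
  have [l1 [Hn1 Hi1]] := nodup_super (map fst l).
  have [l2 [Hn2 Hi2]] := nodup_super (map snd l).
  apply: Rle_trans (_ : (lsumR (fun p => Cmod (a (fst p) * b (snd p))) (list_prod l1 l2) <= _)%R).
  - apply: lsumR_incl => // [p|[i k] Hp]; first exact: Cmod_ge_0.
    apply/in_prod; [apply: Hi1 | apply: Hi2]; apply/in_map_iff; by exists (i, k).
  - have -> : lsumR (fun p => Cmod (a (fst p) * b (snd p))) (list_prod l1 l2)
      = (lsumR (fun i => Cmod (a i)) l1 * lsumR (fun k => Cmod (b k)) l2)%R.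
    { elim: (l1) => [|i l1' IH] /=; first ring.
      rewrite lsumR_app lsumR_map IH Rmult_plus_distr_r. congr (_ + _)%R.
      elim: (l2) => [|k l2' IH2] /=; [ring | rewrite IH2 Cmod_mult; ring]. }
    have := HM l1 Hn1; have := HM' l2 Hn2.
    have : (0 <= lsumR (fun i => Cmod (a i)) l1)%R by apply: lsumR_pos => i; exact: Cmod_ge_0.
    have : (0 <= lsumR (fun i => Cmod (b i)) l2)%R by apply: lsumR_pos => i; exact: Cmod_ge_0.
    nra.
Qed.

Lemma HS_prod {I K} (a : I -> C) (b : K -> C) s t :
  HS a s -> HS b t -> HS (fun p => a (fst p) * b (snd p)) (s * t).
Proof.
  move=> Ha Hb. have [u Hu] := summable_HS (summable_prod (proj1 Ha) (proj1 Hb)).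
  suff -> : s * t = u by [].
  have H1 : HS (fun i => t * a i) u.
  { apply: (HS_fubini Hu) => i /=. rewrite Cmult_comm. exact: HS_scal. }
  have := HS_unique H1 (HS_scal t Ha) => ->; ring.
Qed.

(** Tannery's theorem. A finite list carries almost all of the dominating sum, so the tails are
    small uniformly in n; on the list itself pointwise convergence is enough. *)
Lemma HS_dominated {I} (f : nat -> I -> C) (f' : I -> C) (g : I -> C) (s : nat -> C) s' :
  summable g -> (forall n i, (Cmod (f n i) <= Cmod (g i))%R) ->
  (forall i eps, (0 < eps)%R -> exists N, forall n, (N <= n)%nat -> (Cmod (f n i - f' i) < eps)%R) ->
  (forall n, HS (f n) (s n)) -> HS f' s' ->
  forall eps, (0 < eps)%R -> exists N, forall n, (N <= n)%nat -> (Cmod (s n - s') < eps)%R.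
Proof.
  move=> Hg Hfg Hlim Hs Hs' eps He.
  have [M HM] := Hg.
  have [S HS'] := @nonneg_has_sum I (fun i => Cmod (g i)) M (fun i => Cmod_ge_0 _) HM.
  have [l0 H0] := HS' (eps / 8)%R ltac:(lra).
  have [l1 H1] := (proj2 Hs') (eps / 8)%R ltac:(lra).
  have [L [HnL HiL]] := nodup_super (l0 ++ l1).
  have HL := H0 L HnL (fun x Hx => HiL x (in_or_app _ _ _ (or_introl Hx))).
  have tail n : (Cmod (lsum (f n) L - s n) <= eps / 2)%R.
  { have [l2 H2] := proj2 (Hs n) (eps / 8)%R ltac:(lra).
    set l3 := filter (fun i => if in_dec eqd i L then false else true) (nodup eqd l2).
    have Hn : NoDup (L ++ l3).
    { apply: NoDup_app => //; first by apply: NoDup_filter; exact: NoDup_nodup.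
      move=> i Hi /filter_In [_]; case: in_dec => //. }
    have I2 : (Cmod (lsum (f n) (L ++ l3) - s n) < eps / 8)%R.
    { apply: H2 => // i Hi; apply/in_app_iff; case: (in_dec eqd i L) => HiL'; [by left | right].
      apply/filter_In; split; first by apply/nodup_In. by case: in_dec. }
    have I3 : (Rabs (lsumR (fun i => Cmod (g i)) (L ++ l3) - S) < eps / 8)%R.
    { apply: H0 => // i Hi; apply/in_app_iff; left; apply: HiL; apply/in_app_iff; by left. }
    rewrite lsumR_app in I3; rewrite lsum_app in I2.
    have I4 := Cmod_lsum (f n) l3.
    have I5 : (lsumR (fun i => Cmod (f n i)) l3 <= lsumR (fun i => Cmod (g i)) l3)%R
      by apply: lsumR_le => i _; exact: Hfg.
    have E : lsum (f n) L - s n = (lsum (f n) L + lsum (f n) l3 - s n) - lsum (f n) l3 by ring.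
    have := Cmod_triangle (lsum (f n) L + lsum (f n) l3 - s n) (- lsum (f n) l3).
    rewrite Cmod_opp -/(Cminus _ _) -E.
    move: HL I3; split_Rabs; lra. }
  have tail' := H1 L HnL (fun x Hx => HiL x (in_or_app _ _ _ (or_intror Hx))).
  have [N HN] : exists N, forall n, (N <= n)%nat -> (Cmod (lsum (f n) L - lsum f' L) < eps / 8)%R.
  { have He8 : (0 < eps / 8)%R by lra. move: (eps / 8)%R He8.
    elim: (L) => [|i l IH] e He8 /=.
    - exists 0%nat => n _. have -> : 0 - 0 = 0 by ring. by rewrite Cmod_0.
    - have [N1 I1] := Hlim i (e / 2)%R ltac:(lra). have [N2 I2] := IH (e / 2)%R ltac:(lra).
      exists (N1 + N2)%nat => n Hn.
      have := I1 n ltac:(lia); have := I2 n ltac:(lia).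
      have -> : f n i + lsum (f n) l - (f' i + lsum f' l) = (f n i - f' i) + (lsum (f n) l - lsum f' l) by ring.
      have := Cmod_triangle (f n i - f' i) (lsum (f n) l - lsum f' l). lra. }
  exists N => n Hn. have H3 := HN n Hn. have H4 := tail n.
  have -> : s n - s' = - (lsum (f n) L - s n) + ((lsum (f n) L - lsum f' L) + (lsum f' L - s')) by ring.
  have := Cmod_triangle (- (lsum (f n) L - s n)) ((lsum (f n) L - lsum f' L) + (lsum f' L - s')).
  have := Cmod_triangle (lsum (f n) L - lsum f' L) (lsum f' L - s').
  rewrite Cmod_opp; lra.
Qed.

(** * Limits of complex sequences, and the link with series and infinite products *)

Definition clim (u : nat -> C) (s : C) : Prop :=
  forall eps, (0 < eps)%R -> exists N, forall n, (N <= n)%nat -> (Cmod (u n - s) < eps)%R.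

Lemma clim_filterlim (u : nat -> C) (s : C) :
  clim u s <-> filterlim u eventually (@locally C_UniformSpace s).
Proof.
  split.
  - move=> H; apply/(@filterlim_locally nat C_UniformSpace) => eps.
    have [N HN] := H eps (cond_pos eps). exists N => n Hn.
    apply: C_NormedModule_mixin_compat1. exact: HN.
  - move=> /(@filterlim_locally nat C_UniformSpace) H eps He.
    (* Balls of the product uniform structure are squares, so the modulus is only below sqrt 2 times
       the radius; half of [eps] makes up for it. *)
    have He' : (0 < eps / 2)%R by lra.
    have [N HN] := H (mkposreal _ He'). exists N => n Hn.
    have := @C_NormedModule_mixin_compat2 s (u n) (mkposreal _ He') (HN n Hn) => /= Hb.
    have Hs : (sqrt 2 < 2)%R.
    { have E : sqrt 4 = 2%R by rewrite (_ : 4 = 2 * 2)%R ?sqrt_square; lra.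
      rewrite -{2}E; apply: sqrt_lt_1; lra. }
    apply: Rlt_trans Hb _. nra.
Qed.

Lemma clim_unique u (s t : C) : clim u s -> clim u t -> s = t.
Proof.
  move=> Hs Ht; apply: Classical_Prop.NNPP => Hne.
  have Hp : (0 < Cmod (s - t))%R.
  { apply/Cmod_gt_0 => E; apply: Hne. have -> : s = s - t + t by ring. rewrite E; ring. }
  have [N1 H1] := Hs _ (ltac:(lra) : (0 < Cmod (s - t) / 2)%R).
  have [N2 H2] := Ht _ (ltac:(lra) : (0 < Cmod (s - t) / 2)%R).
  have I1 := H1 (N1 + N2)%nat ltac:(lia). have I2 := H2 (N1 + N2)%nat ltac:(lia).
  have E : s - t = (u (N1 + N2)%nat - t) - (u (N1 + N2)%nat - s) by ring.
  have := Cmod_triangle (u (N1 + N2)%nat - t) (- (u (N1 + N2)%nat - s)).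
  rewrite Cmod_opp -/(Cminus _ _) -E. lra.
Qed.

Lemma clim_const c : clim (fun _ => c) c.
Proof. move=> eps He; exists 0%nat => n _. have -> : c - c = 0 by ring. by rewrite Cmod_0. Qed.

Lemma clim_ext u v (s : C) : (forall n, u n = v n) -> clim u s -> clim v s.
Proof. by move=> /functional_extensionality ->. Qed.

Lemma clim_plus u v (s t : C) : clim u s -> clim v t -> clim (fun n => u n + v n) (s + t).
Proof.
  move=> Hu Hv eps He.
  have [N1 H1] := Hu (eps / 2)%R ltac:(lra). have [N2 H2] := Hv (eps / 2)%R ltac:(lra).
  exists (N1 + N2)%nat => n Hn. have := H1 n ltac:(lia). have := H2 n ltac:(lia).
  have -> : u n + v n - (s + t) = (u n - s) + (v n - t) by ring.
  have := Cmod_triangle (u n - s) (v n - t). lra.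
Qed.

Lemma clim_mult u v (s t : C) : clim u s -> clim v t -> clim (fun n => u n * v n) (s * t).
Proof.
  move=> Hu Hv eps He.
  have Ps := Cmod_ge_0 s. have Pt := Cmod_ge_0 t.
  (* As e is at most 1, the errors e^2, |s| e and |t| e add up to at most e (|s| + |t| + 1). *)
  set e := Rmin 1 (eps / (2 * (Cmod s + Cmod t + 1)))%R.
  have Hd : (0 < eps / (2 * (Cmod s + Cmod t + 1)))%R by apply: Rdiv_lt_0_compat; lra.
  have He' : (0 < e)%R by apply: Rmin_pos; lra.
  have E1 : (e <= 1)%R by apply: Rmin_l.
  have E2 : (e * (Cmod s + Cmod t + 1) <= eps / 2)%R.
  { have H := Rmin_r 1 (eps / (2 * (Cmod s + Cmod t + 1)))%R. rewrite -/e in H.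
    apply: Rle_trans (Rmult_le_compat_r (Cmod s + Cmod t + 1) _ _ ltac:(lra) H) _.
    apply: Req_le; field; lra. }
  have [N1 H1] := Hu e He'. have [N2 H2] := Hv e He'.
  exists (N1 + N2)%nat => n Hn. have I1 := H1 n ltac:(lia). have I2 := H2 n ltac:(lia).
  have -> : u n * v n - s * t = (u n - s) * (v n - t) + (s * (v n - t) + t * (u n - s)) by ring.
  have T1 := Cmod_triangle ((u n - s) * (v n - t)) (s * (v n - t) + t * (u n - s)).
  have T2 := Cmod_triangle (s * (v n - t)) (t * (u n - s)).
  rewrite !Cmod_mult in T1 T2.
  have := Cmod_ge_0 (u n - s). have := Cmod_ge_0 (v n - t). nra.
Qed.

Lemma clim_inv u (s : C) : s <> 0 -> clim u s -> clim (fun n => / u n) (/ s).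
Proof.
  move=> Hs Hu eps He.
  have Ps : (0 < Cmod s)%R := proj1 (Cmod_gt_0 s) Hs.
  set e := Rmin (Cmod s / 2) (eps * (Cmod s * Cmod s) / 4)%R.
  have Hd : (0 < eps * (Cmod s * Cmod s) / 4)%R.
  { have : (0 < Cmod s * Cmod s)%R by nra. nra. }
  have He' : (0 < e)%R by apply: Rmin_pos; lra.
  have E1 : (e <= Cmod s / 2)%R by apply: Rmin_l.
  have E2 : (e <= eps * (Cmod s * Cmod s) / 4)%R by apply: Rmin_r.
  have [N HN] := Hu e He'. exists N => n Hn. have H := HN n Hn.
  have Hu2 : (Cmod s / 2 < Cmod (u n))%R.
  { have E : s = u n - (u n - s) by ring.
    have := Cmod_triangle (u n) (- (u n - s)). rewrite Cmod_opp -/(Cminus _ _) -E; lra. }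
  have Hun : u n <> 0 by apply/Cmod_gt_0; lra.
  have -> : / u n - / s = - (u n - s) / (u n * s) by field.
  rewrite (Cmod_div _ _ (Cmult_neq_0 _ _ Hun Hs)).
  rewrite Cmod_opp Cmod_mult.
  apply: (Rmult_lt_reg_r (Cmod (u n) * Cmod s)); first nra.
  have -> : (Cmod (u n - s) / (Cmod (u n) * Cmod s) * (Cmod (u n) * Cmod s) = Cmod (u n - s))%R by field; lra.
  have : (eps * (Cmod s * Cmod s) / 4 < eps * (Cmod (u n) * Cmod s))%R.
  { have : (Cmod s * Cmod s / 2 < Cmod (u n) * Cmod s)%R by nra.
    have : (0 < Cmod s * Cmod s)%R by nra. nra. }
  lra.
Qed.

Lemma clim_bounded u (s : C) : clim u s -> exists M, (0 < M)%R /\ forall n, (Cmod (u n) <= M)%R.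
Proof.
  move=> H. have [N HN] := H 1%R ltac:(lra).
  have [M HM] : exists M, forall n, (n < N)%nat -> (Cmod (u n) <= M)%R.
  { elim: (N) => [|k [M HM]]; first by exists 0%R => n; lia.
    exists (Rmax M (Cmod (u k))) => n Hn.
    case: (Nat.eq_dec n k) => [->|Hk]; first exact: Rmax_r.
    apply: Rle_trans (Rmax_l _ _). apply: HM; lia. }
  exists (Rmax M (Cmod s + 1)); split.
  - have := Rmax_r M (Cmod s + 1). have := Cmod_ge_0 s. lra.
  - move=> n; case: (Nat.lt_ge_cases n N) => Hn.
    + exact: Rle_trans (HM n Hn) (Rmax_l _ _).
    + apply: Rle_trans (Rmax_r _ _). have := HN n Hn.
      have E : u n = (u n - s) + s by ring.
      have := Cmod_triangle (u n - s) s. rewrite -E; lra.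
Qed.

Lemma sum_n_lsum (f : nat -> C) n : @sum_n C_AbelianMonoid f n = lsum f (seq 0 (S n)).
Proof.
  elim: n => [|n IH]; first by rewrite sum_O /= Cplus_0_r.
  by rewrite sum_Sn IH (seq_S (S n)) lsum_app /= Cplus_0_r.
Qed.

Lemma is_series_clim (f : nat -> C) s :
  @is_series C_AbsRing C_NormedModule f s <-> clim (fun n => lsum f (seq 0 (S n))) s.
Proof.
  rewrite /is_series; split => H.
  - apply/clim_filterlim. move: H; apply: filterlim_ext => n. exact: sum_n_lsum.
  - apply: filterlim_ext (proj1 (clim_filterlim _ _) H) => n. by rewrite sum_n_lsum.
Qed.

Lemma is_series_HS (f : nat -> C) s : HS f s -> @is_series C_AbsRing C_NormedModule f s.
Proof.
  move=> [_ H]; apply/is_series_clim => eps He.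
  have [l0 H0] := H eps He. exists (list_max l0) => n Hn. apply: H0; first exact: seq_NoDup.
  move=> i Hi; apply/in_seq.
  have := proj1 (list_max_le l0 (list_max l0)) (Nat.le_refl _) => /Forall_forall /(_ i Hi). lia.
Qed.

Lemma is_series_unique' (f : nat -> C) s t :
  @is_series C_AbsRing C_NormedModule f s -> @is_series C_AbsRing C_NormedModule f t -> s = t.
Proof. move=> /is_series_clim H1 /is_series_clim H2; exact: clim_unique H1 H2. Qed.

Lemma Cseries_HS f s : HS f s -> Cseries f = s.
Proof.
  move=> /is_series_HS H; apply: iota_unique => // t Ht. exact: is_series_unique' Ht H.
Qed.

Lemma HS_half (f : Z -> C) s : HS f s ->
  exists s1 s2, HS (fun n => f (Z.of_nat n)) s1 /\
    HS (fun n => f (- Z.of_nat (S n))%Z) s2 /\ s = s1 + s2.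
Proof.
  move=> H.
  have [s1 H1] := summable_HS (summable_inj (phi := Z.of_nat) Nat2Z.inj (proj1 H)).
  have [s2 H2] := summable_HS (summable_inj (phi := fun n => (- Z.of_nat (S n))%Z)
     ltac:(cbv beta; lia) (proj1 H)).
  exists s1, s2; split => //; split => //.
  have K1 : HS (fun n : Z => if Z_le_dec 0 n then f n else 0) s1.
  { apply: (proj1 (HS_inj (phi := Z.of_nat) _ _ _)); first exact: Nat2Z.inj.
    - move=> k Hk; case: Z_le_dec => // Hp. case: (Hk (Z.to_nat k)); lia.
    - apply: HS_ext H1 => n. case: Z_le_dec => //; lia. }
  have K2 : HS (fun n : Z => if Z_le_dec 0 n then 0 else f n) s2.
  { apply: (proj1 (HS_inj (phi := fun n => (- Z.of_nat (S n))%Z) _ _ _)); first by cbv beta; lia.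
    - move=> k Hk; case: Z_le_dec => // Hp. case: (Hk (Z.to_nat (- k - 1))); lia.
    - apply: HS_ext H2 => n. case: Z_le_dec => //; lia. }
  apply: (HS_unique H). apply: HS_ext (HS_plus K1 K2) => n. case: Z_le_dec => _; ring.
Qed.

Lemma is_Zseries_HS f s : HS f s -> is_Zseries f s.
Proof.
  move=> /HS_half [s1 [s2 [H1 [H2 E]]]]; exists s1, s2.
  by split; [exact: is_series_HS | split; [exact: is_series_HS |]].
Qed.

Lemma is_Zseries_unique f s t : is_Zseries f s -> is_Zseries f t -> s = t.
Proof.
  move=> [a [b [H1 [H2 ->]]]] [a' [b' [H3 [H4 ->]]]].
  by rewrite (is_series_unique' H1 H3) (is_series_unique' H2 H4).
Qed.

Lemma Zseries_HS f s : HS f s -> Zseries f = s.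
Proof.
  move=> /is_Zseries_HS H; apply: iota_unique => // t Ht. exact: is_Zseries_unique Ht H.
Qed.

Lemma Cprod_inf_clim u l : clim (Cprod u) l -> Cprod_inf u = l.
Proof.
  move=> H; apply: iota_unique.
  - move=> y Hy. apply: (clim_unique _ H). apply/clim_filterlim. exact: Hy.
  - apply/clim_filterlim. exact: H.
Qed.

(** * Summability criteria: geometric and Gaussian majorants *)

Lemma summable_nat_geom (f : nat -> C) (c r : R) : (0 <= r < 1)%R ->
  (forall n, (Cmod (f n) <= c * r ^ n)%R) -> summable f.
Proof.
  move=> Hr Hf. exists (Rabs c / (1 - r))%R => l Hl.
  apply: Rle_trans (_ : (lsumR (fun n => Rabs c * r ^ n)%R (seq 0 (S (list_max l))) <= _)%R).
  - apply: Rle_trans (_ : (lsumR (fun n => Rabs c * r ^ n)%R l <= _)%R).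
    + apply: lsumR_le => n _; apply: Rle_trans (Hf n) _.
      apply: Rmult_le_compat_r; [apply: pow_le; lra | exact: Rle_abs].
    + apply: lsumR_incl => // [n|n Hn].
      * apply: Rmult_le_pos; [exact: Rabs_pos | apply: pow_le; lra].
      * apply/in_seq.
        have := proj1 (list_max_le l (list_max l)) (Nat.le_refl _) => /Forall_forall /(_ n Hn). lia.
  - rewrite lsumR_scal. apply: Rmult_le_compat_l; first exact: Rabs_pos.
    move: (S _) => N.
    have -> : lsumR (fun n => r ^ n)%R (seq 0 N) = ((1 - r ^ N) / (1 - r))%R.
    { elim: N => [|N IH]; first (rewrite /=; field; lra).
      rewrite seq_S lsumR_app IH /=; field; lra. }
    rewrite -[X in (_ <= X)%R]Rmult_1_l /Rdiv. apply: Rmult_le_compat_r.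
    + apply: Rlt_le; apply: Rinv_0_lt_compat; lra.
    + have : (0 <= r ^ N)%R by apply: pow_le; lra. lra.
Qed.

Lemma summable_Z_split (f : Z -> C) :
  summable (fun n => f (Z.of_nat n)) -> summable (fun n => f (- Z.of_nat n)%Z) -> summable f.
Proof.
  move=> [M HM] [M' HM']. exists (M + M')%R => l Hl.
  set N := list_max (map Z.abs_nat l).
  apply: Rle_trans (_ : (lsumR (fun n => Cmod (f n)) (map Z.of_nat (seq 0 (S N)) ++ map (fun n => - Z.of_nat n)%Z (seq 0 (S N))) <= _)%R).
  - apply: lsumR_incl => // [n|n Hn]; first exact: Cmod_ge_0.
    have HN : (Z.abs_nat n <= N)%nat.
    { have := proj1 (list_max_le (map Z.abs_nat l) N) (Nat.le_refl _) => /Forall_forall.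
      apply; exact: in_map. }
    apply/in_app_iff; case: (Z_le_dec 0 n) => H; [left | right]; apply/in_map_iff;
      exists (Z.abs_nat n); (split; [lia | apply/in_seq; lia]).
  - rewrite lsumR_app !lsumR_map. have := HM _ (seq_NoDup (S N) 0). have := HM' _ (seq_NoDup (S N) 0). lra.
Qed.

(** Completing the square: Gaussian decay beats any linear term and still leaves the summable factor
    exp(-t). *)
Lemma gauss_bound (c d e t : R) : (0 < c)%R -> (0 <= t)%R ->
  (- c * t ^ 2 + d * t + e <= - t + ((d + 1) ^ 2 / (4 * c) + e))%R.
Proof.
  move=> Hc Ht.
  have E : ((d + 1) ^ 2 / (4 * c) - (d + 1) * t + c * t ^ 2 = c * (t - (d + 1) / (2 * c)) ^ 2)%R by field; lra.
  have : (0 <= c * (t - (d + 1) / (2 * c)) ^ 2)%R.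
  { apply: Rmult_le_pos; [lra | exact: pow2_ge_0]. }
  lra.
Qed.

Lemma exp_mono a b : (a <= b)%R -> (exp a <= exp b)%R.
Proof. move=> [H|->]; [exact: Rlt_le (exp_increasing _ _ H) | exact: Rle_refl]. Qed.

Lemma Cmod_exp (a : R) : Cmod (RtoC (exp a)) = exp a.
Proof. rewrite Cmod_R; apply: Rabs_pos_eq; exact: Rlt_le (exp_pos _). Qed.

Lemma exp_nat_pow n : exp (- INR n) = (exp (-1) ^ n)%R.
Proof.
  elim: n => [|n IH]; first by rewrite /= Ropp_0 exp_0.
  rewrite S_INR /= -IH -exp_plus; f_equal; ring.
Qed.

Lemma exp_m1 : (0 <= exp (-1) < 1)%R.
Proof. split; first exact: Rlt_le (exp_pos _). rewrite -exp_0; apply: exp_increasing; lra. Qed.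

Lemma summable_Z_exp : summable (fun n : Z => RtoC (exp (- Rabs (IZR n)))).
Proof.
  have key n z : Rabs (IZR z) = INR n ->
    (Cmod (RtoC (exp (- Rabs (IZR z)))) <= 1 * exp (-1) ^ n)%R.
  { move=> ->. rewrite Cmod_exp exp_nat_pow; lra. }
  apply: summable_Z_split; apply: (@summable_nat_geom _ 1 (exp (-1)) exp_m1) => n; apply: key.
  - rewrite -INR_IZR_INZ Rabs_pos_eq //; exact: pos_INR.
  - rewrite opp_IZR Rabs_Ropp -INR_IZR_INZ Rabs_pos_eq //; exact: pos_INR.
Qed.

Lemma summable_gauss (f : Z -> C) (c d e : R) : (0 < c)%R ->
  (forall n, (Cmod (f n) <= exp (- c * IZR n ^ 2 + d * Rabs (IZR n) + e))%R) -> summable f.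
Proof.
  move=> Hc H.
  apply: summable_le (summable_scal (RtoC (exp ((d + 1) ^ 2 / (4 * c) + e))) summable_Z_exp) => n.
  apply: Rle_trans (H n) _. rewrite Cmod_mult !Cmod_exp.
  rewrite -exp_plus. apply: exp_mono.
  have := @gauss_bound c d e _ Hc (Rabs_pos (IZR n)). rewrite pow2_abs; lra.
Qed.

Lemma summable_gauss2 (f : Z * Z -> C) (c d e : R) : (0 < c)%R ->
  (forall n m, (Cmod (f (n, m)) <= exp (- c * (IZR n ^ 2 + IZR m ^ 2) + d * (Rabs (IZR n) + Rabs (IZR m)) + e))%R) ->
  summable f.
Proof.
  move=> Hc H.
  have S1 (e' : R) : summable (fun n : Z => RtoC (exp (- c * IZR n ^ 2 + d * Rabs (IZR n) + e'))).
  { apply: (@summable_gauss _ c d e') => // n. rewrite Cmod_exp; lra. }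
  apply: summable_le (summable_prod (S1 0%R) (S1 e)) => [[n m]] /=.
  apply: Rle_trans (H n m) _. rewrite Cmod_mult !Cmod_exp.
  rewrite -exp_plus; apply: exp_mono; lra.
Qed.

(** * Integer powers *)

Notation "x ^^ n" := (Cpowz x n) (at level 30, right associativity) : C_scope.

Lemma pz_nat (x : C) (n : nat) : x ^^ Z.of_nat n = x ^ n.
Proof. case: n => [|n] //. by rewrite /= SuccNat2Pos.id_succ. Qed.

Lemma pz_negnat (x : C) (n : nat) : x ^^ (- Z.of_nat n) = / x ^ n.
Proof. case: n => [|n] /=; first by field. by rewrite SuccNat2Pos.id_succ. Qed.

Lemma Cinv_0 : / 0 = 0 :> C.
Proof. rewrite /Cinv /= /Rdiv Ropp_0 !Rmult_0_l //. Qed.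

Lemma Cinv_nz (x : C) : x <> 0 -> / x <> 0.
Proof. move=> H E. have := Cinv_r x H. rewrite E Cmult_0_r => K; exact: C1_nz (eq_sym K). Qed.

Lemma pz_nz (x : C) n : x <> 0 -> x ^^ n <> 0.
Proof.
  move=> H; case: n => [|p|p] /=; first exact: C1_nz.
  - exact: Cpow_nz.
  - by apply: Cinv_nz; apply: Cpow_nz.
Qed.

Lemma pz_opp (x : C) n : x ^^ (- n) = / x ^^ n.
Proof.
  case: n => [|p|p] //=; first by field.
  (* At a vanishing power the identity persists because the inverse of 0 is 0. *)
  case: (Classical_Prop.classic (x ^ Pos.to_nat p = 0)) => [->|H]; last by field.
  by rewrite !Cinv_0.
Qed.

Lemma pz_S (x : C) n : x <> 0 -> x ^^ (n + 1) = x ^^ n * x.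
Proof.
  move=> H. case: (Z_le_dec 0 n) => Hn.
  - have [m ->] : exists m, n = Z.of_nat m by exists (Z.to_nat n); lia.
    rewrite (_ : Z.of_nat m + 1 = Z.of_nat (S m))%Z; [|lia]. rewrite !pz_nat Cpow_S; ring.
  - have [m ->] : exists m, (n = - Z.of_nat (S m))%Z by exists (Z.to_nat (- n - 1)); lia.
    rewrite (_ : - Z.of_nat (S m) + 1 = - Z.of_nat m)%Z; [|lia].
    rewrite !pz_negnat Cpow_S. have := Cpow_nz x m H => Hm. by field.
Qed.

Lemma pz_add (x : C) m n : x <> 0 -> x ^^ (m + n) = x ^^ m * x ^^ n.
Proof.
  move=> H. elim/Z.peano_ind: n => [|n IH|n IH].
  - rewrite Z.add_0_r /=; ring.
  - rewrite Z.add_succ_r -Z.add_1_r -(Z.add_1_r n) !pz_S // IH; ring.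
  - have E k : x ^^ (Z.pred k) = x ^^ k / x.
    { have := pz_S (Z.pred k) H. rewrite (_ : Z.pred k + 1 = k)%Z; [|lia]. move=> ->. by field. }
    rewrite Z.add_pred_r !E IH. by field.
Qed.

Lemma pz_sub (x : C) m n : x <> 0 -> x ^^ (m - n) = x ^^ m / x ^^ n.
Proof. by move=> H; rewrite pz_add // pz_opp. Qed.

Lemma pz_1 (x : C) : x ^^ 1 = x.
Proof. rewrite /=; ring. Qed.

Lemma pz_0 (x : C) : x ^^ 0 = 1.
Proof. by []. Qed.

Lemma pz_2 (x : C) : x ^^ 2 = x * x.
Proof. rewrite /=; ring. Qed.

Lemma pz_base1 n : 1 ^^ n = 1.
Proof. case: n => [|p|p] //=; rewrite Cpow_1_l //; by field. Qed.

Lemma pz_base_mul (x y : C) n : (x * y) ^^ n = x ^^ n * y ^^ n.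
Proof.
  have Hp p : (x * y) ^ p = x ^ p * y ^ p by rewrite Cpow_mult_l.
  have Hi (u v : C) : / (u * v) = / u * / v.
  { case: (Classical_Prop.classic (u = 0)) => [->|Hu].
    - by rewrite Cmult_0_l Cinv_0 Cmult_0_l.
    - case: (Classical_Prop.classic (v = 0)) => [->|Hv]; last by field.
      by rewrite Cmult_0_r Cinv_0 Cmult_0_r. }
  case: n => [|p|p] /=; [ring | exact: Hp | by rewrite Hp Hi].
Qed.

Lemma pz_mul (x : C) m n : x <> 0 -> x ^^ (m * n) = (x ^^ m) ^^ n.
Proof.
  move=> H. have Hm := pz_nz (n := m) H.
  elim/Z.peano_ind: n => [|n IH|n IH].
  - by rewrite Z.mul_0_r.
  - by rewrite Z.mul_succ_r pz_add // IH -Z.add_1_r pz_S.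
  - rewrite Z.mul_pred_r pz_sub // IH -Z.sub_1_r pz_sub // pz_1 //.
Qed.

Lemma pz_base_inv (x : C) n : (/ x) ^^ n = x ^^ (- n).
Proof.
  have Hi (u : C) : / / u = u.
  { case: (Classical_Prop.classic (u = 0)) => [->|Hu]; [by rewrite !Cinv_0 | by field]. }
  have Hp p : (/ x) ^ p = / x ^ p.
  { case: (Classical_Prop.classic (x = 0)) => [->|Hu]; last by rewrite Cpow_inv.
    rewrite Cinv_0. case: p => [|p]; first by rewrite /=; field.
    by rewrite Cpow_S Cmult_0_l Cinv_0. }
  rewrite pz_opp; case: n => [|p|p] /=; [by field | exact: Hp | by rewrite Hp].
Qed.

Lemma pz_pow (x : C) m (k : nat) : x <> 0 -> (x ^^ m) ^ k = x ^^ (m * Z.of_nat k).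
Proof. by move=> H; rewrite pz_mul // pz_nat. Qed.

Lemma pow_pz (x : C) (k : nat) n : x <> 0 -> (x ^ k) ^^ n = x ^^ (Z.of_nat k * n).
Proof. by move=> H; rewrite pz_mul // pz_nat. Qed.

Lemma Cmod_pz (x : C) n : x <> 0 -> Cmod (x ^^ n) = exp (IZR n * ln (Cmod x)).
Proof.
  move=> H. have Hp := proj1 (Cmod_gt_0 x) H.
  elim/Z.peano_ind: n => [|n IH|n IH].
  - by rewrite Rmult_0_l exp_0 /= Cmod_1.
  - rewrite -Z.add_1_r pz_S // Cmod_mult IH plus_IZR Rmult_plus_distr_r exp_plus Rmult_1_l exp_ln //.
  - rewrite -Z.sub_1_r pz_sub // pz_1 Cmod_div // IH minus_IZR Rmult_minus_distr_r Rmult_1_l.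
    by rewrite /Rminus exp_plus exp_Ropp exp_ln.
Qed.

Lemma m1_nz : -(1) <> 0 :> C.
Proof. move=> E; apply: C1_nz. have -> : 1 = - (-(1)) :> C by ring. rewrite E; ring. Qed.

Lemma Cmod_sgn n : Cmod ((-(1)) ^^ n) = 1%R.
Proof. by rewrite Cmod_pz; [rewrite Cmod_m1 ln_1 Rmult_0_r exp_0 | exact: m1_nz]. Qed.

Lemma sgn_even n : (-(1)) ^^ (2 * n) = 1.
Proof.
  rewrite pz_mul; last exact: m1_nz. rewrite pz_2 (_ : - (1) * - (1) = 1); last by ring.
  exact: pz_base1.
Qed.

Lemma sgn_odd n : (-(1)) ^^ (2 * n + 1) = -(1).
Proof. rewrite pz_S; last exact: m1_nz. rewrite sgn_even; ring. Qed.

Lemma sgn_opp n : (-(1)) ^^ (- n) = (-(1)) ^^ n.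
Proof.
  rewrite (_ : - n = n + 2 * (- n))%Z; last by lia.
  rewrite pz_add; last exact: m1_nz. rewrite sgn_even; ring.
Qed.

(** * Theta functions *)

Definition nome (q : C) : Prop := (0 < Cmod q < 1)%R.

Lemma nome_nz q : nome q -> q <> 0.
Proof. by move=> [H _] E; move: H; rewrite E Cmod_0; lra. Qed.

Lemma nome_ln q : nome q -> (ln (Cmod q) < 0)%R.
Proof. move=> H; rewrite -ln_1; apply: ln_increasing; case: H; lra. Qed.

Lemma nome_pow q k : nome q -> (0 < k)%nat -> nome (q ^ k).
Proof.
  move=> [H1 H2] Hk; rewrite /nome Cmod_pow; split; first exact: pow_lt.
  case: k Hk => [|k] Hk; first lia. move=> /=.
  have : (Cmod q ^ k <= 1)%R by rewrite -(pow1 k); apply: pow_incr; lra.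
  have : (0 <= Cmod q ^ k)%R by apply: pow_le; lra. nra.
Qed.

Lemma nome_opp q : nome q -> nome (- q).
Proof. by rewrite /nome Cmod_opp. Qed.

Lemma tri_double n : (2 * (n * (n - 1) / 2) = n * (n - 1))%Z.
Proof.
  have [k [->|->]] : exists k, (n = 2 * k \/ n = 2 * k + 1)%Z.
  { exists (n / 2)%Z. have := Z.div_mod n 2 ltac:(lia). have := Z.mod_pos_bound n 2 ltac:(lia). lia. }
  - rewrite (_ : 2 * k * (2 * k - 1) = (k * (2 * k - 1)) * 2)%Z; last by ring.
    rewrite Z.div_mul; lia.
  - rewrite (_ : (2 * k + 1) * (2 * k + 1 - 1) = ((2 * k + 1) * k) * 2)%Z; last by ring.
    rewrite Z.div_mul; lia.
Qed.

Lemma tri_eq n m : (n * (n - 1) = 2 * m)%Z -> (n * (n - 1) / 2 = m)%Z.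
Proof. have := tri_double n. lia. Qed.

(** On the logarithmic scale, an exponent that dominates n^2/K up to linear terms gives Gaussian
    decay. The growth condition is stated over the integers so that it can be discharged by integer
    arithmetic at each use. *)
Lemma q_bound (q x u : C) (e n K a b : Z) (B : R) :
  nome q -> x <> 0 -> (0 < K)%Z -> (0 <= B)%R -> (Cmod u <= exp B)%R ->
  (n * n - a * Z.abs n - b <= K * e)%Z ->
  let c := (- ln (Cmod q) / IZR K)%R in
  (Cmod (u * q ^^ e * x ^^ n) <=
   exp (- c * IZR n ^ 2 + (c * IZR a + Rabs (ln (Cmod x))) * Rabs (IZR n) + (c * IZR b + B)))%R.
Proof.
  move=> Hq Hx HK HB Hu He c.
  rewrite !Cmod_mult !Cmod_pz //; last by exact: nome_nz.
  have HK' : (0 < IZR K)%R by apply: IZR_lt.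
  have Hl := nome_ln Hq.
  have Hc : (0 < c)%R by apply: Rdiv_lt_0_compat; lra.
  apply: Rle_trans (Rmult_le_compat_r _ _ _ (Rlt_le _ _ (exp_pos _)) (Rmult_le_compat_r _ _ _ (Rlt_le _ _ (exp_pos _)) Hu)) _.
  rewrite -!exp_plus; apply: exp_mono.
  have E1 : ln (Cmod q) = (- c * IZR K)%R by rewrite /c; field; lra.
  have He' := IZR_le _ _ He. rewrite !(minus_IZR, mult_IZR) abs_IZR in He'.
  have E2 : (IZR n * ln (Cmod x) <= Rabs (ln (Cmod x)) * Rabs (IZR n))%R.
  { rewrite -Rabs_mult Rmult_comm; exact: Rle_abs. }
  rewrite E1.
  have : (c * (IZR n * IZR n - IZR a * Rabs (IZR n) - IZR b) <= c * (IZR K * IZR e))%R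
    by apply: Rmult_le_compat_l; lra.
  nra.
Qed.

Lemma exp_bound (B : R) : exists B', (0 <= B')%R /\ (B <= exp B')%R.
Proof.
  exists (Rabs B); split; first exact: Rabs_pos.
  have := exp_ineq1_le (Rabs B). have := Rle_abs B. lra.
Qed.

Lemma summable_q (q x : C) (e : Z -> Z) (u : Z -> C) (K a b : Z) (B : R) :
  nome q -> x <> 0 -> (0 < K)%Z -> (forall n, (Cmod (u n) <= B)%R) ->
  (forall n, (n * n - a * Z.abs n - b <= K * e n)%Z) ->
  summable (fun n => u n * q ^^ e n * x ^^ n).
Proof.
  move=> Hq Hx HK Hu He. have [B' [HB1 HB2]] := exp_bound B.
  apply: summable_gauss (_ : forall n, _) => [|n].
  - apply: (Rdiv_lt_0_compat (- ln (Cmod q)) (IZR K)); last exact: IZR_lt.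
    have := nome_ln Hq; lra.
  - apply: q_bound Hq Hx HK HB1 _ (He n). have := Hu n; lra.
Qed.

Lemma summable_q2 (q x y : C) (e : Z -> Z -> Z) (u : Z * Z -> C) (K a b : Z) (B : R) :
  nome q -> x <> 0 -> y <> 0 -> (0 < K)%Z -> (forall p, (Cmod (u p) <= B)%R) ->
  (forall n m, (n * n + m * m - a * (Z.abs n + Z.abs m) - b <= K * e n m)%Z) ->
  summable (fun p => u p * q ^^ e (fst p) (snd p) * x ^^ fst p * y ^^ snd p).
Proof.
  move=> Hq Hx Hy HK Hu He. have [B' [HB1 HB2]] := exp_bound B.
  have Hl := nome_ln Hq. have HK' : (0 < IZR K)%R by apply: IZR_lt.
  set c := (- ln (Cmod q) / IZR K)%R.
  have Hc : (0 < c)%R by apply: Rdiv_lt_0_compat; lra.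
  apply: (@summable_gauss2 _ c (c * IZR a + Rabs (ln (Cmod x)) + Rabs (ln (Cmod y))) (c * IZR b + B')) => // n m /=.
  rewrite !Cmod_mult !Cmod_pz //; last by exact: nome_nz.
  apply: Rle_trans (_ : (exp B' * exp (IZR (e n m) * ln (Cmod q)) * exp (IZR n * ln (Cmod x)) * exp (IZR m * ln (Cmod y)) <= _)%R).
  - do 3 (apply: Rmult_le_compat_r; first exact: Rlt_le (exp_pos _)). have := Hu (n, m); lra.
  rewrite -!exp_plus; apply: exp_mono.
  have E1 : ln (Cmod q) = (- c * IZR K)%R by rewrite /c; field; lra.
  have He' := IZR_le _ _ (He n m). rewrite !(minus_IZR, mult_IZR, plus_IZR) !abs_IZR in He'.
  have E2 : (IZR n * ln (Cmod x) <= Rabs (ln (Cmod x)) * Rabs (IZR n))%R.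
  { rewrite -Rabs_mult Rmult_comm; exact: Rle_abs. }
  have E3 : (IZR m * ln (Cmod y) <= Rabs (ln (Cmod y)) * Rabs (IZR m))%R.
  { rewrite -Rabs_mult Rmult_comm; exact: Rle_abs. }
  rewrite E1.
  have H := Rmult_le_compat_l c _ _ (Rlt_le _ _ Hc) He'.
  have := Rabs_pos (ln (Cmod x)). have := Rabs_pos (ln (Cmod y)).
  have := Rabs_pos (IZR n). have := Rabs_pos (IZR m). nra.
Qed.

Lemma Copp_nz (u : C) : u <> 0 -> - u <> 0.
Proof. move=> Hu E; apply: Hu. have -> : u = - - u by ring. rewrite E; ring. Qed.

Lemma sgn_base (u : C) n : (- u) ^^ n = (-(1)) ^^ n * u ^^ n.
Proof. by rewrite -pz_base_mul; congr (_ ^^ n); ring. Qed.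

Lemma sgn_sqr n : (-(1)) ^^ n * (-(1)) ^^ n = 1.
Proof.
  rewrite -pz_add; last exact: m1_nz. rewrite (_ : n + n = 2 * n)%Z; [exact: sgn_even | lia].
Qed.

Ltac ofnat :=
  change (Z.of_nat 2) with 2%Z; change (Z.of_nat 3) with 3%Z; change (Z.of_nat 4) with 4%Z.

Definition th (q x : C) (n : Z) : C :=
  (-(1)) ^^ n * q ^^ (n * (n - 1) / 2) * x ^^ n.

Lemma HS_j q (x : C) : nome q -> x <> 0 -> HS (th q x) (jtheta x q).
Proof.
  move=> Hq Hx.
  have S : summable (th q x).
  { apply: (@summable_q q x (fun n => n * (n - 1) / 2)%Z (fun n => (-(1)) ^^ n) 2 1 0 1) => // n.
    - rewrite Cmod_sgn; lra.
    - rewrite tri_double; nia. }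
  have [s Hs] := summable_HS S. by rewrite /jtheta (Zseries_HS Hs).
Qed.

Lemma j_eq q (x s : C) : HS (th q x) s -> jtheta x q = s.
Proof. exact: Zseries_HS. Qed.

Lemma HS_shift (f : Z -> C) (k : Z) s : HS f s -> HS (fun n => f (n + k)%Z) s.
Proof. apply: (HS_bij (phi := fun n => (n + k)%Z) (psi := fun n => (n - k)%Z)) => n; ring. Qed.

Lemma HS_refl (f : Z -> C) (k : Z) s : HS f s -> HS (fun n => f (k - n)%Z) s.
Proof. apply: (HS_bij (phi := fun n => (k - n)%Z) (psi := fun n => (k - n)%Z)) => n; ring. Qed.

Lemma HS_even_odd (f : Z -> C) s t :
  HS (fun n => f (2 * n)%Z) s -> HS (fun n => f (2 * n + 1)%Z) t -> HS f (s + t).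
Proof.
  move=> H1 H2.
  have K1 : HS (fun n : Z => if Z.eq_dec (n mod 2) 0 then f n else 0) s.
  { apply: (proj1 (HS_inj (phi := fun n => (2 * n)%Z) _ _ _)); first by move=> i i' ?; lia.
    - move=> k Hk; case: Z.eq_dec => // Hp. case: (Hk (k / 2)%Z).
      have := Z.div_mod k 2 ltac:(lia). lia.
    - apply: HS_ext H1 => n. case: Z.eq_dec => //. by rewrite Z.mul_comm Z_mod_mult. }
  have K2 : HS (fun n : Z => if Z.eq_dec (n mod 2) 0 then 0 else f n) t.
  { apply: (proj1 (HS_inj (phi := fun n => (2 * n + 1)%Z) _ _ _)); first by move=> i i' ?; lia.
    - move=> k Hk; case: Z.eq_dec => // Hp. case: (Hk (k / 2)%Z).
      have := Z.div_mod k 2 ltac:(lia). have := Z.mod_pos_bound k 2 ltac:(lia). lia.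
    - apply: HS_ext H2 => n. case: Z.eq_dec => //. rewrite Z.add_comm (Z.mul_comm 2) Z_mod_plus_full. done. }
  apply: HS_ext (HS_plus K1 K2) => n. case: Z.eq_dec => _; ring.
Qed.

(** Shifting the summation index by k splits the triangular exponent of n + k into those of n and k
    and the product k n, which is absorbed by the argument. *)
Lemma j_shift q (x : C) k : nome q -> x <> 0 ->
  jtheta (q ^^ k * x) q = (-(1)) ^^ k * q ^^ (- (k * (k - 1) / 2)) * x ^^ (- k) * jtheta x q.
Proof.
  move=> Hq Hx. have Hq0 := nome_nz Hq. apply: j_eq.
  apply: HS_ext (HS_scal _ (HS_shift k (HS_j Hq Hx))) => n; rewrite /th.
  rewrite pz_base_mul -pz_mul // !(pz_opp _) !pz_add //; last exact: m1_nz.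
  have E : ((n + k) * (n + k - 1) / 2 = n * (n - 1) / 2 + k * n + k * (k - 1) / 2)%Z.
  { apply: tri_eq. have := tri_double n; have := tri_double k; nia. }
  rewrite E !pz_add //.
  have N1 := pz_nz (n := k) Hx. have N2 := pz_nz (n := (k * (k - 1) / 2)%Z) Hq0.
  have E2 : (-(1)) ^^ k * (-(1)) ^^ k = 1.
  { exact: sgn_sqr. }
  transitivity (((-(1)) ^^ k * (-(1)) ^^ k) * ((-(1)) ^^ n * q ^^ (n * (n - 1) / 2) * (q ^^ (k * n) * x ^^ n))).
  - by field.
  - rewrite E2; ring.
Qed.

Lemma j_q q (x : C) : nome q -> x <> 0 -> jtheta (q * x) q = - jtheta x q / x.
Proof.
  move=> Hq Hx. have := j_shift 1 Hq Hx. rewrite pz_1 => ->.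
  rewrite (_ : 1 * (1 - 1) / 2 = 0)%Z //= . rewrite !Cmult_1_r. by field.
Qed.

Lemma j_refl q (x : C) : nome q -> x <> 0 -> jtheta (q / x) q = jtheta x q.
Proof.
  move=> Hq Hx. have Hq0 := nome_nz Hq. apply: j_eq.
  apply: HS_ext (HS_refl 0 (HS_j Hq Hx)) => n; rewrite /th /Cdiv.
  rewrite Z.sub_0_l sgn_opp pz_base_mul pz_base_inv.
  rewrite (_ : (- n * (- n - 1) / 2 = n * (n - 1) / 2 + n)%Z); first by rewrite pz_add //; ring.
  apply: tri_eq. have := tri_double n; nia.
Qed.

Lemma j_inv q (x : C) : nome q -> x <> 0 -> jtheta (/ x) q = - jtheta x q / x.
Proof.
  move=> Hq Hx. have := j_q Hq (Cinv_nz Hx). rewrite -/(Cdiv q x) j_refl // => ->.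
  by field.
Qed.

Lemma j_1 q : nome q -> jtheta 1 q = 0.
Proof.
  move=> Hq. have := j_inv Hq C1_nz. rewrite (_ : / 1 = 1); last by field.
  move=> H. have E : 2 * jtheta 1 q = 0.
  { have -> : 2 * jtheta 1 q = jtheta 1 q + jtheta 1 q by ring. rewrite {1}H; field. }
  have -> : jtheta 1 q = / 2 * (2 * jtheta 1 q) by field. rewrite E; ring.
Qed.

(** Even and odd summation indices; the minus signs in the new arguments cancel the alternating
    signs of the two series in base q^4. *)
Lemma j_split q (x : C) : nome q -> x <> 0 ->
  jtheta x q = jtheta (- (q * x ^ 2)) (q ^ 4) - x * jtheta (- (q ^ 3 * x ^ 2)) (q ^ 4).
Proof.
  move=> Hq Hx. have Hq0 := nome_nz Hq. have Hq4 : nome (q ^ 4) by apply: nome_pow => //; lia.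
  have X1 : - (q * x ^ 2) <> 0 by apply: Copp_nz; apply: Cmult_neq_0 => //; exact: Cpow_nz.
  have X3 : - (q ^ 3 * x ^ 2) <> 0 by apply: Copp_nz; apply: Cmult_neq_0 => //; exact: Cpow_nz.
  apply: j_eq; rewrite /Cminus; apply: HS_even_odd.
  - apply: HS_ext (HS_j Hq4 X1) => n; rewrite /th.
    rewrite sgn_even (sgn_base (q * x ^ 2)) pz_base_mul !pow_pz //. ofnat.
    have -> : (2 * n * (2 * n - 1) / 2 = 4 * (n * (n - 1) / 2) + n)%Z.
    { apply: tri_eq. have := tri_double n; nia. }
    rewrite pz_add //.
    transitivity (((-(1)) ^^ n * (-(1)) ^^ n) * (q ^^ (4 * (n * (n - 1) / 2)) * q ^^ n * x ^^ (2 * n))).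
    + ring. + rewrite sgn_sqr; ring.
  - have -> : - (x * jtheta (- (q ^ 3 * x ^ 2)) (q ^ 4)) = - x * jtheta (- (q ^ 3 * x ^ 2)) (q ^ 4) by ring.
    apply: HS_ext (HS_scal (- x) (HS_j Hq4 X3)) => n; rewrite /th.
    rewrite sgn_odd (sgn_base (q ^ 3 * x ^ 2)) pz_base_mul !pow_pz //. ofnat.
    have -> : ((2 * n + 1) * (2 * n + 1 - 1) / 2 = 4 * (n * (n - 1) / 2) + 3 * n)%Z.
    { apply: tri_eq. have := tri_double n; nia. }
    rewrite pz_add // pz_S //.
    transitivity (((-(1)) ^^ n * (-(1)) ^^ n) * - (q ^^ (4 * (n * (n - 1) / 2)) * q ^^ (3 * n) * x ^^ (2 * n) * x)).
    + ring. + rewrite sgn_sqr; ring.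
Qed.

(** * Infinite products and the Jacobi triple product *)

Lemma clim_subseq (u : nat -> C) (phi : nat -> nat) (s : C) :
  (forall n, (n <= phi n)%nat) -> clim u s -> clim (fun n => u (phi n)) s.
Proof.
  move=> Hp H eps He; have [N HN] := H eps He. exists N => n Hn. apply: HN. have := Hp n; lia.
Qed.

Lemma HS_clim (f : nat -> C) s : HS f s -> clim (fun n => lsum f (seq 0 n)) s.
Proof.
  move=> /is_series_HS /is_series_clim H eps He. have [N HN] := H eps He.
  exists (S N) => n Hn. have := HN (n - 1)%nat ltac:(lia). by rewrite (_ : S (n - 1) = n); [|lia].
Qed.

Lemma qpoch_S x q n : qpoch x q (S n) = qpoch x q n * (1 - q ^ n * x).
Proof. by []. Qed.

(** Each factor satisfies |1 - q^n x| <= exp(|q|^n |x|), and the exponents form a geometric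
    series. *)
Lemma qpoch_bounded q (x : C) : nome q -> exists B, forall n, (Cmod (qpoch x q n) <= B)%R.
Proof.
  move=> [H0 H1].
  have key n : (Cmod (qpoch x q n) <= exp (Cmod x * ((1 - Cmod q ^ n) / (1 - Cmod q))))%R.
  { elim: n => [|n IH].
    - rewrite /qpoch /= Cmod_1 (_ : (1 - 1) / (1 - Cmod q) = 0)%R; last by field; lra.
      rewrite Rmult_0_r exp_0; lra.
    - rewrite qpoch_S Cmod_mult.
      have I : (Cmod (1 - q ^ n * x) <= exp (Cmod q ^ n * Cmod x))%R.
      { have := Cmod_triangle 1 (- (q ^ n * x)). rewrite Cmod_opp Cmod_1 Cmod_mult Cmod_pow -/(Cminus _ _).
        have := exp_ineq1_le (Cmod q ^ n * Cmod x). lra. }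
      have -> : (Cmod x * ((1 - Cmod q ^ S n) / (1 - Cmod q)) =
         Cmod x * ((1 - Cmod q ^ n) / (1 - Cmod q)) + Cmod q ^ n * Cmod x)%R by rewrite /=; field; lra.
      rewrite exp_plus. apply: Rmult_le_compat => //; exact: Cmod_ge_0. }
  exists (exp (Cmod x * (1 / (1 - Cmod q)))) => n.
  apply: Rle_trans (key n) _. apply: exp_mono. apply: Rmult_le_compat_l; first exact: Cmod_ge_0.
  apply: Rmult_le_compat_r; first by apply: Rlt_le; apply: Rinv_0_lt_compat; lra.
  have : (0 <= Cmod q ^ n)%R by apply: pow_le; lra. lra.
Qed.

(** The increments of the partial products are a bounded sequence times q^n x, hence summable; the
    products are their telescoping sums. *)
Lemma qpoch_cv q (x : C) : nome q -> exists l, clim (qpoch x q) l.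
Proof.
  move=> Hq. have [B HB] := qpoch_bounded x Hq. case: (Hq) => H0 H1.
  have B0 : (0 <= B)%R by apply: Rle_trans (Cmod_ge_0 _) (HB 0%nat).
  have S : summable (fun n => - (qpoch x q n * (q ^ n * x))).
  { apply: (@summable_nat_geom _ (B * Cmod x) (Cmod q)) => [|n]; first lra.
    rewrite Cmod_opp !Cmod_mult Cmod_pow.
    have := HB n. have := Cmod_ge_0 x. have : (0 <= Cmod q ^ n)%R by apply: pow_le; lra.
    move: (Cmod q ^ n)%R (Cmod x) (Cmod (qpoch x q n)) => a b c Ha Hb Hc.
    have : (c * (a * b) <= B * (a * b))%R by apply: Rmult_le_compat_r => //; apply: Rmult_le_pos. lra. }
  have [s Hs] := summable_HS S. exists (s + 1).
  apply: clim_ext (clim_plus (HS_clim Hs) (clim_const 1)) => n.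
  elim: n => [|n IH]; first by rewrite /= Cplus_0_l.
  rewrite seq_S lsum_app qpoch_S -IH /=. rewrite -IH. ring.
Qed.

Definition qp (x q : C) : C := Cprod_inf (fun i => 1 - q ^ i * x).

Lemma qp_clim q x : nome q -> clim (qpoch x q) (qp x q).
Proof. move=> Hq; have [l Hl] := qpoch_cv x Hq. by rewrite /qp (Cprod_inf_clim Hl). Qed.

(** Beyond a suitable N the numbers |q^i x| add up to at most 1/2, and prod (1 - a_i) >= 1 - sum a_i
    keeps the partial products at or above half the modulus of the N-th one, which is not zero. *)
Lemma qp_nz q (x : C) : nome q -> (forall i, 1 - q ^ i * x <> 0) -> qp x q <> 0.
Proof.
  move=> Hq Hx. case: (Hq) => H0 H1.
  have [N HN] : exists N, (Cmod x / (1 - Cmod q) * Cmod q ^ N <= 1 / 2)%R.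
  { have Hc : (0 <= Cmod x / (1 - Cmod q))%R.
    { apply: Rmult_le_pos; [exact: Cmod_ge_0 | apply: Rlt_le; apply: Rinv_0_lt_compat; lra]. }
    have [N HN] := pow_lt_1_zero (Cmod q) ltac:(rewrite Rabs_pos_eq; lra)
        (1 / 2 / (Cmod x / (1 - Cmod q) + 1))%R ltac:(apply: Rdiv_lt_0_compat; lra).
    exists N. have := HN N (Nat.le_refl _). rewrite Rabs_pos_eq; last by apply: pow_le; lra.
    move: (Cmod x / (1 - Cmod q))%R Hc => c Hc I.
    apply: Rle_trans (Rmult_le_compat_l c _ _ Hc (Rlt_le _ _ I)) _.
    apply: (Rmult_le_reg_r (c + 1)); first lra.
    have -> : (c * (1 / 2 / (c + 1)) * (c + 1) = c / 2)%R by field; lra. lra. }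
  have PN : (0 < Cmod (qpoch x q N))%R.
  { apply/Cmod_gt_0. elim: (N) => [|n IH]; first exact: C1_nz. rewrite qpoch_S. exact: Cmult_neq_0. }
  (* The subtracted quantity is the sum of |q|^i |x| over N <= i < N + n in closed form. *)
  have key n : (Cmod (qpoch x q N) * (1 - Cmod x / (1 - Cmod q) * (Cmod q ^ N - Cmod q ^ (N + n))) <= Cmod (qpoch x q (N + n)))%R.
  { elim: n => [|n IH].
    - rewrite Nat.add_0_r Rminus_diag Rmult_0_r; lra.
    - rewrite Nat.add_succ_r qpoch_S Cmod_mult.
      have I : (1 - Cmod q ^ (N + n) * Cmod x <= Cmod (1 - q ^ (N + n) * x))%R.
      { have := Cmod_triangle (1 - q ^ (N + n) * x) (q ^ (N + n) * x).
        have -> : 1 - q ^ (N + n) * x + q ^ (N + n) * x = 1 by ring.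
        rewrite Cmod_1 Cmod_mult Cmod_pow. lra. }
      have E : (Cmod x / (1 - Cmod q) * (Cmod q ^ N - Cmod q ^ S (N + n)) =
        Cmod x / (1 - Cmod q) * (Cmod q ^ N - Cmod q ^ (N + n)) + Cmod q ^ (N + n) * Cmod x)%R by rewrite /=; field; lra.
      rewrite E.
      have Hc : (0 <= Cmod x / (1 - Cmod q))%R.
      { apply: Rmult_le_pos; [exact: Cmod_ge_0 | apply: Rlt_le; apply: Rinv_0_lt_compat; lra]. }
      have Hb : (0 <= Cmod q ^ (N + n) <= Cmod q ^ N)%R.
      { split; first by apply: pow_le; lra. rewrite pow_add.
        have : (Cmod q ^ n <= 1)%R by rewrite -(pow1 n); apply: pow_incr; lra.
        have : (0 <= Cmod q ^ N)%R by apply: pow_le; lra. nra. }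
      have Hxx := Cmod_ge_0 x. have HT := Cmod_ge_0 (1 - q ^ (N + n) * x).
      move: (Cmod x / (1 - Cmod q))%R HN Hc IH {E} => c HN Hc IH.
      move: (Cmod q ^ N)%R (Cmod q ^ (N + n))%R (Cmod x) (Cmod (qpoch x q N)) (Cmod (qpoch x q (N + n))) (Cmod (1 - q ^ (N + n) * x)) PN HN Hc Hb Hxx HT IH I
        => a b y P R T HP HN Hc Hb Hy HT IH I.
      set u := (c * (a - b))%R in IH |- *.
      have Hu : (0 <= u <= 1 / 2)%R.
      { rewrite /u; split; [apply: Rmult_le_pos; lra |]. have := Rmult_le_pos c b Hc (proj1 Hb). lra. }
      have Hv : (0 <= b * y)%R by apply: Rmult_le_pos; lra.
      case: (Rle_dec (b * y) 1) => Hby.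
      + have J1 : (P * (1 - u) * (1 - b * y) <= R * T)%R.
        { apply: Rmult_le_compat => //; [|lra]. apply: Rmult_le_pos; lra. }
        have : (P * (1 - u) * (1 - b * y) = P * (1 - (u + b * y)) + P * u * (b * y))%R by ring.
        have : (0 <= P * u * (b * y))%R by apply: Rmult_le_pos => //; apply: Rmult_le_pos; lra. lra.
      + have : (P * (1 - (u + b * y)) <= 0)%R by nra.
        have : (0 <= P * (1 - u))%R by apply: Rmult_le_pos; lra.
        move=> J2 J3. have HR : (0 <= R)%R by lra.
        have : (0 <= R * T)%R by apply: Rmult_le_pos. lra. }
  move=> E. have Hlim := qp_clim x Hq. rewrite E in Hlim.
  have [M HM] := Hlim (Cmod (qpoch x q N) / 2)%R ltac:(lra).
  have := HM (N + M)%nat ltac:(lia). rewrite (_ : qpoch x q (N + M) - 0 = qpoch x q (N + M)); last by ring.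
  have := key M.
  have : (Cmod x / (1 - Cmod q) * (Cmod q ^ N - Cmod q ^ (N + M)) <= 1 / 2)%R.
  { have : (0 <= Cmod x / (1 - Cmod q))%R.
    { apply: Rmult_le_pos; [exact: Cmod_ge_0 | apply: Rlt_le; apply: Rinv_0_lt_compat; lra]. }
    move=> Hc. have : (0 <= Cmod q ^ (N + M))%R by apply: pow_le; lra.
    move=> Hb. have := Rmult_le_pos _ _ Hc Hb. lra. }
  nra.
Qed.

Definition euler (q : C) : C := qp q q.

Lemma J_euler a q : J a q = euler (q ^ a).
Proof.
  rewrite /J /euler /qp. congr Cprod_inf. apply: functional_extensionality => i.
  rewrite -Cpow_mult_r -Cpow_add_r. congr (1 - q ^ _). lia.
Qed.

Lemma qinf_euler q : qinf q = euler q.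
Proof.
  rewrite /qinf /euler /qp. congr Cprod_inf. apply: functional_extensionality => i.
  by rewrite Cpow_S Cmult_comm.
Qed.

Lemma nome_1m q n : nome q -> (0 < n)%nat -> 1 - q ^ n <> 0.
Proof.
  move=> Hq Hn E. have := nome_pow Hq Hn => [[_ H]].
  have K : q ^ n = 1 by rewrite -[RHS](_ : 1 - (1 - q ^ n) = _); [ring | rewrite E; ring].
  rewrite K Cmod_1 in H; lra.
Qed.

Lemma euler_nz q : nome q -> euler q <> 0.
Proof.
  move=> Hq; apply: qp_nz => // i. rewrite Cmult_comm -Cpow_S. apply: nome_1m => //; lia.
Qed.

Lemma qpoch_qq_nz q n : nome q -> qpoch q q n <> 0.
Proof.
  move=> Hq; elim: n => [|n IH]; first exact: C1_nz.
  rewrite qpoch_S; apply: Cmult_neq_0 => //. rewrite Cmult_comm -Cpow_S. apply: nome_1m => //; lia.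
Qed.

Lemma qp_shift q x : nome q -> qp x q = (1 - x) * qp (q * x) q.
Proof.
  move=> Hq; apply: (clim_unique (u := fun n => qpoch x q (S n))).
  - apply: (clim_subseq (phi := S)) => [n|]; [lia | exact: qp_clim].
  - apply: clim_ext (clim_mult (clim_const (1 - x)) (qp_clim (q * x) Hq)) => n.
    elim: n => [|n IH]; first by rewrite /qpoch /=; ring.
    rewrite [RHS]qpoch_S -IH qpoch_S Cpow_S. ring.
Qed.

Lemma qp_sq q x : nome q -> qp x q * qp (- x) q = qp (x ^ 2) (q ^ 2).
Proof.
  move=> Hq; apply: (clim_unique (clim_mult (qp_clim x Hq) (qp_clim (- x) Hq))).
  apply: clim_ext (qp_clim (x ^ 2) (nome_pow (k := 2) Hq ltac:(lia))) => n.
  elim: n => [|n IH]; first by rewrite /qpoch /=; ring.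
  rewrite !qpoch_S IH -Cpow_mult_r (Nat.mul_comm 2) Cpow_mult_r. ring.
Qed.

Lemma qp_dup q x : nome q -> qp x q = qp x (q ^ 2) * qp (q * x) (q ^ 2).
Proof.
  move=> Hq. have Hq2 := nome_pow (k := 2) Hq ltac:(lia).
  apply: (clim_unique (u := fun n => qpoch x q (2 * n))).
  - apply: (clim_subseq (phi := fun n => (2 * n)%nat)) => [n|]; [lia | exact: qp_clim].
  - apply: clim_ext (clim_mult (qp_clim x Hq2) (qp_clim (q * x) Hq2)) => n.
    elim: n => [|n IH]; first by rewrite /qpoch /=; ring.
    rewrite (_ : 2 * S n = S (S (2 * n)))%nat; [|lia].
    rewrite !qpoch_S -IH -Cpow_mult_r !Cpow_S. ring.
Qed.

(** Reciprocal of (q;q)_m, extended by 0 to negative m as 1/Gamma is. The recursion [ip_pred] then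
    holds for every integer, and finite sums can run over all of Z. *)
Definition ip (q : C) (m : Z) : C := if Z_lt_dec m 0 then 0 else / qpoch q q (Z.to_nat m).

Lemma ip_neg q m : (m < 0)%Z -> ip q m = 0.
Proof. by rewrite /ip; case: Z_lt_dec. Qed.

Lemma ip_nat q n : ip q (Z.of_nat n) = / qpoch q q n.
Proof. rewrite /ip; case: Z_lt_dec => H; [lia | by rewrite Nat2Z.id]. Qed.

Lemma ip_pred q m : nome q -> ip q (m - 1) = (1 - q ^^ m) * ip q m.
Proof.
  move=> Hq. case: (Z_lt_dec m 0) => H; first by rewrite !ip_neg; [ring | lia | lia].
  case: (Z.eq_dec m 0) => [->|H0]; first by rewrite ip_neg //=; ring.
  have [n ->] : exists n, m = Z.of_nat (S n) by exists (Z.to_nat (m - 1)); lia.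
  rewrite (_ : Z.of_nat (S n) - 1 = Z.of_nat n)%Z; [|lia].
  rewrite !ip_nat pz_nat qpoch_S (Cmult_comm (q ^ n)) -Cpow_S.
  have H1 := qpoch_qq_nz (n := n) Hq. have H2 : 1 - q ^ S n <> 0 by apply: nome_1m => //; lia.
  by field.
Qed.

Lemma ip_clim q k : nome q -> clim (fun n => ip q (Z.of_nat n + k)) (/ euler q).
Proof.
  move=> Hq eps He.
  have [N HN] := clim_inv (euler_nz Hq) (qp_clim q Hq) He.
  exists (N + Z.abs_nat k)%nat => n Hn.
  rewrite (_ : Z.of_nat n + k = Z.of_nat (Z.to_nat (Z.of_nat n + k)))%Z; [|lia].
  rewrite ip_nat. apply: HN. lia.
Qed.

Lemma ip_bounded q : nome q -> exists B, (0 < B)%R /\ forall m, (Cmod (ip q m) <= B)%R.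
Proof.
  move=> Hq. have [M [M0 HM]] := clim_bounded (ip_clim 0 Hq).
  exists M; split => // m. case: (Z_lt_dec m 0) => H; first by rewrite ip_neg // Cmod_0; lra.
  have := HM (Z.to_nat m). rewrite (_ : Z.of_nat (Z.to_nat m) + 0 = m)%Z //; lia.
Qed.

Lemma th_S q (x : C) k : nome q -> x <> 0 -> th q x (k + 1) = - (q ^^ k * x) * th q x k.
Proof.
  move=> Hq Hx. have Hq0 := nome_nz Hq. rewrite /th.
  have -> : ((k + 1) * (k + 1 - 1) / 2 = k * (k - 1) / 2 + k)%Z.
  { apply: tri_eq. have := tri_double k; nia. }
  rewrite !pz_S //; last exact: m1_nz. rewrite pz_add //. ring.
Qed.

(** Finite form of the triple product, with the q-binomial coefficients of 2N over N + k as weights.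
    Induction on N multiplies by one more factor of each Pochhammer symbol and compares
    coefficients. *)
Lemma jtp_finite q (x : C) N : nome q -> x <> 0 ->
  HS (fun k => qpoch q q (2 * N) * ip q (Z.of_nat N - k) * ip q (Z.of_nat N + k) * th q x k)
     (qpoch x q N * qpoch (q / x) q N).
Proof.
  move=> Hq Hx. have Hq0 := nome_nz Hq.
  elim: N => [|N IH].
  - set f := (X in HS X _).
    have -> : qpoch x q 0 * qpoch (q / x) q 0 = f 0%Z.
    { rewrite /f /ip /th /qpoch /=. by field. }
    apply: HS_single => k Hk. rewrite /f. case: (Z_lt_dec k 0) => H.
    + rewrite (ip_neg q (m := (Z.of_nat 0 + k)%Z)); [ring | lia].
    + rewrite (ip_neg q (m := (Z.of_nat 0 - k)%Z)); [ring | lia].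
  - rewrite (_ : 2 * S N = S (S (2 * N)))%nat; [|lia]. rewrite !qpoch_S. set s := _ * _ in IH.
    (* The new factors expand to 1 + q^(2N+1), a multiple of x and a multiple of 1/x; the last two
       shift the summation index by -1 and by 1. *)
    have -> : qpoch x q N * (1 - q ^ N * x) * (qpoch (q / x) q N * (1 - q ^ N * (q / x)))
      = ((1 + q ^ (2 * N + 1)) * s + (- (q ^ N * x)) * s) + (- (q ^ N * q / x)) * s.
    { rewrite /s Cpow_add_r (Nat.mul_comm 2) Cpow_mult_r /=. by field. }
    have H1 := HS_shift (-1) IH. have H2 := HS_shift 1 IH.
    apply: HS_ext (HS_plus (HS_plus (HS_scal (1 + q ^ (2 * N + 1)) IH) (HS_scal (- (q ^ N * x)) H1))
       (HS_scal (- (q ^ N * q / x)) H2)) => k.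
    rewrite (th_S k) //.
    have -> : th q x k = - (q ^^ (k + -1) * x) * th q x (k + -1).
    { by rewrite -th_S //; congr th; lia. }
    set t := th q x (k + -1).
    set n := Z.of_nat N.
    have En : Z.of_nat (S N) = (n + 1)%Z by lia. rewrite En.
    have E1 : ip q (n - k) = (1 - q ^^ (n + 1 - k)) * ip q (n + 1 - k) by rewrite -ip_pred //; congr ip; lia.
    have E2 : ip q (n + k) = (1 - q ^^ (n + 1 + k)) * ip q (n + 1 + k) by rewrite -ip_pred //; congr ip; lia.
    have E3 : ip q (n - (k + 1)) = (1 - q ^^ (n - k)) * ip q (n - k) by rewrite -ip_pred //; congr ip; lia.
    have E4 : ip q (n + (k + -1)) = (1 - q ^^ (n + k)) * ip q (n + k) by rewrite -ip_pred //; congr ip; lia.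
    have E5 : ip q (n - (k + -1)) = ip q (n + 1 - k) by congr ip; lia.
    have E6 : ip q (n + (k + 1)) = ip q (n + 1 + k) by congr ip; lia.
    rewrite E3 E4 E5 E6 E1 E2.
    have P1 : q ^^ (n + 1 - k) = q ^ N * q / q ^^ k by rewrite pz_sub // pz_S // pz_nat.
    have P2 : q ^^ (n + 1 + k) = q ^ N * q * q ^^ k by rewrite pz_add // pz_S // pz_nat.
    have P3 : q ^^ (n - k) = q ^ N / q ^^ k by rewrite pz_sub // pz_nat.
    have P4 : q ^^ (n + k) = q ^ N * q ^^ k by rewrite pz_add // pz_nat.
    have P5 : q ^^ (k + -1) = q ^^ k / q by rewrite -/(Z.sub k 1) pz_sub // pz_1.
    rewrite P1 P2 P3 P4 P5.
    have P6 : q ^ (2 * N) = (q ^ N) ^ 2 by rewrite (Nat.mul_comm 2) Cpow_mult_r.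
    rewrite Cpow_add_r ?Cpow_S P6 ?Cpow_1_r.
    have K := pz_nz (n := k) Hq0. by field.
Qed.

(** Limit of [jtp_finite]: the weights are bounded and tend to 1/(q)_infinity, so dominated
    convergence applies on the theta side. *)
Lemma jtp q (x : C) : nome q -> x <> 0 ->
  jtheta x q = euler q * qp x q * qp (q / x) q.
Proof.
  move=> Hq Hx. have HE := euler_nz Hq.
  have [B [B0 HB]] := ip_bounded Hq. have [B' HB'] := qpoch_bounded q Hq.
  have L1 : clim (fun N => qpoch x q N * qpoch (q / x) q N) (jtheta x q / euler q).
  { have HG : HS (fun k => / euler q * th q x k) (jtheta x q / euler q).
    { rewrite /Cdiv Cmult_comm. exact: HS_scal (HS_j Hq Hx). }
    have HB0 : (0 <= B')%R by apply: Rle_trans (Cmod_ge_0 _) (HB' 0%nat).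
    apply: (HS_dominated (g := fun k => RtoC (B' * B * B) * th q x k) _ _ _ (fun N => jtp_finite N Hq Hx) HG).
    - apply: summable_scal. exact: proj1 (HS_j Hq Hx).
    - move=> N k. have R0 : (0 <= B' * B * B)%R by repeat apply: Rmult_le_pos; lra.
      move: (th q x k) => t. rewrite !Cmod_mult Cmod_R (Rabs_pos_eq _ R0).
      apply: Rmult_le_compat_r; first exact: Cmod_ge_0.
      apply: Rmult_le_compat => //; try exact: Cmod_ge_0.
      + apply: Rmult_le_pos; exact: Cmod_ge_0.
      + apply: Rmult_le_compat => //; exact: Cmod_ge_0.
    - move=> k. apply: clim_mult (clim_const _).
      have -> : / euler q = euler q * / euler q * / euler q by field.
      apply: clim_mult; first apply: clim_mult.
      + apply: (clim_subseq (phi := fun n => (2 * n)%nat)) => [n|]; [lia | exact: qp_clim].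
      + exact: ip_clim.
      + exact: ip_clim. }
  have E := clim_unique L1 (clim_mult (qp_clim x Hq) (qp_clim (q / x) Hq)).
  rewrite -Cmult_assoc -E. by field.
Qed.

(** * Partial fractions and mock theta functions *)

(** Says that x is no integer power of q, that is, no zero of [jtheta x q]; see [j_nz] and
    [j_generic]. *)
Definition generic (q x : C) : Prop := forall k : Z, 1 - x * q ^^ k <> 0.

Lemma Csub_eq (u v : C) : u - v = 0 -> u = v.
Proof. move=> H. have -> : u = u - v + v by ring. rewrite H; ring. Qed.

Lemma j_nz q (x : C) : nome q -> x <> 0 -> generic q x -> jtheta x q <> 0.
Proof.
  move=> Hq Hx Hg. have Hq0 := nome_nz Hq. rewrite jtp //.
  apply: Cmult_neq_0; first apply: Cmult_neq_0; first exact: euler_nz.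
  - apply: qp_nz => // i. have := Hg (Z.of_nat i). by rewrite pz_nat Cmult_comm.
  - apply: qp_nz => // i E. apply: (Hg (- Z.of_nat (S i))%Z). rewrite pz_negnat Cpow_S.
    have Hi := Cpow_nz q i Hq0.
    have E1 : q ^ i * (q / x) = 1 by apply: eq_sym; apply: Csub_eq.
    have -> : x * / (q * q ^ i) = / (q ^ i * (q / x)) by field.
    rewrite E1; by field.
Qed.

Lemma j_generic q (x : C) : nome q -> x <> 0 -> jtheta x q <> 0 -> generic q x.
Proof.
  move=> Hq Hx Hj k E. apply: Hj. have Hq0 := nome_nz Hq.
  have Hk := pz_nz (n := k) Hq0.
  have -> : x = q ^^ (- k) * 1.
  { rewrite pz_opp. have E1 : x * q ^^ k = 1 by apply: eq_sym; apply: Csub_eq.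
    by rewrite -E1; field. }
  rewrite j_shift //; last exact: C1_nz. rewrite j_1 //; ring.
Qed.

Lemma nome2 q : nome q -> nome (q ^ 2).
Proof. move=> H; apply: nome_pow => //; lia. Qed.

Lemma nome4 q : nome q -> nome (q ^ 4).
Proof. move=> H; apply: nome_pow => //; lia. Qed.

Lemma j_sq q (x : C) : nome q -> x <> 0 ->
  jtheta x q * jtheta (- x) q * euler (q ^ 2) = jtheta (x ^ 2) (q ^ 2) * euler q ^ 2.
Proof.
  move=> Hq Hx. rewrite !jtp //; try exact: nome2; try exact: Copp_nz; try exact: Cpow_nz.
  have H1 := qp_sq x Hq. have H2 := qp_sq (q / x) Hq.
  have E1 : (q / x) ^ 2 = q ^ 2 / x ^ 2 by field.
  have E2 : q / - x = - (q / x) by field.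
  rewrite E1 in H2. rewrite E2 -H1 -H2; ring.
Qed.

Lemma j_dup q (x : C) : nome q -> x <> 0 ->
  jtheta x q * euler (q ^ 2) ^ 2 = jtheta x (q ^ 2) * jtheta (q * x) (q ^ 2) * euler q.
Proof.
  move=> Hq Hx. have Hq0 := nome_nz Hq.
  rewrite !jtp //; try exact: nome2; try exact: Cmult_neq_0.
  rewrite (qp_dup x Hq) (qp_dup (q / x) Hq).
  have -> : q ^ 2 / (q * x) = q / x by field.
  have -> : q * (q / x) = q ^ 2 / x by field.
  ring.
Qed.

Lemma euler_qp q : nome q -> euler q = qp q (q ^ 2) * euler (q ^ 2).
Proof. move=> Hq. rewrite {1}/euler (qp_dup q Hq) /euler. congr (_ * qp _ _). ring. Qed.

(** The odd factors of [euler q] and [euler (- q)] multiply to (q^2;q^4)_infinity, which is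
    [euler (q ^ 2)] over [euler (q ^ 4)]. *)
Lemma euler_opp q : nome q -> euler q * euler (- q) * euler (q ^ 4) = euler (q ^ 2) ^ 3.
Proof.
  move=> Hq. have H1 := euler_qp Hq. have H2 := euler_qp (nome_opp Hq).
  have H3 := euler_qp (nome2 Hq). have H4 := qp_sq q (nome2 Hq).
  have E1 : (- q) ^ 2 = q ^ 2 by ring. have E2 : (q ^ 2) ^ 2 = q ^ 4 by ring.
  rewrite E1 in H2. rewrite E2 in H3 H4.
  rewrite H1 H2.
  transitivity (qp q (q ^ 2) * qp (- q) (q ^ 2) * euler (q ^ 4) * euler (q ^ 2) ^ 2); first ring.
  rewrite H4 -H3. ring.
Qed.

Lemma j_m1 q : nome q -> jtheta (-(1)) q * euler q = 2 * euler (q ^ 2) ^ 2.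
Proof.
  move=> Hq. rewrite jtp //; last exact: m1_nz.
  have E1 : q / -(1) = - q by field; exact: m1_nz.
  rewrite E1 (qp_shift (-(1)) Hq) (_ : q * - (1) = - q); last by ring.
  have := qp_sq q Hq. rewrite -/(euler q) -/(euler (q ^ 2)) => <-. ring.
Qed.

Lemma j_half q : nome q -> jtheta q (q ^ 2) * euler (q ^ 2) = euler q ^ 2.
Proof.
  move=> Hq. have Hq0 := nome_nz Hq. rewrite jtp //; last exact: nome2.
  have -> : q ^ 2 / q = q by field. rewrite (euler_qp Hq); ring.
Qed.

Lemma j_quarter q : nome q -> jtheta q (q ^ 4) * euler (q ^ 2) = euler q * euler (q ^ 4).
Proof.
  move=> Hq. have Hq0 := nome_nz Hq. rewrite jtp //; last exact: nome4.
  have -> : q ^ 4 / q = q ^ 2 * q by field. rewrite (euler_qp Hq).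
  have := qp_dup q (nome2 Hq). have -> : (q ^ 2) ^ 2 = q ^ 4 by ring.
  move=> ->; ring.
Qed.

Lemma clim_pow q : nome q -> clim (fun n => q ^ n) 0.
Proof.
  move=> [H0 H1] eps He.
  have [N HN] := pow_lt_1_zero (Cmod q) ltac:(rewrite Rabs_pos_eq; lra) eps He.
  exists N => n Hn. have := HN n Hn. rewrite (_ : q ^ n - 0 = q ^ n); last by ring.
  rewrite Cmod_pow Rabs_pos_eq //. apply: pow_le; lra.
Qed.

Lemma Cinv_mult (u v : C) : / (u * v) = / u * / v.
Proof.
  case: (Classical_Prop.classic (u = 0)) => [->|Hu].
  - by rewrite Cmult_0_l Cinv_0 Cmult_0_l.
  - case: (Classical_Prop.classic (v = 0)) => [->|Hv]; last by field.
    by rewrite Cmult_0_r Cinv_0 Cmult_0_r.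
Qed.

(** The values converge at both ends, to 1 as k tends to infinity and to 0 as k tends to minus
    infinity. *)
Lemma inv_bounded q (x : C) : nome q -> x <> 0 ->
  exists B, (0 < B)%R /\ forall k : Z, (Cmod (/ (1 - x * q ^^ k)) <= B)%R.
Proof.
  move=> Hq Hx. have Hq0 := nome_nz Hq.
  have L1 : clim (fun n => / (1 - x * q ^ n)) (/ (1 - x * 0)).
  { apply: clim_inv; first by rewrite Cmult_0_r /Cminus Copp_0 Cplus_0_r; exact: C1_nz.
    have -> : 1 - x * 0 = 1 + - x * 0 by ring.
    apply: clim_ext (clim_plus (clim_const 1) (clim_mult (clim_const (- x)) (clim_pow Hq))) => n; ring. }
  have L2 : clim (fun n => q ^ n * / (q ^ n - x)) (0 * / (0 - x)).
  { apply: clim_mult (clim_pow Hq) _. apply: clim_inv; first by rewrite /Cminus Cplus_0_l; exact: Copp_nz.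
    apply: clim_plus (clim_pow Hq) (clim_const _). }
  have L2' : clim (fun n => / (1 - x * q ^^ (- Z.of_nat n))) (0 * / (0 - x)).
  { apply: clim_ext L2 => n. rewrite pz_negnat. have Hn := Cpow_nz q n Hq0.
    have -> : 1 - x * / q ^ n = (q ^ n - x) * / q ^ n by field.
    rewrite Cinv_mult. have -> : / / q ^ n = q ^ n by field. ring. }
  have [B1 [H1 HB1]] := clim_bounded L1. have [B2 [H2 HB2]] := clim_bounded L2'.
  exists (B1 + B2)%R; split; first lra. move=> k; case: (Z_le_dec 0 k) => Hk.
  - have := HB1 (Z.to_nat k). rewrite -pz_nat Z2Nat.id //. lra.
  - have := HB2 (Z.to_nat (- k)). rewrite Z2Nat.id ?Z.opp_involutive; [lra | lia].
Qed.

Lemma summable_bounded_mul {I} (u f : I -> C) (B : R) :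
  (forall i, (Cmod (u i) <= B)%R) -> summable f -> summable (fun i => u i * f i).
Proof.
  move=> Hu Hf. apply: summable_le (summable_scal (RtoC B) Hf) => i.
  rewrite !Cmod_mult Cmod_R. apply: Rmult_le_compat_r; first exact: Cmod_ge_0.
  apply: Rle_trans (Hu i) (Rle_abs _).
Qed.

Lemma ip2_bounded q : nome q -> exists B, forall m n, (Cmod (ip q m * ip q n) <= B)%R.
Proof.
  move=> Hq. have [B [B0 HB]] := ip_bounded Hq. exists (B * B)%R => m n.
  rewrite Cmod_mult. apply: Rmult_le_compat => //; exact: Cmod_ge_0.
Qed.

Lemma th_x q (x y : C) k : th q (x * y) k = th q x k * y ^^ k.
Proof. rewrite /th pz_base_mul; ring. Qed.

Lemma th_1 q k : th q q k = th q 1 k * q ^^ k.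
Proof. by rewrite -th_x Cmult_1_l. Qed.

Lemma th_opp q k : nome q -> th q q (- k) = th q 1 k.
Proof.
  move=> Hq. rewrite /th sgn_opp pz_base1 Cmult_1_r -Cmult_assoc -pz_add; last exact: nome_nz.
  congr (_ * _ ^^ _). have := tri_double k. have := tri_double (- k). nia.
Qed.

(** Up to a factor this is the q-binomial expansion of a product with a zero factor. The recurrence
    [rec] in b shows it directly: its right-hand factor 1 - q^b vanishes at b = 0, and from there
    zero propagates upwards. *)
Lemma ip_vanish q A B : nome q ->
  HS (fun k => th q 1 k * (ip q (Z.of_nat (S A) - k) * ip q (Z.of_nat B + k))) 0.
Proof.
  move=> Hq. have Hq0 := nome_nz Hq.
  have [M HM] := ip2_bounded Hq.
  have Sm (b : Z) : exists s, HS (fun k => th q 1 k * (ip q (Z.of_nat (S A) - k) * ip q (b + k))) s.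
  { apply: summable_HS.
    apply: (summable_le _ (summable_bounded_mul (u := fun k => ip q (Z.of_nat (S A) - k) * ip q (b + k)) (fun k => HM _ _) (proj1 (HS_j Hq C1_nz)))) => k.
    rewrite Cmult_comm; apply: Rle_refl. }
  have rec (b : Z) s t :
    HS (fun k => th q 1 k * (ip q (Z.of_nat (S A) - k) * ip q (b + k))) s ->
    HS (fun k => th q 1 k * (ip q (Z.of_nat (S A) - k) * ip q (b - 1 + k))) t ->
    (1 - q ^^ (Z.of_nat (S A) + b)) * s = (1 - q ^^ b) * t.
  { move=> Hs Ht. apply: (HS_unique (HS_scal _ Hs)).
    have -> : (1 - q ^^ b) * t = t + - q ^^ b * t by ring.
    apply: HS_ext (HS_plus Ht (HS_scal (- q ^^ b) (HS_shift 1 Ht))) => k.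
    rewrite th_S //; last exact: C1_nz.
    have -> : ip q (b - 1 + k) = (1 - q ^^ (b + k)) * ip q (b + k) by rewrite -ip_pred //; congr ip; lia.
    have -> : ip q (Z.of_nat (S A) - (k + 1)) = (1 - q ^^ (Z.of_nat (S A) - k)) * ip q (Z.of_nat (S A) - k)
      by rewrite -ip_pred //; congr ip; lia.
    have -> : ip q (b - 1 + (k + 1)) = ip q (b + k) by congr ip; lia.
    rewrite pz_sub // !pz_add //. have K := pz_nz (n := k) Hq0. by field. }
  elim: B => [|B IH].
  - have [s Hs] := Sm 0%Z. have [t Ht] := Sm (0 - 1)%Z.
    have E := rec 0%Z s t Hs Ht. rewrite Z.add_0_r pz_nat pz_0 in E.
    have Hn := nome_1m (n := S A) Hq ltac:(lia).
    suff <- : s = 0 by [].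
    have -> : s = / (1 - q ^ S A) * ((1 - q ^ S A) * s) by field.
    rewrite E; ring.
  - have [s Hs] := Sm (Z.of_nat (S B)).
    have E := rec _ s 0 Hs. rewrite (_ : Z.of_nat (S B) - 1 = Z.of_nat B)%Z in E; last by lia.
    have {}E := E IH. rewrite -Nat2Z.inj_add pz_nat Cmult_0_r in E.
    have Hn := nome_1m (n := (S A + S B)%nat) Hq ltac:(lia).
    suff <- : s = 0 by [].
    have -> : s = / (1 - q ^ (S A + S B)) * ((1 - q ^ (S A + S B)) * s) by field.
    rewrite E; ring.
Qed.

Definition pf_term q (x : C) A B (k : Z) : C :=
  th q q k * (ip q (Z.of_nat A - k) * ip q (Z.of_nat B + k)) / (1 - x * q ^^ k).

Lemma pf_summable q (x : C) : nome q -> x <> 0 ->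
  exists M, (0 <= M)%R /\ forall A B k, (Cmod (pf_term q x A B k) <= Cmod (RtoC M * th q q k))%R.
Proof.
  move=> Hq Hx. have [M HM] := ip2_bounded Hq. have [M' [M0 HM']] := inv_bounded Hq Hx.
  have M1 : (0 <= M)%R by apply: Rle_trans (Cmod_ge_0 _) (HM 0%Z 0%Z).
  have M2 : (0 <= M' * M)%R by apply: Rmult_le_pos; lra.
  exists (M' * M)%R; split => // A B k. rewrite /pf_term /Cdiv.
  move: (th q q k) => t.
  rewrite Cmod_mult (Cmod_mult t) (Cmod_mult (RtoC _)) Cmod_R (Rabs_pos_eq _ M2).
  have := HM (Z.of_nat A - k)%Z (Z.of_nat B + k)%Z. have := HM' k.
  have := Cmod_ge_0 (/ (1 - x * q ^^ k)).
  have := Cmod_ge_0 (ip q (Z.of_nat A - k) * ip q (Z.of_nat B + k)).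
  have := Cmod_ge_0 t.
  move: (Cmod t) (Cmod (/ _)) (Cmod (_ * _)) => a b c Ha Hc Hb Hb' Hc'.
  have : (c * b <= M * M')%R by apply: Rmult_le_compat. nra.
Qed.

Lemma qpoch_generic_nz q (x : C) n : generic q x -> qpoch x q n <> 0.
Proof.
  move=> Hg; elim: n => [|n IH]; first exact: C1_nz. rewrite qpoch_S; apply: Cmult_neq_0 => //.
  have := Hg (Z.of_nat n). by rewrite pz_nat Cmult_comm.
Qed.

Lemma generic_refl q (x : C) : nome q -> x <> 0 -> generic q x -> generic q (q / x).
Proof.
  move=> Hq Hx Hg k E. have Hq0 := nome_nz Hq. apply: (Hg (- (k + 1))%Z).
  rewrite pz_opp pz_S //. have Hk := pz_nz (n := k) Hq0.
  have E1 : q / x * q ^^ k = 1 by apply: eq_sym; apply: Csub_eq.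
  have -> : x * / (q ^^ k * q) = / (q / x * q ^^ k) by field. rewrite E1; by field.
Qed.

Lemma inv_of_mul_eq (u v a s : C) : a <> 0 -> a * s = / (u * v) -> / (u * a * v) = s.
Proof.
  move=> Ha E. have -> : s = / a * (a * s) by field. rewrite E !Cinv_mult; ring.
Qed.

(** Multiplying the sum by the newest factor of the product changes each term of the shorter sum
    only by a part without pole; these parts add up to zero by [ip_vanish]. So each factor can be
    adjoined separately, those of the first product and then those of the second. *)
Lemma partial_fractions q (x : C) A B : nome q -> x <> 0 -> generic q x ->
  HS (pf_term q x A B) (/ (qpoch x q (S A) * qpoch (q / x) q B)).
Proof.
  move=> Hq Hx Hg. have Hq0 := nome_nz Hq. have Hg' := generic_refl Hq Hx Hg.
  have [M [M0 HM]] := pf_summable Hq Hx.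
  have Sm A' B' : exists s, HS (pf_term q x A' B') s.
  { apply: summable_HS. apply: summable_le (HM A' B') _. apply: summable_scal. exact: proj1 (HS_j Hq Hq0). }
  elim: B => [|B IHB].
  - elim: A => [|A IHA].
    + have -> : / (qpoch x q 1 * qpoch (q / x) q 0) = pf_term q x 0 0 0.
      { rewrite /pf_term /th /ip /qpoch /=. field. have := Hg 0%Z. by rewrite pz_0 Cmult_1_r. }
      apply: HS_single => k Hk. rewrite /pf_term. case: (Z_lt_dec k 0) => H.
      * rewrite (ip_neg q (m := (Z.of_nat 0 + k)%Z)); [rewrite /Cdiv; ring | lia].
      * rewrite (ip_neg q (m := (Z.of_nat 0 - k)%Z)); [rewrite /Cdiv; ring | lia].
    + have [s Hs] := Sm (S A) 0%nat.
      have Ha : 1 - q ^ (S A) * x <> 0 by have := Hg (Z.of_nat (S A)); rewrite pz_nat Cmult_comm.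
      suff E : (1 - q ^ (S A) * x) * s = / (qpoch x q (S A) * qpoch (q / x) q 0).
      { rewrite qpoch_S (inv_of_mul_eq Ha E). exact: Hs. }
      apply: (HS_unique (HS_scal _ Hs)).
      have -> : / (qpoch x q (S A) * qpoch (q / x) q 0) =
        / (qpoch x q (S A) * qpoch (q / x) q 0) + q ^^ Z.of_nat (S A) * 0 by ring.
      apply: HS_ext (HS_plus IHA (HS_scal _ (ip_vanish A 0 Hq))) => k.
      have -> : pf_term q x A 0 k = pf_term q x (S A) 0 k * (1 - q ^^ (Z.of_nat (S A) - k)).
      { rewrite /pf_term (_ : Z.of_nat A - k = Z.of_nat (S A) - k - 1)%Z; last by lia.
        rewrite ip_pred // /Cdiv; ring. }
      rewrite /pf_term th_1 pz_sub // -pz_nat. have K := pz_nz (n := k) Hq0. have := Hg k => Hgk. by field.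
  - have [s Hs] := Sm A (S B).
    have Ha : 1 - q ^ B * (q / x) <> 0 by have := Hg' (Z.of_nat B); rewrite pz_nat Cmult_comm.
    suff E : (1 - q ^ B * (q / x)) * s = / (qpoch x q (S A) * qpoch (q / x) q B).
    { rewrite (Cmult_comm (qpoch x q (S A))) in E.
      rewrite (qpoch_S (q / x)) (Cmult_comm (qpoch x q (S A))) (inv_of_mul_eq Ha E). exact: Hs. }
    apply: (HS_unique (HS_scal _ Hs)).
    have -> : / (qpoch x q (S A) * qpoch (q / x) q B) =
      / (qpoch x q (S A) * qpoch (q / x) q B) + - (q ^ B * q / x) * 0 by ring.
    apply: HS_ext (HS_plus IHB (HS_scal _ (HS_refl 0 (ip_vanish B A Hq)))) => k.
    have T : th q 1 (- k) = th q q k by rewrite -(th_opp (- k)) // Z.opp_involutive.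
    rewrite Z.sub_0_l T.
    have -> : pf_term q x A B k = pf_term q x A (S B) k * (1 - q ^^ (Z.of_nat (S B) + k)).
    { rewrite /pf_term (_ : Z.of_nat B + k = Z.of_nat (S B) + k - 1)%Z; last by lia.
      rewrite ip_pred // /Cdiv; ring. }
    have -> : ip q (Z.of_nat (S B) - - k) = ip q (Z.of_nat (S B) + k) by congr ip; lia.
    have -> : ip q (Z.of_nat A + - k) = ip q (Z.of_nat A - k) by [].
    rewrite /pf_term pz_add // pz_nat Cpow_S. have K := pz_nz (n := k) Hq0. have := Hg k => Hgk. by field.
Qed.

(** Limit of [partial_fractions] with A = B = N. The two [ip] factors tend to 1/(q)_infinity each,
    and the triple product brings a third one, hence the cube. *)
Lemma j_reciprocal q (x : C) : nome q -> x <> 0 -> generic q x ->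
  HS (fun k => th q q k / (1 - x * q ^^ k)) (euler q ^ 3 / jtheta x q).
Proof.
  move=> Hq Hx Hg. have Hq0 := nome_nz Hq. have HE := euler_nz Hq.
  have Hj := j_nz Hq Hx Hg. rewrite jtp // in Hj.
  have Hp1 : qp x q <> 0 by move=> E; apply: Hj; rewrite E; ring.
  have Hp2 : qp (q / x) q <> 0 by move=> E; apply: Hj; rewrite E; ring.
  have [M [M0 HM]] := pf_summable Hq Hx.
  have [M' [M0' HM']] := inv_bounded Hq Hx.
  have Sth := proj1 (HS_j Hq Hq0).
  have [s Hs] : exists s, HS (fun k => th q q k / (1 - x * q ^^ k)) s.
  { apply: summable_HS. apply: (summable_le _ (summable_bounded_mul HM' Sth)) => k.
    rewrite /Cdiv Cmult_comm; apply: Rle_refl. }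
  have L1 : clim (fun N => / (qpoch x q (S N) * qpoch (q / x) q N)) (/ (qp x q * qp (q / x) q)).
  { apply: clim_inv; first exact: Cmult_neq_0.
    apply: clim_mult (qp_clim _ Hq). apply: (clim_subseq (phi := S)) => [n|]; [lia | exact: qp_clim]. }
  have L2 : clim (fun N => / (qpoch x q (S N) * qpoch (q / x) q N)) (/ euler q * / euler q * s).
  { apply: (HS_dominated (f := fun N => pf_term q x N N) (g := fun k => RtoC M * th q q k) _ _ _
       (fun N => partial_fractions N N Hq Hx Hg) (HS_scal (/ euler q * / euler q) Hs)).
    - exact: summable_scal.
    - move=> N k; exact: HM.
    - move=> k. apply: (clim_ext (u := fun N => (ip q (Z.of_nat N + - k) * ip q (Z.of_nat N + k)) * (th q q k / (1 - x * q ^^ k)))) => [N|].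
      + rewrite /pf_term /Cdiv -/(Z.sub _ _); ring.
      + apply: clim_mult (clim_const _). apply: clim_mult; exact: ip_clim. }
  suff -> : euler q ^ 3 / jtheta x q = s by [].
  rewrite jtp // -(_ : euler q * euler q * (/ euler q * / euler q * s) = s); last by field.
  rewrite -(clim_unique L1 L2). by field.
Qed.

Lemma summable_ip2 q (s a b : Z) : nome q ->
  summable (fun m : Z => q ^^ (m * (m + s)) * (ip q (m + a) * ip q (m + b))).
Proof.
  move=> Hq. have [M HM] := ip2_bounded Hq.
  apply: (summable_le _ (@summable_q q 1 (fun m => m * (m + s))%Z (fun m => ip q (m + a) * ip q (m + b)) 2 (2 * Z.abs s) 0 M Hq C1_nz ltac:(lia) (fun m => HM _ _) _)) => m.
  - rewrite pz_base1 Cmult_1_r (Cmult_comm (q ^^ _)). apply: Rle_refl.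
  - nia.
Qed.

(* By telescoping, the sum does not depend on s (Durfee rectangles). *)
Lemma durfee q (s : Z) : nome q ->
  HS (fun m : Z => q ^^ (m * (m + s)) * (ip q m * ip q (m + s))) (/ euler q).
Proof.
  move=> Hq. have Hq0 := nome_nz Hq.
  pose f s m := q ^^ (m * (m + s)) * (ip q m * ip q (m + s)).
  have Sf t : summable (f t).
  { apply: summable_le (summable_ip2 t 0 t Hq) => m. rewrite Z.add_0_r; apply: Rle_refl. }
  have rec t v : HS (f t) v <-> HS (f (t + 1)%Z) v.
  { have [g Hg] : exists g, HS (fun m => q ^^ (m * (m + t)) * (ip q (m + -1) * ip q (m + t))) g
      := summable_HS (summable_ip2 t (-1) t Hq).
    have K := HS_minus Hg (HS_shift 1 Hg). rewrite (_ : g - g = 0) in K; last by ring.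
    have E m : q ^^ (m * (m + t)) * (ip q (m + -1) * ip q (m + t)) -
       q ^^ ((m + 1) * (m + 1 + t)) * (ip q (m + 1 + -1) * ip q (m + 1 + t)) = f t m - f (t + 1)%Z m.
    { rewrite /f.
      have -> : ip q (m + -1) = (1 - q ^^ m) * ip q m := ip_pred m Hq.
      have -> : ip q (m + t) = (1 - q ^^ (m + t + 1)) * ip q (m + t + 1) by rewrite -ip_pred //; congr ip; lia.
      have -> : ip q (m + 1 + -1) = ip q m by congr ip; lia.
      have -> : ip q (m + 1 + t) = ip q (m + t + 1) by congr ip; lia.
      have -> : ip q (m + (t + 1)) = ip q (m + t + 1) by congr ip; lia.
      have -> : ((m + 1) * (m + 1 + t) = m * (m + t) + (m + (m + t + 1)))%Z by ring.
      have -> : (m * (m + (t + 1)) = m * (m + t) + m)%Z by ring.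
      rewrite (pz_add (m * (m + t))) // (pz_add m (m + t + 1)) // (pz_add (m * (m + t)) m) //. ring. }
    have K' := HS_ext E K.
    split => H.
    - have -> : v = v - 0 by ring. apply: HS_ext (HS_minus H K') => m; ring.
    - have -> : v = v + 0 by ring. apply: HS_ext (HS_plus H K') => m; ring. }
  have rec0 v t : HS (f 0%Z) v <-> HS (f t) v.
  { elim/Z.peano_ind: t => [|t IH|t IH]; first by [].
    - by rewrite IH rec Z.add_1_r.
    - rewrite IH (rec (Z.pred t)) (_ : Z.pred t + 1 = t)%Z //; lia. }
  suff H : HS (f 0%Z) (/ euler q) by exact: (proj1 (rec0 _ s) H).
  have [v Hv] := summable_HS (Sf 0%Z). suff -> : / euler q = v by [].
  have [B [B0 HB]] := ip_bounded Hq.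
  (* The constant value is found by letting s tend to infinity: the term m = 0 tends to
     1/(q)_infinity, terms with m > 0 contain q^(m s), and those with m < 0 are zero. *)
  apply: (clim_unique (u := fun _ => v)); last exact: clim_const.
  apply: (HS_dominated (f := fun n => f (Z.of_nat n)) (f' := fun m => if Z.eq_dec m 0 then / euler q else 0)
     (g := fun m => RtoC (B * B) * q ^^ (m * m) * 1 ^^ m) (s := fun _ => v)).
  - apply: (@summable_q q 1 (fun m => m * m)%Z (fun _ => RtoC (B * B)) 1 0 0 (Rabs (B * B)) Hq C1_nz) => // m.
    + rewrite Cmod_R; apply: Rle_refl. + nia.
  - move=> n m. rewrite pz_base1 Cmult_1_r /f.
    case: (Z_lt_dec m 0) => Hm.
    + rewrite ip_neg // Cmult_0_l Cmult_0_r Cmod_0; exact: Cmod_ge_0.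
    + rewrite !Cmod_mult Cmod_R Rabs_pos_eq; last by nra.
      have H1 := HB m. have H2 := HB (m + Z.of_nat n)%Z.
      have H3 : (Cmod (q ^^ (m * (m + Z.of_nat n))) <= Cmod (q ^^ (m * m)))%R.
      { rewrite !Cmod_pz //; apply: exp_mono.
        have := nome_ln Hq => Hl.
        have : (IZR (m * m) <= IZR (m * (m + Z.of_nat n)))%R by apply: IZR_le; nia. nra. }
      rewrite Rmult_comm. apply: Rmult_le_compat => //; try exact: Cmod_ge_0.
      * apply: Rmult_le_pos; exact: Cmod_ge_0.
      * apply: Rmult_le_compat => //; exact: Cmod_ge_0.
  - move=> m. case: Z.eq_dec => [->|Hm].
    + apply: clim_ext (ip_clim 0 Hq) => n. rewrite /f Z.mul_0_l pz_0 Cmult_1_l Z.add_0_r Z.add_0_l.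
      by rewrite /ip /qpoch /= (_ : / 1 = 1) ?Cmult_1_l //; field.
    + case: (Z_lt_dec m 0) => Hm'.
      * apply: clim_ext (clim_const 0) => n. rewrite /f ip_neg //; ring.
      * have -> : RtoC 0 = q ^^ (m * m) * (0 * (ip q m * / euler q)) by ring.
        have Hk : (0 < Z.to_nat m)%nat by lia.
        apply: clim_ext (clim_mult (clim_const (q ^^ (m * m))) (clim_mult (clim_pow (nome_pow Hq Hk))
          (clim_mult (clim_const (ip q m)) (ip_clim m Hq)))) => n.
        rewrite /f (Z.add_comm m) Z.mul_add_distr_l pz_add // -Cpow_mult_r -pz_nat Nat2Z.inj_mul Z2Nat.id; last by lia.
        ring.
  - move=> n. by apply/rec0.
  - move: (@HS_single Z (fun m => if Z.eq_dec m 0 then / euler q else 0) 0%Z) => /=.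
    apply => m Hm. by case: Z.eq_dec.
Qed.

Lemma durfee_shift q (a b : Z) : nome q ->
  HS (fun m : Z => q ^^ ((m + a) * (m + b)) * (ip q (m + a) * ip q (m + b))) (/ euler q).
Proof.
  move=> Hq. apply: HS_ext (HS_shift a (durfee (b - a) Hq)) => m.
  by have -> : (m + a + (b - a) = m + b)%Z by ring.
Qed.

(* Expand each summand in partial fractions and sum over n by the Durfee
   identity. *)
Lemma universal_mock q (x : C) (b : nat) : nome q -> x <> 0 -> generic q x -> (b <= 1)%nat ->
  exists s, HS (fun n : nat => q ^ (n * (n + b)) / (qpoch x q (S n) * qpoch (q / x) q (n + b))) s /\
    HS (fun k => th q q k * q ^^ (k * (k + Z.of_nat b)) / (1 - x * q ^^ k)) (euler q * s).
Proof.
  move=> Hq Hx Hg Hb. have Hq0 := nome_nz Hq. have HE := euler_nz Hq.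
  have [M [M0 HM]] := pf_summable Hq Hx.
  pose F (p : nat * Z) := q ^ (fst p * (fst p + b)) * pf_term q x (fst p) (fst p + b) (snd p).
  have SF : summable F.
  { have S1 : summable (fun n : nat => q ^ (n * (n + b))).
    { apply: (@summable_nat_geom _ 1 (Cmod q)) => [|n]; first by case: Hq; lra.
      rewrite Cmod_pow. case: Hq => H0 H1.
      have [m ->] : exists m, (n * (n + b) = n + m)%nat by exists (n * (n + b) - n)%nat; nia.
      rewrite pow_add. have : (Cmod q ^ m <= 1)%R by rewrite -(pow1 m); apply: pow_incr; lra.
      have : (0 <= Cmod q ^ n)%R by apply: pow_le; lra. nra. }
    have Sth := summable_scal (RtoC M) (proj1 (HS_j Hq Hq0)).
    apply: summable_le (summable_prod S1 Sth) => [[n k]] /=. rewrite /F /= Cmod_mult (Cmod_mult (q ^ _)).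
    apply: Rmult_le_compat_l; [exact: Cmod_ge_0 | exact: HM]. }
  have [s Hs] := summable_HS SF.
  exists s; split.
  - apply: (HS_fubini Hs) => n. rewrite /Cdiv /F /=.
    exact: (HS_scal (q ^ (n * (n + b))) (partial_fractions n (n + b) Hq Hx Hg)).
  - apply: HS_ext (HS_scal (euler q) (HS_fubini (g := fun k => / euler q * (th q q k * q ^^ (k * (k + Z.of_nat b)) / (1 - x * q ^^ k))) (HS_swap Hs) _)) => k.
    + have Hgk := Hg k. by field.
    + rewrite /F /=.
      (* The shifts come from n (n + b) = k (k + b) + (n - k)(n + b + k). *)
      have H := durfee_shift (- k) (Z.of_nat b + k) Hq.
      have H' : HS (fun n : nat => q ^^ ((Z.of_nat n + - k) * (Z.of_nat n + (Z.of_nat b + k))) *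
         (ip q (Z.of_nat n + - k) * ip q (Z.of_nat n + (Z.of_nat b + k)))) (/ euler q).
      { apply: (proj2 (HS_inj (phi := Z.of_nat) _ _ _) H); first exact: Nat2Z.inj.
        move=> m Hm. have Hneg : (m < 0)%Z.
        { case: (Z_lt_dec m 0) => // H0. case: (Hm (Z.to_nat m)). apply: Z2Nat.id; lia. }
        (* For m < 0 the two arguments cannot both be nonnegative: their sum 2m + b is negative, as
           b <= 1. *)
        case: (Z_lt_dec (m + - k) 0) => Hk; first by rewrite (ip_neg q Hk); ring.
        rewrite (ip_neg q (m := (m + (Z.of_nat b + k))%Z)); [ring | lia]. }
      rewrite Cmult_comm.
      apply: HS_ext (HS_scal _ H') => n. rewrite /pf_term.
      have -> : ip q (Z.of_nat (n + b) + k) = ip q (Z.of_nat n + (Z.of_nat b + k)) by congr ip; lia.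
      rewrite -/(Z.sub _ k).
      have -> : q ^ (n * (n + b)) = q ^^ (k * (k + Z.of_nat b)) * q ^^ ((Z.of_nat n - k) * (Z.of_nat n + (Z.of_nat b + k))).
      { rewrite -pz_add // -pz_nat. congr Cpowz. nia. }
      have Hgk := Hg k. by field.
Qed.

Lemma generic_m1 q : nome q -> generic q (-(1)).
Proof.
  move=> Hq k E. have : (-(1)) * q ^^ k = 1 by apply: eq_sym; apply: Csub_eq.
  move=> E1. have Ha : Cmod (q ^^ k) = 1%R.
  { have <- : Cmod (-(1) * q ^^ k) = Cmod (q ^^ k) by rewrite Cmod_mult Cmod_m1 Rmult_1_l.
    by rewrite E1 Cmod_1. }
  rewrite (Cmod_pz _ (nome_nz Hq)) in Ha.
  have L : (IZR k * ln (Cmod q) = 0)%R by rewrite -(ln_exp (IZR k * ln (Cmod q))) Ha ln_1.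
  have := nome_ln Hq => Hl. have K : IZR k = 0%R by nra.
  have {}K : k = 0%Z by exact: eq_IZR.
  move: E; rewrite K pz_0 => E. have : 2 = 0 :> C by rewrite -E; ring.
  move=> /RtoC_inj; lra.
Qed.

(** The case x = -1, b = 0 of [universal_mock]; the first factor 1 - (-1) = 2 of the Pochhammer
    symbol is responsible for the half. *)
Lemma f3_appell q : nome q ->
  HS (fun k => th q q k * q ^^ (k * k) / (1 + q ^^ k)) (euler q * (f3 q / 2)).
Proof.
  move=> Hq. have Hg := generic_m1 Hq.
  have [s [H1 H2]] := universal_mock Hq m1_nz Hg (ltac:(lia) : (0 <= 1)%nat).
  have E : f3 q = 2 * s.
  { rewrite /f3. apply: Cseries_HS. apply: HS_ext (HS_scal 2 H1) => n.
    rewrite Nat.add_0_r.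
    have Eq1 : q / -(1) = - q by field; exact: m1_nz.
    have Eq2 : qpoch (-(1)) q (S n) = 2 * qpoch (- q) q n.
    { elim: n => [|n IH]; first by rewrite /qpoch /=; ring.
      rewrite qpoch_S IH qpoch_S Cpow_S; ring. }
    have N1 := qpoch_generic_nz (n := n) (generic_refl Hq m1_nz Hg). rewrite Eq1 in N1.
    rewrite Eq1 Eq2. by field. }
  rewrite E. have -> : euler q * (2 * s / 2) = euler q * s by field.
  apply: HS_ext H2 => k. rewrite Z.add_0_r. congr (_ / _). ring.
Qed.

(** The case of base q^2 with x = q and b = 1, where q^2/x = x makes the two Pochhammer symbols
    equal. *)
Lemma omega3_appell q : nome q -> generic (q ^ 2) q ->
  HS (fun k => th (q ^ 2) (q ^ 2) k * (q ^ 2) ^^ (k * (k + 1)) / (1 - q * (q ^ 2) ^^ k))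
     (euler (q ^ 2) * omega3 q).
Proof.
  move=> Hq Hg. have Hq0 := nome_nz Hq. have Hq2 := nome2 Hq.
  have [s [H1 H2]] := universal_mock Hq2 Hq0 Hg (Nat.le_refl 1).
  suff -> : omega3 q = s by [].
  rewrite /omega3. apply: Cseries_HS. apply: HS_ext H1 => n.
  have -> : q ^ 2 / q = q by field.
  rewrite Nat.add_1_r -Cpow_mult_r.
  rewrite (_ : 2 * (n * S n) = 2 * n * S n)%nat; last by ring.
  have N1 := qpoch_generic_nz (n := S n) Hg. by field.
Qed.

(** * Laurent series *)

Definition cis (t : R) : C := (cos t, sin t).

Lemma cis_plus s t : cis (s + t) = cis s * cis t.
Proof. rewrite /cis /Cmult /= cos_plus sin_plus; f_equal; ring. Qed.

Lemma cis_0 : cis 0 = 1.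
Proof. by rewrite /cis cos_0 sin_0. Qed.

Lemma cis_PI : cis PI = -(1).
Proof. rewrite /cis cos_PI sin_PI /Copp /=; f_equal; ring. Qed.

Lemma Cmod_cis t : Cmod (cis t) = 1%R.
Proof.
  rewrite /Cmod /cis /= -[RHS]sqrt_1. f_equal. have := sin2_cos2 t; rewrite /Rsqr; lra.
Qed.

Lemma cis_nz t : cis t <> 0.
Proof. move=> E; have := Cmod_cis t; rewrite E Cmod_0; lra. Qed.

Lemma cis_pz t n : cis t ^^ n = cis (IZR n * t).
Proof.
  have H := cis_nz (t := t).
  elim/Z.peano_ind: n => [|n IH|n IH].
  - by rewrite Rmult_0_l cis_0.
  - by rewrite -Z.add_1_r pz_S // IH plus_IZR Rmult_plus_distr_r Rmult_1_l cis_plus.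
  - rewrite -Z.sub_1_r pz_sub // IH pz_1 minus_IZR.
    have -> : (IZR n * t = (IZR n - 1) * t + t)%R by ring.
    rewrite cis_plus. by field.
Qed.

(* A rotation sending the frequency k to -1 times the frequency m averages k
   away while not increasing any other coefficient. *)
Lemma kill_frequencies (b : Z -> C) (m : Z) (l : list Z) :
  (forall t, HS (fun k => b k * cis (IZR k * t)) 0) ->
  exists c : Z -> C, c m = 1 /\ (forall k, In k l -> k <> m -> c k = 0) /\
    (forall k, (Cmod (c k) <= 1)%R) /\
    forall t, HS (fun k => c k * b k * cis (IZR k * t)) 0.
Proof.
  move=> H; elim: l => [|j l [c [C1 [C2 [C3 C4]]]]].
  - exists (fun _ => 1); split => //; split => //; split => [k|t]; first by rewrite Cmod_1; lra.
    apply: HS_ext (H t) => k; ring.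
  - case: (Z.eq_dec j m) => [->|Hj].
    { exists c; split => //; split => // k [<-|Hk] // Hkm. exact: C2. }
    set p := (PI / IZR (j - m))%R.
    have Hjm : IZR (j - m) <> 0%R by apply: not_0_IZR; lia.
    exists (fun k => c k * (/ 2 * (1 + cis (IZR (k - m) * p)))); split; [|split; [|split]].
    + rewrite Z.sub_diag Rmult_0_l cis_0 C1. by field.
    + move=> k [<-|Hk] Hkm.
      * have -> : (IZR (j - m) * p = PI)%R by rewrite /p; field.
        rewrite cis_PI; ring.
      * rewrite C2 //; ring.
    + move=> k. rewrite !Cmod_mult.
      have H2 : (Cmod (/ 2) = / 2)%R by rewrite Cmod_inv ?Cmod_R ?Rabs_pos_eq //; try lra; move=> /RtoC_inj; lra.
      have := C3 k. have := Cmod_ge_0 (c k).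
      have := Cmod_triangle 1 (cis (IZR (k - m) * p)). rewrite Cmod_1 Cmod_cis H2.
      have := Cmod_ge_0 (1 + cis (IZR (k - m) * p)). nra.
    + move=> t.
      have K := HS_scal (/ 2) (HS_plus (C4 t) (HS_scal (cis (- IZR m * p)) (C4 (t + p)%R))).
      rewrite Cmult_0_r Cplus_0_l Cmult_0_r in K.
      apply: HS_ext K => k. rewrite Rmult_plus_distr_l cis_plus minus_IZR.
      have -> : ((IZR k - IZR m) * p = - IZR m * p + IZR k * p)%R by ring.
      rewrite cis_plus; ring.
Qed.

(** Uniqueness of Fourier coefficients without integration: take finitely many frequencies carrying
    nearly all of the sum of |b|, remove those different from m by [kill_frequencies], and evaluate
    at angle 0. Then b m is balanced by a remainder of at most half its modulus. *)
Lemma circle_unique (b : Z -> C) : (forall t, HS (fun k => b k * cis (IZR k * t)) 0) ->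
  forall m, b m = 0.
Proof.
  move=> H m. apply: Classical_Prop.NNPP => Hne.
  have He := proj1 (Cmod_gt_0 _) Hne.
  have [M HM] : summable b.
  { apply: summable_le (proj1 (H 0%R)) => k. rewrite Rmult_0_r cis_0 Cmult_1_r; apply: Rle_refl. }
  have [S HS'] := @nonneg_has_sum Z (fun i => Cmod (b i)) M (fun i => Cmod_ge_0 _) HM.
  have [l0 H0] := HS' (Cmod (b m) / 4)%R ltac:(lra).
  have [l1 [Hn1 Hi1]] := nodup_super l0.
  have [c [C1 [C2 [C3 C4]]]] := kill_frequencies m l1 H.
  pose B k : C := if eqd k m then 0 else c k * b k.
  have K : HS B (- b m).
  { have K0 : HS (fun k => if eqd k m then b m else 0) (b m).
    { have := @HS_single Z (fun k => if eqd k m then b m else 0) m. case: (eqd m m) => // _.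
      apply => k Hk. by case: eqd. }
    have K1 := HS_minus (C4 0%R) K0. rewrite (_ : 0 - b m = - b m) in K1; last by ring.
    apply: HS_ext K1 => k. rewrite /B Rmult_0_r cis_0 Cmult_1_r.
    case: eqd => [->|_]; [rewrite C1; ring | ring]. }
  have L : (Cmod (- b m) <= Cmod (b m) / 2)%R.
  { apply: HS_le (proj2 K) => l Hl.
    set l2 := filter (fun k => if in_dec eqd k l1 then false else true) l.
    have Hn : NoDup (l1 ++ l2).
    { apply: NoDup_app => //; first exact: NoDup_filter.
      move=> i Hi /filter_In [_]; case: in_dec => //. }
    have I1 := H0 l1 Hn1 Hi1.
    have I2 := H0 (l1 ++ l2) Hn (fun x Hx => in_or_app _ _ _ (or_introl (Hi1 x Hx))).
    rewrite lsumR_app in I2.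
    have I3 : (lsumR (fun k => Cmod (B k)) l <= lsumR (fun k => Cmod (b k)) l2)%R.
    { rewrite /l2; elim: (l) => [|k l' IH] /=; first lra.
      have Hk : (Cmod (B k) <= Cmod (b k))%R.
      { rewrite /B; case: eqd => _; first by rewrite Cmod_0; exact: Cmod_ge_0.
        rewrite Cmod_mult. have := C3 k. have := Cmod_ge_0 (b k). nra. }
      case: (in_dec eqd k l1) => Hin /=; last lra.
      have -> : Cmod (B k) = 0%R.
      { rewrite /B; case: eqd => Hkm; first by rewrite Cmod_0. by rewrite C2 // Cmult_0_l Cmod_0. }
      lra. }
    move: I1 I2; split_Rabs; lra. }
  rewrite Cmod_opp in L; lra.
Qed.

Definition LS (a : Z -> C) (f : C -> C) : Prop :=
  forall x : C, x <> 0 -> HS (fun m => a m * x ^^ m) (f x).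

Lemma laurent_zero (a : Z -> C) (x : C) : x <> 0 ->
  (forall t, HS (fun m => a m * (x * cis t) ^^ m) 0) -> forall m, a m = 0.
Proof.
  move=> Hx H m.
  have K : a m * x ^^ m = 0.
  { apply: (circle_unique (b := fun m => a m * x ^^ m)) => t.
    apply: HS_ext (H t) => k. rewrite pz_base_mul cis_pz; ring. }
  have Hm := pz_nz (n := m) Hx.
  have -> : a m = / x ^^ m * (a m * x ^^ m) by field. rewrite K; ring.
Qed.

Lemma LS_unique a b f : LS a f -> LS b f -> forall m, a m = b m.
Proof.
  move=> Ha Hb m. apply: Csub_eq.
  apply: (laurent_zero (a := fun m => a m - b m) C1_nz) => t.
  have Ht : 1 * cis t <> 0 by apply: Cmult_neq_0; [exact: C1_nz | exact: cis_nz].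
  have -> : 0 = f (1 * cis t) - f (1 * cis t) :> C by ring.
  apply: HS_ext (HS_minus (Ha _ Ht) (Hb _ Ht)) => k; ring.
Qed.

Lemma LS_ext a f g : (forall x : C, x <> 0 -> f x = g x) -> LS a f -> LS a g.
Proof. move=> H Hf x Hx; rewrite -H //; exact: Hf. Qed.

Lemma LS_lin a b f g (c d : C) : LS a f -> LS b g ->
  LS (fun m => c * a m + d * b m) (fun x => c * f x + d * g x).
Proof.
  move=> Ha Hb x Hx. apply: HS_ext (HS_plus (HS_scal c (Ha x Hx)) (HS_scal d (Hb x Hx))) => m; ring.
Qed.

Lemma LS_scale a f (c : C) : c <> 0 -> LS a f -> LS (fun m => a m * c ^^ m) (fun x => f (c * x)).
Proof.
  move=> Hc Ha x Hx. apply: HS_ext (Ha _ (Cmult_neq_0 _ _ Hc Hx)) => m. rewrite pz_base_mul; ring.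
Qed.

Lemma LS_inv a f : LS a f -> LS (fun m => a (- m)%Z) (fun x => f (/ x)).
Proof.
  move=> Ha x Hx. apply: HS_ext (HS_refl 0 (Ha _ (Cinv_nz Hx))) => m.
  by rewrite pz_base_inv Z.sub_0_l Z.opp_involutive.
Qed.

Lemma LS_monomial a f k (c : C) : LS a f ->
  LS (fun m => c * a (m - k)%Z) (fun x => c * x ^^ k * f x).
Proof.
  move=> Ha x Hx. apply: HS_ext (HS_scal (c * x ^^ k) (HS_shift (- k) (Ha _ Hx))) => m.
  rewrite -/(Z.sub m k) pz_sub //. have Hk := pz_nz (n := k) Hx. by field.
Qed.

Lemma LS_mul a b f g : LS a f -> LS b g -> exists c, LS c (fun x => f x * g x).
Proof.
  move=> Ha Hb.
  have P (x : C) (Hx : x <> 0) : HS (fun p : Z * Z => a (snd p) * b (fst p - snd p)%Z * x ^^ fst p) (f x * g x).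
  { pose phi (p : Z * Z) := (snd p, (fst p - snd p)%Z).
    pose psi (p : Z * Z) := ((fst p + snd p)%Z, fst p).
    have H1 p : psi (phi p) = p by case: p => i k; rewrite /phi /psi /=; f_equal; lia.
    have H2 p : phi (psi p) = p by case: p => i k; rewrite /phi /psi /=; f_equal; lia.
    apply: HS_ext (HS_bij H1 H2 (HS_prod (Ha x Hx) (Hb x Hx))) => [[i k]] /=.
    rewrite pz_sub //. have Hk := pz_nz (n := k) Hx. by field. }
  have Hc (i : Z) : exists t, HS (fun k => a k * b (i - k)%Z) t.
  { apply: summable_HS. apply: summable_le (summable_fibre i (proj1 (P 1 C1_nz))) => k /=.
    rewrite pz_base1 Cmult_1_r; apply: Rle_refl. }
  exists (fun i => proj1_sig (constructive_indefinite_description _ (Hc i))) => x Hx.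
  apply: (HS_fubini (P x Hx)) => i. case: constructive_indefinite_description => t Ht /=.
  rewrite Cmult_comm. apply: HS_ext (HS_scal _ Ht) => k; ring.
Qed.

Lemma LS_j q : nome q -> LS (th q 1) (fun x => jtheta x q).
Proof.
  move=> Hq x Hx. apply: HS_ext (HS_j Hq Hx) => m. by rewrite -th_x Cmult_1_l.
Qed.

(** * The theta function divided by 1 - x *)

Section Quotient.
Variable q : C.
Hypothesis Hq : nome q.

(** Dividing a Laurent series by 1 - x replaces its coefficients by their partial sums up to m. *)
Definition hc_spec m s := HS (fun k => if Z_le_dec k m then th q 1 k else 0) s.

Lemma hc_ex m : exists s, hc_spec m s.
Proof.
  apply: summable_HS. apply: summable_le (proj1 (HS_j Hq C1_nz)) => k.
  case: Z_le_dec => _; first by apply: Rle_refl. rewrite Cmod_0; exact: Cmod_ge_0.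
Qed.

Definition hc m : C := proj1_sig (constructive_indefinite_description _ (hc_ex m)).

Lemma hcP m : hc_spec m (hc m).
Proof. by rewrite /hc; case: constructive_indefinite_description. Qed.

Lemma hc_diff m : hc m - hc (m - 1) = th q 1 m.
Proof.
  apply: (HS_unique (HS_minus (hcP m) (hcP (m - 1)))).
  have := @HS_single Z (fun k => (if Z_le_dec k m then th q 1 k else 0) - (if Z_le_dec k (m - 1) then th q 1 k else 0)) m.
  case: Z_le_dec => H1; last lia. case: Z_le_dec => H2; first lia.
  rewrite (_ : th q 1 m - 0 = th q 1 m); last by ring.
  apply => k Hk. case: Z_le_dec => H3; case: Z_le_dec => H4; try lia; ring.
Qed.

Lemma th_refl1 k : th q 1 (1 - k) = - th q 1 k.
Proof.
  have -> : (1 - k = - (k - 1))%Z by lia.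
  have E := th_opp (- (k - 1)) Hq. rewrite Z.opp_involutive in E. rewrite -E th_1.
  have E2 := th_S (k - 1) Hq C1_nz. rewrite Z.sub_add in E2. rewrite E2; ring.
Qed.

(** The coefficients add up to j(1;q) = 0, and the antisymmetry k -> 1 - k carries those beyond m to
    those up to -m. *)
Lemma hc_opp m : hc (- m) = hc m.
Proof.
  have H0 := HS_j Hq C1_nz. rewrite j_1 // in H0.
  have K := HS_plus H0 (HS_refl 1 (hcP (- m))). rewrite Cplus_0_l in K.
  apply: (HS_unique _ (hcP m)). apply: HS_ext K => k.
  rewrite th_refl1. case: Z_le_dec => H1; case: Z_le_dec => H2; try lia; ring.
Qed.

(** Up to m <= 0 every coefficient has the factor q^(m(m-1)/2), since the triangular exponent of k
    is at least that of m plus that of k - m. For m > 0 the decay comes from [hc_opp], that is, from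
    the vanishing total. *)
Lemma hc_bound : exists M, (0 <= M)%R /\
  forall m, (Cmod (hc m) <= M * Cmod (q ^^ (Z.abs m * (Z.abs m + 1) / 2)))%R.
Proof.
  have Hq0 := nome_nz Hq.
  have [M HM] := proj1 (HS_j Hq C1_nz).
  have M0 : (0 <= M)%R by apply: (HM nil); constructor.
  have neg m : (m <= 0)%Z -> (Cmod (hc m) <= M * Cmod (q ^^ (- m * (- m + 1) / 2)))%R.
  { move=> Hm. apply: HS_le (proj2 (hcP m)) => l Hl.
    have H1 := HM (map (fun k => (k - m)%Z) l) (NoDup_map_inj (phi := fun k => (k - m)%Z) ltac:(cbv beta; lia) Hl).
    rewrite lsumR_map in H1.
    rewrite Rmult_comm.
    apply: Rle_trans (Rmult_le_compat_l _ _ _ (Cmod_ge_0 _) H1). rewrite -lsumR_scal.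
    apply: lsumR_le => k _. case: Z_le_dec => Hk; last by rewrite Cmod_0 -Cmod_mult; exact: Cmod_ge_0.
    rewrite /th !pz_base1 !Cmult_1_r !Cmod_mult !Cmod_sgn !Rmult_1_l -Cmod_mult -pz_add //.
    rewrite !Cmod_pz //. apply: exp_mono.
    have := nome_ln Hq. move=> Hl0.
    have : (IZR (- m * (- m + 1) / 2 + (k - m) * (k - m - 1) / 2) <= IZR (k * (k - 1) / 2))%R.
    { apply: IZR_le. have := tri_double k. have := tri_double (k - m). have := tri_double (- m + 1).
      rewrite (_ : (- m + 1) * (- m + 1 - 1) = - m * (- m + 1))%Z; last by ring. nia. }
    nra. }
  exists M; split => // m. case: (Z_le_dec m 0) => Hm.
  - rewrite Z.abs_neq //; exact: neg.
  - rewrite -hc_opp Z.abs_eq; last by lia. have := neg (- m)%Z ltac:(lia). by rewrite Z.opp_involutive.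
Qed.

Lemma hc_summable (x : C) : x <> 0 -> summable (fun m => hc m * x ^^ m).
Proof.
  move=> Hx. have [M [M0 HM]] := hc_bound.
  apply: (summable_le _ (@summable_q q x (fun m => Z.abs m * (Z.abs m + 1) / 2)%Z (fun _ => RtoC M) 2 0 0 (Rabs M) Hq Hx ltac:(lia) _ _)) => m.
  - rewrite !Cmod_mult Cmod_R (Rabs_pos_eq _ M0). apply: Rmult_le_compat_r; [exact: Cmod_ge_0 | exact: HM].
  - rewrite Cmod_R; apply: Rle_refl.
  - have := tri_double (Z.abs m + 1). rewrite (_ : (Z.abs m + 1) * (Z.abs m + 1 - 1) = Z.abs m * (Z.abs m + 1))%Z; [nia | ring].
Qed.

Lemma h_ex (x : C) : exists s, x <> 0 -> HS (fun m => hc m * x ^^ m) s.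
Proof.
  case: (Classical_Prop.classic (x = 0)) => Hx; first by exists 0.
  have [s Hs] := summable_HS (hc_summable Hx). by exists s.
Qed.

(* jtheta x q / (1 - x), continued to x = 1 *)
Definition h (x : C) : C := proj1_sig (constructive_indefinite_description _ (h_ex x)).

Lemma LS_h : LS hc h.
Proof. move=> x Hx; rewrite /h; case: constructive_indefinite_description => s /=; exact. Qed.

Lemma h_j (x : C) : x <> 0 -> (1 - x) * h x = jtheta x q.
Proof.
  move=> Hx. have H := LS_h Hx. apply: eq_sym; apply: j_eq.
  have -> : (1 - x) * h x = h x - x * h x by ring.
  apply: HS_ext (HS_minus H (HS_scal x (HS_shift (-1) H))) => m.
  rewrite -[x in th q x]Cmult_1_l th_x -hc_diff -/(Z.sub m 1) pz_sub // pz_1. by field.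
Qed.

Lemma h_inv (x : C) : x <> 0 -> h (/ x) = h x.
Proof.
  move=> Hx. apply: (HS_unique (LS_h (Cinv_nz Hx))).
  apply: HS_ext (HS_refl 0 (LS_h Hx)) => m. by rewrite Z.sub_0_l hc_opp pz_base_inv.
Qed.

End Quotient.

Lemma clim_pz (u : nat -> C) (s : C) m : s <> 0 -> clim u s -> clim (fun n => u n ^^ m) (s ^^ m).
Proof.
  move=> Hs Hu.
  have P k : clim (fun n => u n ^ k) (s ^ k).
  { elim: k => [|k IH]; first exact: clim_const.
    apply: clim_ext (clim_mult Hu IH) => n. by rewrite Cpow_S. }
  case: (Z_le_dec 0 m) => Hm.
  - have [k ->] : exists k, m = Z.of_nat k by exists (Z.to_nat m); lia.
    rewrite pz_nat. apply: clim_ext (P k) => n. by rewrite pz_nat.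
  - have [k ->] : exists k, (m = - Z.of_nat k)%Z by exists (Z.to_nat (- m)); lia.
    rewrite pz_negnat. apply: clim_ext (clim_inv (Cpow_nz s k Hs) (P k)) => n. by rewrite pz_negnat.
Qed.

Lemma Cmod_sub_ge (u v : C) : (Cmod u - Cmod v <= Cmod (u - v))%R.
Proof. have := Cmod_triangle (u - v) v. have -> : u - v + v = u by ring. lra. Qed.

Lemma pz_RtoC_mod (x : R) m : (0 < x)%R -> Cmod (RtoC x ^^ m) = exp (IZR m * ln x).
Proof.
  move=> Hx. rewrite Cmod_pz; last by move=> /RtoC_inj; lra. rewrite Cmod_R Rabs_pos_eq //; lra.
Qed.

(* Let x tend to 1 in the partial fractions of 1 / jtheta x q. *)
Lemma h_1 q (Hq : nome q) : h Hq 1 = euler q ^ 3.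
Proof.
  have Hq0 := nome_nz Hq. have [Q0 Q1] := Hq.
  (* The point 1 + d lies halfway between 1 and 1/|q|, so real points of (1, 1 + d] keep a fixed
     distance from all the poles but x = 1. *)
  set d := ((/ Cmod q - 1) / 2)%R.
  have Hd : (0 < d)%R.
  { have : (1 < / Cmod q)%R by rewrite -Rinv_1; apply: Rinv_lt_contravar; lra. rewrite /d; lra. }
  have Hdq : ((1 + d) * Cmod q < 1)%R.
  { have E : (Cmod q * / Cmod q = 1)%R by field; lra. rewrite /d; nra. }
  have Hd2 : (/ Cmod q - 1 = 2 * d)%R by rewrite /d; field; lra.
  pose x (n : nat) : R := (1 + d * / INR (S n))%R.
  have Hinv n : (0 < / INR (S n) <= 1)%R.
  { split; first by apply: Rinv_0_lt_compat; apply: lt_0_INR; lia.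
    rewrite -Rinv_1; apply: Rinv_le_contravar; [lra | apply: (le_INR 1); lia]. }
  have X1 n : (1 < x n <= 1 + d)%R.
  { have := Hinv n; rewrite /x; nra. }
  have Xnz n : RtoC (x n) <> 0 by move=> /RtoC_inj; have := X1 n; lra.
  have Xlim : clim (fun n => RtoC (x n)) 1.
  { move=> eps He.
    have [N [HN N0]] := archimed_cor1 (eps / d) ltac:(exact: Rdiv_lt_0_compat).
    exists N => n Hn. rewrite -RtoC_minus Cmod_R /x.
    have -> : (1 + d * / INR (S n) - 1 = d * / INR (S n))%R by ring.
    rewrite Rabs_pos_eq; last by apply: Rmult_le_pos; have := Hinv n; lra.
    have H1 : (/ INR (S n) <= / INR N)%R.
    { apply: Rinv_le_contravar; [apply: lt_0_INR; lia | apply: le_INR; lia]. }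
    have : (d * / INR (S n) < d * (eps / d))%R by apply: Rmult_lt_compat_l => //; lra.
    have -> : (d * (eps / d) = eps)%R by field; lra. done. }
  have B1 k n : (0 < k)%Z -> (1 - (1 + d) * Cmod q <= Cmod (1 - RtoC (x n) * q ^^ k))%R.
  { move=> Hk. have := Cmod_sub_ge 1 (RtoC (x n) * q ^^ k). rewrite Cmod_1 Cmod_mult Cmod_R Rabs_pos_eq; last by have := X1 n; lra.
    have : (Cmod (q ^^ k) <= Cmod q)%R.
    { rewrite -{2}(pz_1 q) !Cmod_pz //. apply: exp_mono. have := nome_ln Hq.
      have : (1 <= IZR k)%R by apply: (IZR_le 1); lia. nra. }
    have := Cmod_ge_0 (q ^^ k). have := X1 n. nra. }
  have B2 k n : (k < 0)%Z -> (/ Cmod q - 1 <= Cmod (1 - RtoC (x n) * q ^^ k))%R.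
  { move=> Hk. have := Cmod_sub_ge (RtoC (x n) * q ^^ k) 1.
    have -> : Cmod (RtoC (x n) * q ^^ k - 1) = Cmod (1 - RtoC (x n) * q ^^ k).
    { rewrite -Cmod_opp; congr Cmod; ring. }
    rewrite Cmod_1 Cmod_mult Cmod_R Rabs_pos_eq; last by have := X1 n; lra.
    have : (/ Cmod q <= Cmod (q ^^ k))%R.
    { rewrite -Cmod_inv // -{1}(pz_1 q) -pz_opp !Cmod_pz //. apply: exp_mono. have := nome_ln Hq.
      have : (IZR k <= -1)%R by apply: (IZR_le _ (-1)); lia. rewrite opp_IZR. nra. }
    have := Rinv_0_lt_compat _ Q0. have := X1 n. nra. }
  have Hg n : generic q (RtoC (x n)).
  { move=> k E. have [Hk|[Hk|Hk]] : (0 < k \/ k = 0 \/ k < 0)%Z by lia.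
    - have := B1 k n Hk. rewrite E Cmod_0; lra.
    - move: E; rewrite Hk pz_0 Cmult_1_r -RtoC_minus => /RtoC_inj. have := X1 n; lra.
    - have := B2 k n Hk. rewrite E Cmod_0; lra. }
  set dl := Rmin (1 - (1 + d) * Cmod q) (/ Cmod q - 1).
  have Hdl : (0 < dl)%R by apply: Rmin_pos; lra.
  (* After multiplication by 1 - x only the term k = 0 survives the limit, and it is constantly
     1. *)
  have L1 : clim (fun n => (1 - RtoC (x n)) * (euler q ^ 3 / jtheta (RtoC (x n)) q)) 1.
  { apply: (HS_dominated (f := fun n k => (1 - RtoC (x n)) * (th q q k / (1 - RtoC (x n) * q ^^ k)))
       (f' := fun k => if Z.eq_dec k 0 then 1 else 0) (g := fun k => RtoC (1 + d / dl) * th q q k)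
       (s := fun n => (1 - RtoC (x n)) * (euler q ^ 3 / jtheta (RtoC (x n)) q))).
    - apply: summable_scal; exact: proj1 (HS_j Hq Hq0).
    - move=> n k. have Pd : (0 <= 1 + d / dl)%R by have := Rdiv_lt_0_compat _ _ Hd Hdl; lra.
      have -> : (1 - RtoC (x n)) * (th q q k / (1 - RtoC (x n) * q ^^ k)) =
        ((1 - RtoC (x n)) / (1 - RtoC (x n) * q ^^ k)) * th q q k by field; exact: Hg.
      move: (th q q k) => t.
      rewrite (Cmod_mult _ t) (Cmod_mult (RtoC _) t) Cmod_R (Rabs_pos_eq _ Pd). apply: Rmult_le_compat_r; first exact: Cmod_ge_0.
      rewrite Cmod_div; last exact: Hg.
      case: (Z.eq_dec k 0) => [->|Hk].
      + rewrite pz_0 Cmult_1_r. have Hp : (0 < Cmod (1 - RtoC (x n)))%R.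
        { apply/Cmod_gt_0 => E. apply: (Hg n 0%Z). by rewrite pz_0 Cmult_1_r. }
        have := Rdiv_lt_0_compat _ _ Hd Hdl. have -> : (Cmod (1 - RtoC (x n)) / Cmod (1 - RtoC (x n)) = 1)%R by field; lra. lra.
      + have Hden : (dl <= Cmod (1 - RtoC (x n) * q ^^ k))%R.
        { case: (Z_lt_dec 0 k) => Hk'.
          - exact: Rle_trans (Rmin_l _ _) (B1 k n Hk').
          - apply: Rle_trans (Rmin_r _ _) (B2 k n _); lia. }
        have Hnum : (Cmod (1 - RtoC (x n)) <= d)%R.
        { rewrite -RtoC_minus Cmod_R Rabs_left1; have := X1 n; lra. }
        have : (Cmod (1 - RtoC (x n)) / Cmod (1 - RtoC (x n) * q ^^ k) <= d / dl)%R.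
        { apply: Rmult_le_compat => //; first exact: Cmod_ge_0.
          - apply: Rlt_le; apply: Rinv_0_lt_compat; lra.
          - apply: Rinv_le_contravar => //. }
        lra.
    - move=> k. case: Z.eq_dec => [->|Hk].
      + apply: clim_ext (clim_const 1) => n. rewrite /th /=. field.
        have := Hg n 0%Z. by rewrite pz_0 Cmult_1_r.
      + have [M [M0 HM]] : exists M, (0 < M)%R /\ forall n, (Cmod (th q q k / (1 - RtoC (x n) * q ^^ k)) <= M)%R.
        { exists (Cmod (th q q k) * / dl + 1)%R; split.
          - have := Cmod_ge_0 (th q q k). have := Rinv_0_lt_compat _ Hdl. nra.
          - move=> n. rewrite Cmod_div; last exact: Hg.
            have Hden : (dl <= Cmod (1 - RtoC (x n) * q ^^ k))%R.
            { case: (Z_lt_dec 0 k) => Hk'.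
              - exact: Rle_trans (Rmin_l _ _) (B1 k n Hk').
              - apply: Rle_trans (Rmin_r _ _) (B2 k n _); lia. }
            have : (/ Cmod (1 - RtoC (x n) * q ^^ k) <= / dl)%R by apply: Rinv_le_contravar.
            have := Cmod_ge_0 (th q q k). rewrite /Rdiv. nra. }
        move=> eps He. have [N HN] := Xlim (eps / M)%R ltac:(exact: Rdiv_lt_0_compat).
        exists N => n Hn. have := HN n Hn.
        rewrite (_ : (1 - RtoC (x n)) * (th q q k / (1 - RtoC (x n) * q ^^ k)) - 0 = - (RtoC (x n) - 1) * (th q q k / (1 - RtoC (x n) * q ^^ k))); last by ring.
        rewrite Cmod_mult Cmod_opp => H.
        apply: Rle_lt_trans (Rmult_le_compat_l _ _ _ (Cmod_ge_0 _) (HM n)) _.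
        apply: Rlt_le_trans (Rmult_lt_compat_r _ _ _ M0 H) _. apply: Req_le; field; lra.
    - move=> n. apply: HS_scal. exact: j_reciprocal.
    - move: (@HS_single Z (fun k => if Z.eq_dec k 0 then RtoC 1 else RtoC 0) 0%Z) => /=.
      apply => k Hk. by case: Z.eq_dec. }
  (* Continuity of [h] at 1 along the sequence: for 1 < x <= 1 + d the power x^k is at most (1 +
     d)^k + 1, so the series at 1 + d and at 1 dominate. *)
  have L2 : clim (fun n => h Hq (RtoC (x n))) (h Hq 1).
  { have Hd1 : RtoC (1 + d) <> 0 by move=> /RtoC_inj; lra.
    have S1 := hc_summable Hq Hd1. have S2 := hc_summable Hq C1_nz.
    pose A (f : Z -> C) k := RtoC (Cmod (f k)).
    have SA (f : Z -> C) : summable f -> summable (A f).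
    { apply: summable_le => k. rewrite /A Cmod_R Rabs_pos_eq; [exact: Rle_refl | exact: Cmod_ge_0]. }
    apply: (HS_dominated (f := fun n k => hc Hq k * RtoC (x n) ^^ k) (f' := fun k => hc Hq k * 1 ^^ k) _ _ _
      (fun n => LS_h Hq (Xnz n)) (LS_h Hq C1_nz)).
    - exact: summable_plus (SA _ S1) (SA _ S2).
    - move=> n k. rewrite /A -RtoC_plus Cmod_R Rabs_pos_eq; last first.
      { apply: Rplus_le_le_0_compat; exact: Cmod_ge_0. }
      rewrite !Cmod_mult pz_base1 Cmod_1 !pz_RtoC_mod; try (have := X1 n; lra).
      have := Cmod_ge_0 (hc Hq k). have X := X1 n.
      have L0 : (0 < ln (x n))%R by rewrite -ln_1; apply: ln_increasing; lra.
      have L1' : (ln (x n) <= ln (1 + d))%R.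
      { case: (proj2 X) => [H|<-]; [apply: Rlt_le; apply: ln_increasing; lra | exact: Rle_refl]. }
      have : (exp (IZR k * ln (x n)) <= exp (IZR k * ln (1 + d)) + 1)%R.
      { case: (Z_le_dec 0 k) => Hk.
        - have Hk' : (0 <= IZR k)%R by apply: IZR_le.
          have : (exp (IZR k * ln (x n)) <= exp (IZR k * ln (1 + d)))%R by apply: exp_mono; nra. lra.
        - have Hk' : (IZR k <= 0)%R by apply: IZR_le; lia.
          have : (exp (IZR k * ln (x n)) <= exp 0)%R by apply: exp_mono; nra.
          rewrite exp_0. have := exp_pos (IZR k * ln (1 + d)). lra. }
      nra.
    - move=> k. apply: clim_mult (clim_const _) _. exact: clim_pz C1_nz Xlim. }
  have E n : h Hq (RtoC (x n)) * ((1 - RtoC (x n)) * (euler q ^ 3 / jtheta (RtoC (x n)) q)) = euler q ^ 3.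
  { have Hj := j_nz Hq (Xnz n) (Hg n). rewrite -(h_j Hq (Xnz n)) in Hj *.
    field. split; move=> E; apply: Hj; rewrite E; ring. }
  have L3 := clim_mult L2 L1. rewrite Cmult_1_r in L3.
  exact: (clim_unique L3 (clim_ext (fun n => eq_sym (E n)) (clim_const _))).
Qed.

(** * Appell sums of level three *)

Section AppellTheta.
Variable q : C.
Hypothesis Hq : nome q.
Let HQ : nome (q ^ 4) := nome4 Hq.

(* j times a level-three Appell sum, in a form that is regular at the poles *)
Definition AT (b e : Z) (F : C -> C) : Prop := forall x : C, x <> 0 ->
  HS (fun n => (-(1)) ^^ n * q ^^ (8 * n * n + b * n) * x ^^ (4 * n + e) * h HQ ((q ^ 4) ^^ n * x)) (F x).

(** Expanding [h] gives a double series whose exponent has the leading form 8 n^2 + 4 n k + 2 k^2 =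
    (2n + k)^2 + 4 n^2 + k^2, positive definite; it may therefore be regrouped by the total power of
    x. *)
Lemma AT_laurent b e : exists a F, LS a F /\ AT b e F.
Proof.
  have Hq0 := nome_nz Hq.
  have [M [M0 HM]] := hc_bound HQ.
  pose G (x : C) (p : Z * Z) := (-(1)) ^^ fst p * q ^^ (8 * fst p * fst p + b * fst p + 4 * fst p * snd p)
     * x ^^ (4 * fst p + e + snd p) * hc HQ (snd p).
  have SG (x : C) : x <> 0 -> summable (G x).
  { move=> Hx. have Hx4 := pz_nz (n := 4%Z) Hx.
    have K := @summable_q2 q (x ^^ 4) x
      (fun n k => 8 * n * n + b * n + 4 * n * k + 4 * (Z.abs k * (Z.abs k + 1) / 2))%Z
      (fun _ => RtoC M * x ^^ e) 1 (Z.abs b) 0 (Cmod (RtoC M * x ^^ e)) Hq Hx4 Hx ltac:(lia) (fun _ => Rle_refl _).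
    apply: (summable_le _ (K _)).
    - move=> [n k]; rewrite /G /=.
      rewrite -(pz_mul 4 n Hx) !(pz_add _ _ Hx) (pz_add _ (4 * (Z.abs k * (Z.abs k + 1) / 2)) Hq0).
      rewrite (_ : q ^^ (4 * (Z.abs k * (Z.abs k + 1) / 2)) = (q ^ 4) ^^ (Z.abs k * (Z.abs k + 1) / 2)); last by rewrite pow_pz.
      have := HM k. move: (hc HQ k) ((q ^ 4) ^^ _) => u v Huv.
      rewrite !Cmod_mult Cmod_sgn Cmod_R (Rabs_pos_eq _ M0).
      move: (Cmod (q ^^ _)) (Cmod (x ^^ (4 * n))) (Cmod (x ^^ e)) (Cmod (x ^^ k)) (Cmod_ge_0 (q ^^ (8 * n * n + b * n + 4 * n * k))) (Cmod_ge_0 (x ^^ (4 * n))) (Cmod_ge_0 (x ^^ e)) (Cmod_ge_0 (x ^^ k)) => A B D E HA HB HD HE.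
      have : (0 <= A * B * D * E)%R by repeat apply: Rmult_le_pos.
      move: Huv; move: (Cmod u) (Cmod v) => U V Huv H0.
      have := Rmult_le_compat_l _ _ _ H0 Huv. lra.
    - move=> n k. have := tri_double (Z.abs k + 1).
      rewrite (_ : (Z.abs k + 1) * (Z.abs k + 1 - 1) = Z.abs k * (Z.abs k + 1))%Z; last by ring.
      have : (0 <= (2 * n + k) * (2 * n + k))%Z by exact: Z.square_nonneg.
      have : (- (Z.abs b * Z.abs n) <= b * n)%Z by rewrite -Z.abs_mul; lia.
      have : (Z.abs k * Z.abs k = k * k)%Z by exact: Z.abs_square.
      have : (0 <= Z.abs b * Z.abs k)%Z by apply: Z.mul_nonneg_nonneg; exact: Z.abs_nonneg.
      nia. }
  pose T (x : C) n := (-(1)) ^^ n * q ^^ (8 * n * n + b * n) * x ^^ (4 * n + e) * h HQ ((q ^ 4) ^^ n * x).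
  have HT (x : C) n : x <> 0 -> HS (fun k => G x (n, k)) (T x n).
  { move=> Hx. have Hn := pz_nz (n := n) (nome_nz HQ).
    apply: HS_ext (HS_scal _ (LS_h HQ (Cmult_neq_0 _ _ Hn Hx))) => k.
    rewrite /G /= pz_base_mul -(pz_mul n k (nome_nz HQ)) (pz_add _ k Hx) (pz_add _ (4 * n * k) Hq0) (pow_pz 4 (n * k) Hq0).
    ofnat. rewrite Z.mul_assoc. ring. }
  have Hex (x : C) : exists s, x <> 0 -> HS (T x) s.
  { case: (Classical_Prop.classic (x = 0)) => Hx; first by exists 0.
    have [s Hs] := summable_HS (SG x Hx). exists s => _. apply: (HS_fubini Hs) => n. exact: HT. }
  pose F x := proj1_sig (constructive_indefinite_description _ (Hex x)).
  have HF (x : C) : x <> 0 -> HS (T x) (F x).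
  { by rewrite /F; case: constructive_indefinite_description. }
  have HG (x : C) : x <> 0 -> HS (G x) (F x).
  { move=> Hx. have [s Hs] := summable_HS (SG x Hx).
    suff -> : F x = s by []. apply: (HS_unique (HF x Hx)). apply: (HS_fubini Hs) => n. exact: HT. }
  pose phi (p : Z * Z) := (snd p, (fst p - 4 * snd p - e)%Z).
  pose psi (p : Z * Z) := ((4 * fst p + e + snd p)%Z, fst p).
  have H1 p : psi (phi p) = p by case: p => i k; rewrite /phi /psi /=; f_equal; lia.
  have H2 p : phi (psi p) = p by case: p => i k; rewrite /phi /psi /=; f_equal; lia.
  have HR (x : C) (Hx : x <> 0) : HS (fun p => x ^^ fst p * G 1 (phi p)) (F x).
  { apply: HS_ext (HS_bij H1 H2 (HG x Hx)) => [[m n]]. rewrite /G /phi /= pz_base1.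
    rewrite (_ : 4 * n + e + (m - 4 * n - e) = m)%Z; [ring | lia]. }
  have Ha (m : Z) : exists s, HS (fun n => G 1 (phi (m, n))) s.
  { apply: summable_HS. apply: summable_le (summable_fibre m (proj1 (HR 1 C1_nz))) => n /=.
    rewrite pz_base1 Cmult_1_l; apply: Rle_refl. }
  exists (fun m => proj1_sig (constructive_indefinite_description _ (Ha m))), F; split; last exact: HF.
  move=> x Hx. apply: (HS_fubini (HR x Hx)) => m. case: constructive_indefinite_description => s Hs /=.
  rewrite Cmult_comm. exact: HS_scal.
Qed.

(** Passing from n to n + 1 absorbs the factor q^4 into the argument of [h]. *)
Lemma AT_shift b e F (x : C) : AT b e F -> x <> 0 ->
  F (q ^ 4 * x) = - q ^^ (4 * e - 8 - b) * x ^^ (-4) * F x.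
Proof.
  move=> HF Hx. have Hq0 := nome_nz Hq. have HQ0 := nome_nz HQ.
  apply: (HS_unique (HF _ (Cmult_neq_0 _ _ HQ0 Hx))).
  apply: HS_ext (HS_scal _ (HS_shift 1 (HF x Hx))) => n.
  have -> : (q ^ 4) ^^ (n + 1) * x = (q ^ 4) ^^ n * (q ^ 4 * x) by rewrite pz_S //; ring.
  set H := h HQ _. rewrite pz_S; last exact: m1_nz. rewrite pz_base_mul pow_pz //.
  have -> : (4 * (n + 1) + e = 4 * n + e + 4)%Z by ring. rewrite (pz_add _ 4 Hx).
  rewrite (_ : -4 = - (4))%Z // (pz_opp x). ofnat.
  have -> : (8 * (n + 1) * (n + 1) + b * (n + 1) = 8 * n * n + b * n + 4 * (4 * n + e) - (4 * e - 8 - b))%Z by ring.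
  rewrite (pz_sub _ (4 * e - 8 - b)) // (pz_add _ (4 * (4 * n + e))) //.
  have K1 := pz_nz (n := 4%Z) Hx. have K2 := pz_nz (n := (4 * e - 8 - b)%Z) Hq0.
  by field.
Qed.

Lemma AT_inv b e F e' G (x : C) : AT b e F -> AT (- b) e' G -> x <> 0 ->
  F (/ x) = x ^^ (- e - e') * G x.
Proof.
  move=> HF HG Hx. have HQ0 := nome_nz HQ.
  apply: (HS_unique (HF _ (Cinv_nz Hx))).
  apply: HS_ext (HS_scal _ (HS_refl 0 (HG x Hx))) => n.
  rewrite Z.sub_0_l sgn_opp pz_base_inv pz_opp.
  have -> : / (q ^ 4) ^^ n * x = / ((q ^ 4) ^^ n * / x).
  { have K := pz_nz (n := n) HQ0. by field. }
  rewrite h_inv; last by apply: Cmult_neq_0; [exact: pz_nz | exact: Cinv_nz].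
  have -> : (8 * - n * - n + - b * - n = 8 * n * n + b * n)%Z by ring.
  have -> : (- (4 * n + e) = - e - e' + (4 * - n + e'))%Z by ring.
  rewrite (pz_add (- e - e')) //. ring.
Qed.

(** The theta function vanishes at every power of its base, and 1 - x only at the zeroth. *)
Lemma h_pow n : n <> 0%Z -> h HQ ((q ^ 4) ^^ n) = 0.
Proof.
  move=> Hn. have HQ0 := nome_nz HQ. have K := pz_nz (n := n) HQ0.
  have H := h_j HQ K. rewrite -[X in jtheta X]Cmult_1_r j_shift // in H; last exact: C1_nz.
  rewrite j_1 // Cmult_0_r in H.
  have H1 : 1 - (q ^ 4) ^^ n <> 0.
  { move=> E. have E1 : (q ^ 4) ^^ n = 1 by apply: eq_sym; apply: Csub_eq.
    have := Cmod_pz n HQ0. rewrite E1 Cmod_1 => E2.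
    have := nome_ln HQ. have : (IZR n * ln (Cmod (q ^ 4)) = 0)%R by rewrite -(ln_exp (_ * _)) -E2 ln_1.
    have : IZR n <> 0%R by apply: not_0_IZR. nra. }
  have -> : h HQ ((q ^ 4) ^^ n) = / (1 - (q ^ 4) ^^ n) * ((1 - (q ^ 4) ^^ n) * h HQ ((q ^ 4) ^^ n)) by field.
  rewrite H; ring.
Qed.

(** By [h_pow] only n = 0 survives at x = 1. This is the elementary one of the two values that
    determine an Appell sum. *)
Lemma AT_1 b e F : AT b e F -> F 1 = euler (q ^ 4) ^ 3.
Proof.
  move=> HF. apply: (HS_unique (HF 1 C1_nz)).
  pose g n := (-(1)) ^^ n * q ^^ (8 * n * n + b * n) * 1 ^^ (4 * n + e) * h HQ ((q ^ 4) ^^ n * 1).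
  have <- : g 0%Z = euler (q ^ 4) ^ 3.
  { rewrite /g (_ : 8 * 0 * 0 + b * 0 = 0)%Z; last by ring.
    rewrite pz_base1 !pz_0 !Cmult_1_l. exact: h_1. }
  apply: (HS_single (f := g)) => n Hn. rewrite /g Cmult_1_r h_pow //; ring.
Qed.

(** Off the poles, [h] is j divided by 1 - x, and quasi-periodicity of j contributes q^(-2n^2+2n)
    x^(-n): the exponent 8 n^2 drops to 6 n^2 and x^(4n) to x^(3n), which is level three. *)
Lemma AT_generic b e F (x : C) : AT b e F -> x <> 0 -> generic (q ^ 4) x ->
  HS (fun n => q ^^ (6 * n * n + (b + 2) * n) * x ^^ (3 * n + e) / (1 - x * (q ^ 4) ^^ n))
     (F x / jtheta x (q ^ 4)).
Proof.
  move=> HF Hx Hg. have HQ0 := nome_nz HQ. have Hq0 := nome_nz Hq. have Hj := j_nz HQ Hx Hg.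
  rewrite /Cdiv Cmult_comm.
  apply: HS_ext (HS_scal _ (HF x Hx)) => n.
  have K := pz_nz (n := n) HQ0. have Hgn := Hg n.
  have H := h_j HQ (Cmult_neq_0 _ _ K Hx). rewrite j_shift // in H.
  have -> : h HQ ((q ^ 4) ^^ n * x) = / (1 - x * (q ^ 4) ^^ n) * ((1 - (q ^ 4) ^^ n * x) * h HQ ((q ^ 4) ^^ n * x)) by field.
  rewrite H (pow_pz 4 (- (n * (n - 1) / 2)) Hq0). ofnat.
  have -> : (4 * - (n * (n - 1) / 2) = (6 * n * n + (b + 2) * n) - (8 * n * n + b * n))%Z.
  { have := tri_double n; nia. }
  have -> : (4 * n + e = 3 * n + e + n)%Z by ring.
  rewrite pz_sub // (pz_add (3 * n + e)) // pz_opp.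
  have K1 := pz_nz (n := n) Hx. have K2 := pz_nz (n := (8 * n * n + b * n)%Z) Hq0.
  transitivity (((-(1)) ^^ n * (-(1)) ^^ n) * (q ^^ (6 * n * n + (b + 2) * n) * x ^^ (3 * n + e) * / (1 - x * (q ^ 4) ^^ n))).
  - by field.
  - rewrite sgn_sqr; ring.
Qed.

End AppellTheta.

(** Quasi-periodicity of degree four makes four consecutive Laurent coefficients determine all of
    them; the symmetry under inversion relates these, and in both uses below two remain free. *)
Definition theta_like (Q kappa : C) (t : Z) (a : Z -> C) (f : C -> C) : Prop :=
  LS a f /\ (forall x : C, x <> 0 -> f (Q * x) = kappa / x ^ 4 * f x) /\
  (forall x : C, x <> 0 -> f (/ x) = x ^^ (- t) * f x).

Lemma theta_like_lin Q k t a b f g (c d : C) : theta_like Q k t a f -> theta_like Q k t b g ->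
  theta_like Q k t (fun m => c * a m + d * b m) (fun x => c * f x + d * g x).
Proof.
  move=> [F1 [F2 F3]] [G1 [G2 G3]]; split; [exact: LS_lin | split => x Hx].
  - rewrite F2 // G2 //; ring.
  - rewrite F3 // G3 //; ring.
Qed.

Lemma theta_like_rec (Q k : C) t a f : Q <> 0 -> theta_like Q k t a f ->
  (forall m, a m * Q ^^ m = k * a (m + 4)%Z) /\ (forall m, a (- m)%Z = a (m + t)%Z).
Proof.
  move=> HQ [F1 [F2 F3]]; split.
  - have K1 := LS_scale HQ F1. have K2 := LS_monomial (-4) k F1.
    have K3 : LS (fun m => k * a (m - -4)%Z) (fun x => f (Q * x)).
    { apply: LS_ext K2 => x Hx. rewrite F2 // (_ : -4 = - Z.of_nat 4)%Z // pz_negnat //. }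
    move=> m. exact: LS_unique K1 K3 m.
  - have K1 := LS_inv F1. have K2 := LS_monomial (- t) 1 F1.
    have K3 : LS (fun m => 1 * a (m - - t)%Z) (fun x => f (/ x)).
    { apply: LS_ext K2 => x Hx. rewrite F3 //; ring. }
    move=> m. rewrite (LS_unique K1 K3 m) Z.sub_opp_r; ring.
Qed.

Lemma theta_like_zero (Q k : C) t a f r : Q <> 0 -> k <> 0 -> theta_like Q k t a f ->
  a r = 0 -> a (r + 1)%Z = 0 -> a (r + 2)%Z = 0 -> a (r + 3)%Z = 0 ->
  forall x : C, x <> 0 -> f x = 0.
Proof.
  move=> HQ Hk Hf H0 H1 H2 H3 x Hx.
  have [R1 _] := theta_like_rec HQ Hf.
  have up m : a m = 0 <-> a (m + 4)%Z = 0.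
  { have Hm := pz_nz (n := m) HQ. have E := R1 m. split => H.
    - have -> : a (m + 4)%Z = / k * (k * a (m + 4)%Z) by field. rewrite -E H; ring.
    - have -> : a m = / Q ^^ m * (a m * Q ^^ m) by field. rewrite E H; ring. }
  have all m i : a m = 0 -> a (m + 4 * i)%Z = 0.
  { move=> Hm. elim/Z.peano_ind: i => [|i IH|i IH]; first by rewrite Z.mul_0_r Z.add_0_r.
    - rewrite (_ : m + 4 * Z.succ i = m + 4 * i + 4)%Z; [exact: (proj1 (up _) IH) | lia].
    - apply: (proj2 (up _)). rewrite (_ : m + 4 * Z.pred i + 4 = m + 4 * i)%Z //; lia. }
  have az m : a m = 0.
  { have D := Z.div_mod (m - r) 4 ltac:(lia). have B := Z.mod_pos_bound (m - r) 4 ltac:(lia).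
    have [E|[E|[E|E]]] : ((m - r) mod 4 = 0 \/ (m - r) mod 4 = 1 \/ (m - r) mod 4 = 2 \/ (m - r) mod 4 = 3)%Z by lia.
    - have -> : (m = r + 4 * ((m - r) / 4))%Z by lia. exact: all.
    - have -> : (m = r + 1 + 4 * ((m - r) / 4))%Z by lia. exact: all.
    - have -> : (m = r + 2 + 4 * ((m - r) / 4))%Z by lia. exact: all.
    - have -> : (m = r + 3 + 4 * ((m - r) / 4))%Z by lia. exact: all. }
  apply: (HS_unique (proj1 Hf x Hx)). apply: HS_ext HS_zero => m. by rewrite az Cmult_0_l.
Qed.

Lemma Cmult_integral (u v : C) : u * v = 0 -> v <> 0 -> u = 0.
Proof. move=> E Hv. have -> : u = u * v * / v by field. rewrite E; ring. Qed.

(** [W f u v] places f in a linear space with faithful coordinates (u, v). Since g1 vanishes at p1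
    and g2 at p2 only, they form a basis dual to the two evaluations, and f is interpolated. Keeping
    [W] abstract serves both parities. *)
Lemma two_dim (W : (C -> C) -> C -> C -> Prop) f g1 g2 (p1 p2 u v a b c d : C) :
  (forall f g u v u' v' (c d : C), W f u v -> W g u' v' ->
     W (fun x => c * f x + d * g x) (c * u + d * u') (c * v + d * v')) ->
  (forall f, W f 0 0 -> forall x : C, x <> 0 -> f x = 0) ->
  W f u v -> W g1 a b -> W g2 c d -> p1 <> 0 -> p2 <> 0 ->
  g1 p1 = 0 -> g1 p2 <> 0 -> g2 p2 = 0 -> g2 p1 <> 0 ->
  forall x : C, x <> 0 -> f x = f p2 / g1 p2 * g1 x + f p1 / g2 p1 * g2 x.
Proof.
  move=> lin zero Hf H1 H2 P1 P2 A1 A2 B2 B1.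
  have cross (x0 s t : C) (Hx : x0 <> 0) : s * a + t * c = 0 -> s * b + t * d = 0 -> s * g1 x0 + t * g2 x0 = 0.
  { move=> E1 E2. have K := lin _ _ _ _ _ _ s t H1 H2. rewrite E1 E2 in K. exact: (zero _ K). }
  (* Were the coordinates of g1 and g2 proportional, evaluation at p1, where g2 does not vanish,
     would force g1 to be zero, against its value at p2. *)
  have HD : a * d - b * c <> 0.
  { move=> HD.
    have Ea : a = 0.
    { have K := cross p1 c (- a) P1 ltac:(ring) ltac:(rewrite -[RHS](Cmult_0_r (-(1))) -HD; ring).
      rewrite A1 in K. apply: (Cmult_integral (v := g2 p1)) => //.
      have -> : a * g2 p1 = - (c * 0 + - a * g2 p1) by ring. rewrite K; ring. }
    have Eb : b = 0.
    { have K := cross p1 d (- b) P1 ltac:(rewrite -HD; ring) ltac:(ring).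
      rewrite A1 in K. apply: (Cmult_integral (v := g2 p1)) => //.
      have -> : b * g2 p1 = - (d * 0 + - b * g2 p1) by ring. rewrite K; ring. }
    apply: A2. apply: zero P2. by rewrite -{1}Ea -Eb. }
  have comb (x : C) : x <> 0 -> (a * d - b * c) * f x = (u * d - v * c) * g1 x + (a * v - b * u) * g2 x.
  { move=> Hx. have K := lin _ _ _ _ _ _ 1 (-(1)) (lin _ _ _ _ _ _ (a * d - b * c) 0 Hf Hf)
       (lin _ _ _ _ _ _ (u * d - v * c) (a * v - b * u) H1 H2).
    set U := _ + _ in K; set V := 1 * _ + _ in K.
    have EU : U = 0 by rewrite /U; ring. have EV : V = 0 by rewrite /V; ring.
    rewrite EU EV in K. have := zero _ K x Hx => E. apply: Csub_eq. rewrite -E; ring. }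
  have E1 := comb p1 P1. have E2 := comb p2 P2. rewrite A1 in E1. rewrite B2 in E2.
  move=> x Hx. have E := comb x Hx.
  have -> : f x = / (a * d - b * c) * ((a * d - b * c) * f x) by field.
  have -> : f p1 = / (a * d - b * c) * ((a * d - b * c) * f p1) by field.
  have -> : f p2 = / (a * d - b * c) * ((a * d - b * c) * f p2) by field.
  rewrite E E1 E2. by field.
Qed.

Ltac cfield := field; repeat split; try assumption; try exact m1_nz.

(** Jacobi's formula for the derivative of theta_1 as a product of three theta constants; by [h_1]
    the cube of [euler (q ^ 4)] plays the role of that derivative. *)
Lemma theta_constants q : nome q ->
  jtheta (-(1)) (q ^ 4) * jtheta (q ^ 2) (q ^ 4) * jtheta (- q ^ 2) (q ^ 4) = 2 * euler (q ^ 4) ^ 3.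
Proof.
  move=> Hq. have HQ := nome4 Hq. have HE := euler_nz HQ.
  have H1 := j_m1 HQ. have H2 := j_half (nome2 Hq). have H3 := j_half (nome_opp (nome2 Hq)).
  have H4 := euler_opp (nome2 Hq).
  have E1 : (q ^ 4) ^ 2 = q ^ 8 by ring. have E2 : (q ^ 2) ^ 2 = q ^ 4 by ring.
  have E3 : (- q ^ 2) ^ 2 = q ^ 4 by ring. have E4 : (q ^ 2) ^ 4 = q ^ 8 by ring.
  rewrite E1 in H1. rewrite E2 in H2 H4. rewrite E3 in H3. rewrite E4 in H4.
  apply: Csub_eq. apply: (Cmult_integral (v := euler (q ^ 4) ^ 3)); last exact: Cpow_nz.
  transitivity ((jtheta (-(1)) (q ^ 4) * euler (q ^ 4)) * (jtheta (q ^ 2) (q ^ 4) * euler (q ^ 4)) * (jtheta (- q ^ 2) (q ^ 4) * euler (q ^ 4)) - 2 * euler (q ^ 4) ^ 6); first ring.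
  rewrite H1 H2 H3.
  transitivity (2 * (euler (q ^ 2) * euler (- q ^ 2) * euler (q ^ 8)) ^ 2 - 2 * euler (q ^ 4) ^ 6); first ring.
  rewrite H4; ring.
Qed.

(** Comparing moduli, c p^m p^(Nk) = 1 forces m + N k = 0. *)
Lemma generic_pz (p c : C) m N : nome p -> Cmod c = 1%R -> (0 < N)%nat ->
  (m mod Z.of_nat N <> 0)%Z -> generic (p ^ N) (c * p ^^ m).
Proof.
  move=> Hp Hc HN Hm k E. have Hp0 := nome_nz Hp.
  have E1 : c * p ^^ m * (p ^ N) ^^ k = 1 by apply: eq_sym; apply: Csub_eq.
  have Ha := f_equal Cmod E1.
  rewrite pow_pz // -Cmult_assoc -pz_add // Cmod_mult Hc Rmult_1_l Cmod_1 Cmod_pz // in Ha.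
  have L : (IZR (m + Z.of_nat N * k) * ln (Cmod p) = 0)%R by rewrite -(ln_exp (_ * _)) Ha ln_1.
  have := nome_ln Hp => Hl. have K : IZR (m + Z.of_nat N * k) = 0%R by nra.
  have {}K := eq_IZR _ _ K. apply: Hm.
  rewrite (_ : m = (- k) * Z.of_nat N)%Z; last by lia. exact: Z_mod_mult.
Qed.

Lemma j_neg_base Q : nome Q -> jtheta (- Q) Q = jtheta (-(1)) Q.
Proof.
  move=> HQ. have -> : - Q = Q * -(1) by ring. rewrite j_q //; last exact: m1_nz.
  by cfield.
Qed.

Lemma j_base Q : nome Q -> jtheta Q Q = 0.
Proof.
  move=> HQ. have := j_q HQ C1_nz. rewrite Cmult_1_r j_1 // => ->. by field.
Qed.

Section LevelThree.
Variable q : C.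
Hypothesis Hq : nome q.
Let Hq0 := nome_nz Hq.
Let HQ := nome4 Hq.
Let HQ0 := nome_nz HQ.
Let Hq2 : q ^ 2 <> 0 := Cpow_nz q 2 Hq0.
Let Hq2' : - q ^ 2 <> 0 := Copp_nz Hq2.

Lemma gen_q2 : generic (q ^ 4) (q ^ 2).
Proof.
  have := @generic_pz q 1 2 4 Hq Cmod_1 ltac:(lia) ltac:(by []). by rewrite Cmult_1_l -(pz_nat q 2).
Qed.

Lemma gen_mq2 : generic (q ^ 4) (- q ^ 2).
Proof.
  have := @generic_pz q (-(1)) 2 4 Hq Cmod_m1 ltac:(lia) ltac:(by []).
  rewrite (_ : -(1) * q ^^ 2 = - q ^ 2) //. rewrite -(pz_nat q 2). change (Z.of_nat 2) with 2%Z. ring.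
Qed.

Notation j x := (jtheta x (q ^ 4)).
Let alpha := j (-(1)).
Let beta := j (q ^ 2).
Let gamma := j (- q ^ 2).

Lemma alpha_nz : alpha <> 0.
Proof. exact: j_nz HQ m1_nz (generic_m1 HQ). Qed.
Lemma beta_nz : beta <> 0.
Proof. exact: j_nz HQ Hq2 gen_q2. Qed.
Lemma gamma_nz : gamma <> 0.
Proof. exact: j_nz HQ Hq2' gen_mq2. Qed.

Lemma LSj (c : C) : c <> 0 -> exists a, LS a (fun x => j (c * x)).
Proof. move=> Hc. eexists. exact: LS_scale Hc (LS_j HQ). Qed.

Let jQ (u : C) : u <> 0 -> j (q ^ 4 * u) = - j u / u.
Proof. exact: j_q. Qed.

(** Supplies the comparison functions: four theta factors give degree four, and [kappa] is read off
    from their shifts and the power of x. *)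
Lemma theta_like_prod4 (c1 c2 c3 c4 : C) k kappa t :
  c1 <> 0 -> c2 <> 0 -> c3 <> 0 -> c4 <> 0 ->
  kappa = (q ^ 4) ^^ k / (c1 * c2 * c3 * c4) ->
  (forall x : C, x <> 0 -> (/ x) ^^ k * (j (c1 / x) * j (c2 / x) * (j (c3 / x) * j (c4 / x))) =
     x ^^ (- t) * (x ^^ k * (j (c1 * x) * j (c2 * x) * (j (c3 * x) * j (c4 * x))))) ->
  exists a, theta_like (q ^ 4) kappa t a
    (fun x => x ^^ k * (j (c1 * x) * j (c2 * x) * (j (c3 * x) * j (c4 * x)))).
Proof.
  move=> H1 H2 H3 H4 Hk Hinv.
  have [a1 L1] := LSj H1. have [a2 L2] := LSj H2. have [a3 L3] := LSj H3. have [a4 L4] := LSj H4.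
  have [b1 M1] := LS_mul L1 L2. have [b2 M2] := LS_mul L3 L4. have [b M] := LS_mul M1 M2.
  exists (fun m => 1 * b (m - k)%Z); split; [|split].
  - apply: LS_ext (LS_monomial k 1 M) => x Hx; ring.
  - move=> x Hx. rewrite pz_base_mul.
    have A c : c * (q ^ 4 * x) = q ^ 4 * (c * x) by ring.
    rewrite !A !jQ; try exact: Cmult_neq_0. rewrite Hk. have K := pz_nz (n := k) HQ0. by field.
  - exact: Hinv.
Qed.

(* Times j x, both sides satisfy theta functional equations whose solutions
   form a two-dimensional space; compare them at x = 1 and x = -q^2. *)
Lemma even_appell : exists F : C -> C,
  (forall x : C, x <> 0 -> generic (q ^ 4) x ->
     HS (fun n => q ^^ (6 * n * n) * x ^^ (3 * n) * ((1 + x * (q ^ 4) ^^ n) / (1 - x * (q ^ 4) ^^ n))) (F x)) /\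
  (forall x : C, x <> 0 -> generic (q ^ 4) x ->
     F x = - (q ^ 2 * omega3 (- q ^ 2) / euler (q ^ 4) ^ 2) * (j x * j (- x) * j (q ^ 2 * x) / x)
       + j (- x) * j (q ^ 2 * x) * j (- q ^ 2 * x) ^ 2 / (gamma * j x)).
Proof.
  have [a1 [F1 [L1 A1]]] := AT_laurent Hq (-2) 0.
  have [a2 [F2 [L2 A2]]] := AT_laurent Hq 2 1.
  (* The two summands of the numerator 1 + x q^(4n) are the Appell sums with (b, e) = (-2, 0) and
     (2, 1). *)
  pose f x := 1 * F1 x + 1 * F2 x.
  have D (x : C) : x <> 0 -> generic (q ^ 4) x ->
     HS (fun n => q ^^ (6 * n * n) * x ^^ (3 * n) * ((1 + x * (q ^ 4) ^^ n) / (1 - x * (q ^ 4) ^^ n))) (f x / j x).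
  { move=> Hx Hg. have Hj := j_nz HQ Hx Hg.
    have -> : f x / j x = F1 x / j x + F2 x / j x by rewrite /f; field.
    apply: HS_ext (HS_plus (AT_generic A1 Hx Hg) (AT_generic A2 Hx Hg)) => n.
    have -> : (6 * n * n + (-2 + 2) * n = 6 * n * n)%Z by ring.
    have -> : (6 * n * n + (2 + 2) * n = 6 * n * n + 4 * n)%Z by ring.
    rewrite Z.add_0_r pz_S // pz_add // (pow_pz 4 n Hq0). ofnat.
    have := Hg n. rewrite (pow_pz 4 n Hq0). ofnat. move=> Hgn. by field. }
  pose kappa := - / q ^ 6.
  have k0 : kappa <> 0 by apply: Copp_nz; apply: Cinv_nz; exact: Cpow_nz.
  pose W g u v := exists a, theta_like (q ^ 4) kappa 1 a g /\ a 0%Z = u /\ a 2%Z = v.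
  have Wf : W f (1 * a1 0%Z + 1 * a2 0%Z) (1 * a1 2%Z + 1 * a2 2%Z).
  { exists (fun m => 1 * a1 m + 1 * a2 m); split => //. split; first exact: LS_lin.
    split => x Hx.
    - rewrite /f (AT_shift A1 Hx) (AT_shift A2 Hx) /kappa /=. by field.
    - rewrite /f (AT_inv A1 A2 Hx) (AT_inv A2 A1 Hx) /=. ring. }
  (* Both products have the required multiplier and symmetry. G1 vanishes at 1 through j(x), and G2
     at -q^2 through j(-q^2 x), which becomes j(q^4;q^4) = 0. *)
  pose G1 (x : C) := x ^^ (-1) * (j (1 * x) * j (1 * x) * (j (-(1) * x) * j (q ^ 2 * x))).
  pose G2 (x : C) := x ^^ 0 * (j (-(1) * x) * j (q ^ 2 * x) * (j (- q ^ 2 * x) * j (- q ^ 2 * x))).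
  have inv1 (x : C) : x <> 0 -> j (1 / x) = - j (1 * x) / x.
  { move=> Hx. rewrite /Cdiv !Cmult_1_l. exact: j_inv. }
  have invm (x : C) : x <> 0 -> j (-(1) / x) = j (-(1) * x) / x.
  { move=> Hx. have -> : -(1) / x = / (-(1) * x) by cfield.
    rewrite j_inv //; last by apply: Cmult_neq_0 => //; exact: m1_nz. cfield. }
  have inv2 (x : C) : x <> 0 -> j (q ^ 2 / x) = j (q ^ 2 * x).
  { move=> Hx. have -> : q ^ 2 / x = q ^ 4 / (q ^ 2 * x) by field.
    apply: j_refl => //; exact: Cmult_neq_0. }
  have inv3 (x : C) : x <> 0 -> j (- q ^ 2 / x) = j (- q ^ 2 * x).
  { move=> Hx. have -> : - q ^ 2 / x = q ^ 4 / (- q ^ 2 * x) by field.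
    apply: j_refl => //; exact: Cmult_neq_0. }
  have WG1 : exists u v, W G1 u v.
  { have [a Ha] := @theta_like_prod4 1 1 (-(1)) (q ^ 2) (-1) kappa 1 C1_nz C1_nz m1_nz Hq2
      ltac:(rewrite /kappa /=; cfield)
      ltac:(move=> x Hx; rewrite inv1 // invm // inv2 // /=; cfield).
    by exists (a 0%Z), (a 2%Z), a. }
  have WG2 : exists u v, W G2 u v.
  { have [a Ha] := @theta_like_prod4 (-(1)) (q ^ 2) (- q ^ 2) (- q ^ 2) 0 kappa 1 m1_nz Hq2 Hq2' Hq2'
      ltac:(rewrite /kappa /=; cfield)
      ltac:(move=> x Hx; rewrite invm // inv2 // inv3 // /=; cfield).
    by exists (a 0%Z), (a 2%Z), a. }
  have [u1 [v1 WG1']] := WG1. have [u2 [v2 WG2']] := WG2.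
  have val1 : f 1 = 2 * euler (q ^ 4) ^ 3 by rewrite /f (AT_1 A1) (AT_1 A2); ring.
  (* Write (1 + X)/(1 - X) = 2/(1 - X) - 1. The first part is the Appell sum of omega_3(-q^2), and
     the second is the bilateral series j(q^12;q^12) = 0. *)
  have val2 : f (- q ^ 2) = 2 * euler (q ^ 4) * omega3 (- q ^ 2) * gamma.
  { have E2 : (- q ^ 2) ^ 2 = q ^ 4 by ring.
    have O := @omega3_appell (- q ^ 2) (nome_opp (nome2 Hq)). rewrite E2 in O.
    have Hq12 : nome (q ^ 12) by apply: nome_pow => //; lia.
    have T := HS_j Hq12 (nome_nz Hq12). rewrite (j_base Hq12) in T.
    have K := HS_minus (HS_scal 2 (O gen_mq2)) T.
    suff E : f (- q ^ 2) / gamma = 2 * (euler (q ^ 4) * omega3 (- q ^ 2)) - 0.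
    { rewrite -[LHS](_ : f (- q ^ 2) / gamma * gamma = _); [rewrite E; ring | field; exact: gamma_nz]. }
    apply: (HS_unique (D _ Hq2' gen_mq2)). apply: HS_ext K => n. rewrite /th.
    have Hgn := @gen_mq2 n. rewrite (pow_pz 4 n Hq0) in Hgn *. ofnat.
    rewrite !(pow_pz 4 _ Hq0) !(pow_pz 12 _ Hq0).
    change (Z.of_nat 4) with 4%Z in *; change (Z.of_nat 12) with 12%Z.
    rewrite (sgn_base (q ^ 2)) (pow_pz 2 _ Hq0). ofnat.
    have -> : (-(1)) ^^ (3 * n) = (-(1)) ^^ n.
    { rewrite (_ : 3 * n = n + 2 * n)%Z; last by ring. rewrite pz_add; last exact: m1_nz. rewrite sgn_even; ring. }
    have T2 := tri_double n.
    have -> : (4 * (n * (n - 1) / 2) = 2 * n * n - 2 * n)%Z by lia.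
    have -> : (12 * (n * (n - 1) / 2) = 6 * n * n + 2 * (3 * n) - 12 * n)%Z by lia.
    have -> : (4 * (n * (n + 1)) = 4 * n * n + 4 * n)%Z by ring.
    have -> : (6 * n * n = (2 * n * n - 2 * n) + (4 * n * n + 4 * n) + 4 * n - 2 * (3 * n))%Z by ring.
    rewrite !(pz_add, pz_sub) //.
    have K1 := pz_nz (n := (12 * n)%Z) Hq0. have K2 := pz_nz (n := (2 * (3 * n))%Z) Hq0.
    have K3 := pz_nz (n := (2 * n)%Z) Hq0. by field. }
  have lin : forall f g u v u' v' (c d : C), W f u v -> W g u' v' ->
     W (fun x => c * f x + d * g x) (c * u + d * u') (c * v + d * v').
  { move=> f0 g0 u v u' v' c d [a [Ha [<- <-]]] [b [Hb [<- <-]]].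
    exists (fun m => c * a m + d * b m); split => //. exact: theta_like_lin. }
  have zero : forall f, W f 0 0 -> forall x : C, x <> 0 -> f x = 0.
  { move=> f0 [a [Ha [E0 E2]]]. have [_ R] := theta_like_rec HQ0 Ha.
    (* The symmetry identifies the coefficients 0 and 1, and -1 and 2, so a(0) = a(2) = 0 clears the
       whole window from -1 to 2. *)
    have R0 := R 0%Z. have R1 := R 1%Z. rewrite /= in R0 R1.
    apply: (theta_like_zero HQ0 k0 Ha (r := (-1)%Z)) => /=; [by rewrite R1 | by [] | by rewrite -R0 | by []]. }
  have an := alpha_nz. have bn := beta_nz. have gn := gamma_nz.
  have TC : alpha * beta * gamma = 2 * euler (q ^ 4) ^ 3 := theta_constants Hq.
  have En := euler_nz HQ.
  have eG1 : G1 (- q ^ 2) = - / q ^ 2 * (gamma * gamma * (beta * alpha)).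
  { rewrite /G1 !Cmult_1_l (_ : -(1) * - q ^ 2 = q ^ 2); last by ring.
    rewrite (_ : q ^ 2 * - q ^ 2 = - q ^ 4); last by ring. rewrite (j_neg_base HQ) (_ : -1 = - (1))%Z // pz_opp pz_1 /alpha /beta /gamma.
    cfield. }
  have eG2 : G2 1 = alpha * beta * (gamma * gamma).
  { rewrite /G2 !Cmult_1_r pz_0 Cmult_1_l /alpha /beta /gamma. ring. }
  have main := two_dim lin zero Wf WG1' WG2' C1_nz Hq2'.
  exists (fun x => f x / j x); split; first exact: D.
  move=> x Hx Hg. have Hj := j_nz HQ Hx Hg.
  rewrite main //.
  - rewrite val1 val2 eG1 eG2 /G1 /G2 !Cmult_1_l.
    have -> : - (1) * x = - x by ring.
    rewrite (_ : -1 = - (1))%Z // pz_opp pz_1.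
    have -> : 2 * euler (q ^ 4) * omega3 (- q ^ 2) * gamma / (- / q ^ 2 * (gamma * gamma * (beta * alpha)))
       = - (q ^ 2 * omega3 (- q ^ 2) / euler (q ^ 4) ^ 2).
    { have -> : - / q ^ 2 * (gamma * gamma * (beta * alpha)) = - / q ^ 2 * gamma * (2 * euler (q ^ 4) ^ 3) by rewrite -TC; ring.
      cfield. }
    have -> : 2 * euler (q ^ 4) ^ 3 / (alpha * beta * (gamma * gamma)) = / gamma.
    { have -> : alpha * beta * (gamma * gamma) = (2 * euler (q ^ 4) ^ 3) * gamma by rewrite -TC; ring.
      cfield. }
    cfield.
  - rewrite /G1 !Cmult_1_l j_1 //; ring.
  - rewrite eG1. repeat apply: Cmult_neq_0 => //. apply: Copp_nz; exact: Cinv_nz.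
  - rewrite /G2 (_ : - q ^ 2 * - q ^ 2 = q ^ 4); last by ring. rewrite j_base //; ring.
  - rewrite eG2. by repeat apply: Cmult_neq_0.
Qed.

(** Again an interpolation in a two-dimensional space, now at x = 1 and x = -1; at -1 the
    denominators become 1 + q^(4n), and [f3_appell] in base q^4 supplies the value. *)
Lemma odd_appell : exists F : C -> C,
  (forall x : C, x <> 0 -> generic (q ^ 4) x ->
     HS (fun n => q ^^ (6 * n * n + 2 * n) * x ^^ (3 * n + 2) / (1 - x * (q ^ 4) ^^ n)) (F x)) /\
  (forall x : C, x <> 0 -> generic (q ^ 4) x ->
     F x = - (f3 (q ^ 4) / (4 * euler (q ^ 4) ^ 2)) * (x * j x * j (q ^ 2 * x) * j (- q ^ 2 * x))
       + x * j (- x) ^ 2 * j (q ^ 2 * x) * j (- q ^ 2 * x) / (2 * alpha * j x)).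
Proof.
  have [a1 [f [L1 A1]]] := AT_laurent Hq 0 2.
  have D (x : C) : x <> 0 -> generic (q ^ 4) x ->
     HS (fun n => q ^^ (6 * n * n + 2 * n) * x ^^ (3 * n + 2) / (1 - x * (q ^ 4) ^^ n)) (f x / j x)
    := fun Hx Hg => AT_generic A1 Hx Hg.
  pose W g u v := exists a, theta_like (q ^ 4) (-(1)) 4 a g /\ a 1%Z = u /\ a 2%Z = v.
  have Wf : W f (a1 1%Z) (a1 2%Z).
  { exists a1; split => //. split => //. split => x Hx.
    - rewrite (AT_shift A1 Hx) /=. by field.
    - rewrite (AT_inv A1 A1 Hx) //. }
  pose G1 (x : C) := x ^^ 1 * (j (1 * x) * j (1 * x) * (j (q ^ 2 * x) * j (- q ^ 2 * x))).
  pose G2 (x : C) := x ^^ 1 * (j (-(1) * x) * j (-(1) * x) * (j (q ^ 2 * x) * j (- q ^ 2 * x))).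
  have inv1 (x : C) : x <> 0 -> j (1 / x) = - j (1 * x) / x.
  { move=> Hx. rewrite /Cdiv !Cmult_1_l. exact: j_inv. }
  have invm (x : C) : x <> 0 -> j (-(1) / x) = j (-(1) * x) / x.
  { move=> Hx. have -> : -(1) / x = / (-(1) * x) by cfield.
    rewrite j_inv //; last by apply: Cmult_neq_0 => //; exact: m1_nz. cfield. }
  have inv2 (x : C) : x <> 0 -> j (q ^ 2 / x) = j (q ^ 2 * x).
  { move=> Hx. have -> : q ^ 2 / x = q ^ 4 / (q ^ 2 * x) by field.
    apply: j_refl => //; exact: Cmult_neq_0. }
  have inv3 (x : C) : x <> 0 -> j (- q ^ 2 / x) = j (- q ^ 2 * x).
  { move=> Hx. have -> : - q ^ 2 / x = q ^ 4 / (- q ^ 2 * x) by field.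
    apply: j_refl => //; exact: Cmult_neq_0. }
  have WG1 : exists u v, W G1 u v.
  { have [a Ha] := @theta_like_prod4 1 1 (q ^ 2) (- q ^ 2) 1 (-(1)) 4 C1_nz C1_nz Hq2 Hq2'
      ltac:(simpl; cfield)
      ltac:(move=> x Hx; rewrite inv1 // inv2 // inv3 // /=; cfield).
    by exists (a 1%Z), (a 2%Z), a. }
  have WG2 : exists u v, W G2 u v.
  { have [a Ha] := @theta_like_prod4 (-(1)) (-(1)) (q ^ 2) (- q ^ 2) 1 (-(1)) 4 m1_nz m1_nz Hq2 Hq2'
      ltac:(simpl; cfield)
      ltac:(move=> x Hx; rewrite invm // inv2 // inv3 // /=; cfield).
    by exists (a 1%Z), (a 2%Z), a. }
  have [u1 [v1 WG1']] := WG1. have [u2 [v2 WG2']] := WG2.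
  have an := alpha_nz. have bn := beta_nz. have gn := gamma_nz.
  have val1 : f 1 = euler (q ^ 4) ^ 3 := AT_1 A1.
  have val2 : f (-(1)) = euler (q ^ 4) * (f3 (q ^ 4) / 2) * alpha.
  { suff E : f (-(1)) / alpha = euler (q ^ 4) * (f3 (q ^ 4) / 2).
    { rewrite -[LHS](_ : f (-(1)) / alpha * alpha = _); [rewrite E; ring | by field]. }
    apply: (HS_unique (D _ m1_nz (generic_m1 HQ))). apply: HS_ext (f3_appell HQ) => n. rewrite /th.
    rewrite !(pow_pz 4 _ Hq0). change (Z.of_nat 4) with 4%Z.
    have -> : (-(1)) ^^ (3 * n + 2) = (-(1)) ^^ n.
    { rewrite (_ : 3 * n + 2 = n + 2 * (n + 1))%Z; last by ring. rewrite pz_add; last exact: m1_nz. rewrite sgn_even; ring. }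
    have T2 := tri_double n.
    have -> : (6 * n * n + 2 * n = 4 * (n * (n - 1) / 2) + 4 * n + 4 * (n * n))%Z by lia.
    rewrite !pz_add //. have -> : 1 - - (1) * q ^^ (4 * n) = 1 + q ^^ (4 * n) by ring. by rewrite /Cdiv; ring. }
  have lin : forall f g u v u' v' (c d : C), W f u v -> W g u' v' ->
     W (fun x => c * f x + d * g x) (c * u + d * u') (c * v + d * v').
  { move=> f0 g0 u v u' v' c d [a [Ha [<- <-]]] [b [Hb [<- <-]]].
    exists (fun m => c * a m + d * b m); split => //. exact: theta_like_lin. }
  have zero : forall f, W f 0 0 -> forall x : C, x <> 0 -> f x = 0.
  { move=> f0 [a [Ha [E1 E2]]]. have [R' R] := theta_like_rec HQ0 Ha.
    have R0 := R 0%Z. have R1 := R (-1)%Z. have S0 := R' 0%Z. rewrite /= in R0 R1 S0.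
    apply: (theta_like_zero HQ0 m1_nz Ha (r := 0%Z)) => /=; [| by [] | by [] | by rewrite -R1].
    (* The symmetry gives a(0) = a(4), the quasi-periodicity a(0) = -a(4); hence a(0) = 0, while
       a(3) = a(1). *)
    rewrite -R0 Cmult_1_r in S0.
    have E : 2 * a 0%Z = 0.
    { transitivity (a 0%Z + a 0%Z); first ring. rewrite {1}S0; ring. }
    apply: (Cmult_integral (v := 2)); [by rewrite Cmult_comm | by move=> /RtoC_inj; lra]. }
  have TC : alpha * beta * gamma = 2 * euler (q ^ 4) ^ 3 := theta_constants Hq.
  have En := euler_nz HQ.
  have eG1 : G1 (-(1)) = - (alpha * (alpha * beta * gamma)).
  { rewrite /G1 !Cmult_1_l pz_1 (_ : q ^ 2 * -(1) = - q ^ 2); last by ring.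
    rewrite (_ : - q ^ 2 * -(1) = q ^ 2); last by ring. rewrite /alpha /beta /gamma. ring. }
  have eG2 : G2 1 = alpha * (alpha * beta * gamma).
  { rewrite /G2 !Cmult_1_r pz_1 /alpha /beta /gamma. ring. }
  rewrite TC in eG1 eG2.
  have main := two_dim lin zero Wf WG1' WG2' C1_nz m1_nz.
  exists (fun x => f x / j x); split; first exact: D.
  have two_nz : 2 <> 0 :> C by move=> /RtoC_inj; lra.
  move=> x Hx Hg. have Hj := j_nz HQ Hx Hg.
  rewrite main //.
  - rewrite val1 val2 eG1 eG2 /G1 /G2 !Cmult_1_l pz_1.
    have -> : - (1) * x = - x by ring.
    rewrite -/alpha. cfield.
  - rewrite /G1 !Cmult_1_l j_1 //; ring.
  - rewrite eG1. apply: Copp_nz. exact: (Cmult_neq_0 _ _ an (Cmult_neq_0 _ _ two_nz (Cpow_nz _ 3 En))).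
  - rewrite /G2 (_ : -(1) * -(1) = 1); last by ring. rewrite j_1 //; ring.
  - rewrite eG2. exact: (Cmult_neq_0 _ _ an (Cmult_neq_0 _ _ two_nz (Cpow_nz _ 3 En))).
Qed.

End LevelThree.

Lemma summable_finite (f : Z -> C) (A : Z) : (forall i, (A < Z.abs i)%Z -> f i = 0) -> summable f.
Proof.
  move=> H.
  have [l [Hn Hi]] := nodup_super (map (fun k => (Z.of_nat k - A)%Z) (seq 0 (Z.to_nat (2 * A + 1)))).
  apply: (proj1 (HS_finite Hn _)) => i Hni. apply: H.
  case: (Z_lt_dec A (Z.abs i)) => // Hc. case: Hni. apply: Hi. apply/in_map_iff.
  exists (Z.to_nat (i + A)); split; [lia | apply/in_seq; lia].
Qed.

(* twice the signed indicator of the double cone i, N >= 0 or i, N < 0, the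
   boundary N = 0 being counted with weight 1/2 in both halves *)
Definition cone (i N : Z) : C :=
  if Z_le_dec 0 i then (if Z_lt_dec 0 N then 2 else if Z.eq_dec N 0 then 1 else 0)
  else (if Z_lt_dec N 0 then -(2) else if Z.eq_dec N 0 then -(1) else 0).

(** On the line N = u - 4i the cone keeps a finite, signed range of i with weight 2. The boundary N
    = 0 is met only if 4 divides u, at i = u/4, where one copy of X^(u/4) has to be taken back. *)
Lemma geometric_fibre (X : C) (u : Z) : X <> 0 -> 1 - X <> 0 ->
  HS (fun i => cone i (u - 4 * i) * X ^^ i)
     (2 * (1 - X ^^ (u / 4 + 1)) / (1 - X) - (if Z.eq_dec (u mod 4) 0 then X ^^ (u / 4) else 0)).
Proof.
  move=> HX H1. set v := (u / 4)%Z.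
  have D := Z.div_mod u 4 ltac:(lia). have B := Z.mod_pos_bound u 4 ltac:(lia). rewrite -/v in D.
  (* A difference of two half-lines: the indicator of 0..v for v >= 0, minus that of v+1..-1
     otherwise. The telescoping then treats both signs at once. *)
  pose s i : C := (if Z_le_dec 0 i then 1 else 0) - (if Z_le_dec (v + 1) i then 1 else 0).
  have [t Ht] : exists t, HS (fun i => s i * X ^^ i) t.
  { apply: summable_HS. apply: (summable_finite (A := Z.abs v + 1)) => i Hi. rewrite /s.
    case: Z_le_dec => Ha; case: Z_le_dec => Hb; try lia; ring. }
  have sgl c : HS (fun i => if Z.eq_dec i c then X ^^ i else 0) (X ^^ c).
  { move: (@HS_single Z (fun i => if Z.eq_dec i c then X ^^ i else 0) c).
    case: (Z.eq_dec c c) => // _. apply => i Hi. by case: Z.eq_dec. }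
  have Et : t = (1 - X ^^ (v + 1)) / (1 - X).
  { suff E : (1 - X) * t = X ^^ 0 - X ^^ (v + 1).
    { rewrite pz_0 in E. rewrite -E. by field. }
    have -> : (1 - X) * t = t - X * t by ring.
    apply: (HS_unique (HS_minus Ht (HS_scal X (HS_shift (-1) Ht)))).
    apply: HS_ext (HS_minus (sgl 0%Z) (sgl (v + 1)%Z)) => i.
    have -> : X * (s (i + -1)%Z * X ^^ (i + -1)) = s (i + -1)%Z * X ^^ i.
    { rewrite -/(Z.sub i 1) pz_sub // pz_1. by field. }
    rewrite /s. case: Z.eq_dec => Ha; case: Z.eq_dec => Hb;
      repeat (case: Z_le_dec => ?); try lia; ring. }
  have K : HS (fun i => if Z.eq_dec (u mod 4) 0 then (if Z.eq_dec i v then X ^^ i else 0) else 0)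
     (if Z.eq_dec (u mod 4) 0 then X ^^ v else 0).
  { case: Z.eq_dec => _; [exact: sgl | exact: HS_zero]. }
  have -> : 2 * (1 - X ^^ (v + 1)) / (1 - X) = 2 * t by rewrite Et; field.
  apply: HS_ext (HS_minus (HS_scal 2 Ht) K) => i. rewrite /s /cone.
  case: (Z.eq_dec (u mod 4) 0) => Hm; repeat (case: Z_le_dec => ?); repeat (case: Z_lt_dec => ?);
    repeat (case: Z.eq_dec => ?); try lia; ring.
Qed.

(** * The Hecke-type double sum *)

Section Hecke.
Variable P : C.
Hypothesis HP : nome P.
Variable y : C.
Hypothesis Hy : y <> 0.
Let HP0 := nome_nz HP.

Definition hecke_term (p : Z * Z) : C :=
  cone (fst p) (snd p) * (-(1)) ^^ snd p * P ^^ (48 * fst p * fst p + 16 * fst p * snd p + snd p * snd p)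
    * y ^^ (6 * fst p + snd p).

(** Along N = u - 4i the exponent is u^2 + 8 u i, so the inner sum is geometric with ratio X =
    P^(8u) y^2. The constant in its numerator gives the Lambert sum [F1]; the power X^(u/4 + 1) and
    the boundary term, sorted by the parity of u, give Appell sums at y and -y and at q^2 y and -q^2
    y, where q = P^2. *)
Lemma hecke_split (L F1 Dp Dm Tp Tm : C) :
  generic ((P ^ 2) ^ 4) y -> generic ((P ^ 2) ^ 4) (- y) ->
  generic ((P ^ 2) ^ 4) ((P ^ 2) ^ 2 * y) -> generic ((P ^ 2) ^ 4) (- ((P ^ 2) ^ 2 * y)) ->
  HS hecke_term L ->
  HS (fun u => (-(1)) ^^ u * P ^^ (u * u) * y ^^ u / (1 - P ^^ (8 * u) * y ^ 2)) F1 ->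
  let D x n := (P ^ 2) ^^ (6 * n * n) * x ^^ (3 * n) * ((1 + x * ((P ^ 2) ^ 4) ^^ n) / (1 - x * ((P ^ 2) ^ 4) ^^ n)) in
  let T x n := (P ^ 2) ^^ (6 * n * n + 2 * n) * x ^^ (3 * n + 2) / (1 - x * ((P ^ 2) ^ 4) ^^ n) in
  HS (D y) Dp -> HS (D (- y)) Dm ->
  HS (T ((P ^ 2) ^ 2 * y)) Tp -> HS (T (- ((P ^ 2) ^ 2 * y))) Tm ->
  L = 2 * F1 - / 2 * (Dp + Dm) + / P ^ 3 * (Tp - Tm).
Proof.
  move=> g1 g2 g3 g4 HL HF D T HDp HDm HTp HTm.
  have HP2 : P ^ 2 <> 0 by exact: Cpow_nz.
  have Q8 n : ((P ^ 2) ^ 4) ^^ n = P ^^ (8 * n).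
  { rewrite pow_pz // pow_pz // Z.mul_assoc. ofnat. done. }
  pose X u := P ^^ (8 * u) * y ^ 2.
  pose t u := (-(1)) ^^ u * P ^^ (u * u) * y ^^ u.
  have X0 u : X u <> 0 by apply: Cmult_neq_0; [exact: pz_nz | exact: Cpow_nz].
  (* X is the square of W = y P^(8n) for u = 2n and of W = P^4 y P^(8n) for u = 2n + 1; so 1 - X
     factors into the denominators 1 - W and 1 + W of the Appell sums. *)
  have [Xe Xo] : (forall n, X (2 * n)%Z = (y * P ^^ (8 * n)) ^ 2) /\ (forall n, X (2 * n + 1)%Z = (P ^ 4 * y * P ^^ (8 * n)) ^ 2).
  { split=> n; rewrite /X.
    - rewrite (_ : 8 * (2 * n) = 8 * n + 8 * n)%Z; last by ring. rewrite pz_add //; ring.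
    - rewrite (_ : 8 * (2 * n + 1) = 8 * n + 8 * n + Z.of_nat 8)%Z; last by lia. rewrite !pz_add // pz_nat; ring. }
  have ne n : 1 - y * P ^^ (8 * n) <> 0 by rewrite -Q8; exact: g1.
  have ne' n : 1 + y * P ^^ (8 * n) <> 0.
  { have := @g2 n. rewrite Q8. have -> : 1 - - y * P ^^ (8 * n) = 1 + y * P ^^ (8 * n) by ring. done. }
  have no n : 1 - P ^ 4 * y * P ^^ (8 * n) <> 0.
  { have := @g3 n. rewrite Q8. have -> : (P ^ 2) ^ 2 = P ^ 4 by ring. done. }
  have no' n : 1 + P ^ 4 * y * P ^^ (8 * n) <> 0.
  { have := @g4 n. rewrite Q8. have -> : 1 - - ((P ^ 2) ^ 2 * y) * P ^^ (8 * n) = 1 + P ^ 4 * y * P ^^ (8 * n) by ring. done. }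
  have X1 u : 1 - X u <> 0.
  { have [n [->|->]] : exists n, (u = 2 * n \/ u = 2 * n + 1)%Z.
    { exists (u / 2)%Z. have := Z.div_mod u 2 ltac:(lia). have := Z.mod_pos_bound u 2 ltac:(lia). lia. }
    - rewrite Xe. have -> : 1 - (y * P ^^ (8 * n)) ^ 2 = (1 - y * P ^^ (8 * n)) * (1 + y * P ^^ (8 * n)) by ring.
      exact: Cmult_neq_0.
    - rewrite Xo. have -> : 1 - (P ^ 4 * y * P ^^ (8 * n)) ^ 2 = (1 - P ^ 4 * y * P ^^ (8 * n)) * (1 + P ^ 4 * y * P ^^ (8 * n)) by ring.
      exact: Cmult_neq_0. }
  pose th u := if Z.eq_dec (u mod 4) 0 then X u ^^ (u / 4) else 0.
  have HL1 : HS (fun u => t u * (2 * (1 - X u ^^ (u / 4 + 1)) / (1 - X u) - th u)) L.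
  { pose phi (p : Z * Z) := (snd p, (fst p - 4 * snd p)%Z).
    pose psi (p : Z * Z) := ((snd p + 4 * fst p)%Z, fst p).
    have H1 p : psi (phi p) = p by case: p => i k; rewrite /phi /psi /=; f_equal; lia.
    have H2 p : phi (psi p) = p by case: p => i k; rewrite /phi /psi /=; f_equal; lia.
    apply: (HS_fubini (HS_bij H1 H2 HL)) => u.
    apply: HS_ext (HS_scal (t u) (geometric_fibre u (X0 u) (X1 u))) => i.
    rewrite /hecke_term /phi /t /X /=.
    rewrite (_ : u - 4 * i = u + 2 * (- (2 * i)))%Z; last by ring.
    rewrite (pz_add u _ m1_nz) sgn_even.
    rewrite (_ : 48 * i * i + 16 * i * (u + 2 * - (2 * i)) + (u + 2 * - (2 * i)) * (u + 2 * - (2 * i)) = u * u + 8 * u * i)%Z; last by ring.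
    rewrite (_ : 6 * i + (u + 2 * - (2 * i)) = u + 2 * i)%Z; last by ring.
    rewrite pz_base_mul (pow_pz 2 i Hy) !pz_add // -(pz_mul (8 * u) i HP0). ofnat. ring. }
  (* For u = 2n the combination of [D y] and [D (- y)] is (1 + W)/(1 - W) plus (n even) or minus (n
     odd) its reciprocal, that is 2(1 + X)/(1 - X) or 4W/(1 - X). This matches whether or not the
     boundary term [th u] is present. *)
  have HB : HS (fun u => t u * (2 * X u ^^ (u / 4 + 1) / (1 - X u) + th u))
     (/ 2 * (Dp + Dm) + - / P ^ 3 * (Tp - Tm)).
  { have P4 : P ^ 4 = P ^^ 4 by rewrite -(pz_nat P 4).
    apply: HS_even_odd.
    - apply: HS_ext (HS_scal (/ 2) (HS_plus HDp HDm)) => n.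
      rewrite /D; cbv beta; rewrite !Q8 /t /th Xe sgn_even (sgn_base y).
      have Wp := ne n. have Wm := ne' n.
      have W2 : 1 - (y * P ^^ (8 * n)) ^ 2 <> 0 by rewrite -Xe; exact: X1.
      set W := y * P ^^ (8 * n) in Wp Wm W2 *.
      have W0 : W <> 0 by apply: Cmult_neq_0 => //; exact: pz_nz.
      have Wpow k : (W ^ 2) ^^ k = y ^^ (2 * k) * P ^^ (8 * n * (2 * k)).
      { rewrite pow_pz // /W pz_base_mul -pz_mul //. }
      have Wmy : - y * P ^^ (8 * n) = - W by rewrite /W; ring.
      rewrite Wmy (pow_pz 2 _ HP0). ofnat.
      have [k [Ek|Ek]] : exists k, (n = 2 * k \/ n = 2 * k + 1)%Z.
      { exists (n / 2)%Z. have := Z.div_mod n 2 ltac:(lia). have := Z.mod_pos_bound n 2 ltac:(lia). lia. }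
      + have -> : (2 * n / 4 = k)%Z by rewrite Ek; symmetry; apply: (Z.div_unique _ _ _ 0); lia.
        have -> : (2 * n mod 4 = 0)%Z by rewrite Ek (_ : 2 * (2 * k) = k * 4)%Z; [exact: Z_mod_mult | ring].
        case: Z.eq_dec => // _. rewrite pz_S; last exact: Cpow_nz.
        have -> : (-(1)) ^^ (3 * n) = 1 by rewrite Ek (_ : 3 * (2 * k) = 2 * (3 * k))%Z; [exact: sgn_even | ring].
        have C : P ^^ (2 * (6 * n * n)) * y ^^ (3 * n) = P ^^ (2 * n * (2 * n)) * y ^^ (2 * n) * (W ^ 2) ^^ k.
        { rewrite Wpow. transitivity ((P ^^ (2 * n * (2 * n)) * P ^^ (8 * n * (2 * k))) * (y ^^ (2 * n) * y ^^ (2 * k))); last ring.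
          rewrite -!pz_add //. congr (_ ^^ _ * _ ^^ _); rewrite Ek; ring. }
        rewrite !Cmult_1_l C. field. repeat split => //. by have -> : 1 - - W = 1 + W by ring.
      + have -> : (2 * n / 4 = k)%Z by rewrite Ek; symmetry; apply: (Z.div_unique _ _ _ 2); lia.
        have -> : (2 * n mod 4 = 2)%Z by rewrite Ek; symmetry; apply: (Z.mod_unique _ _ k 2); lia.
        case: Z.eq_dec => // _.
        have -> : (-(1)) ^^ (3 * n) = -(1) by rewrite Ek (_ : 3 * (2 * k + 1) = 2 * (3 * k + 1) + 1)%Z; [exact: sgn_odd | ring].
        have C : P ^^ (2 * n * (2 * n)) * y ^^ (2 * n) * (W ^ 2) ^^ (k + 1) = P ^^ (2 * (6 * n * n)) * y ^^ (3 * n) * W.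
        { rewrite Wpow /W. transitivity ((P ^^ (2 * n * (2 * n)) * P ^^ (8 * n * (2 * (k + 1)))) * (y ^^ (2 * n) * y ^^ (2 * (k + 1)))); first ring.
          transitivity ((P ^^ (2 * (6 * n * n)) * P ^^ (8 * n)) * (y ^^ (3 * n) * y ^^ 1)); last by rewrite pz_1; ring.
          rewrite -!pz_add //. congr (_ ^^ _ * _ ^^ _); rewrite Ek; ring. }
        rewrite Cmult_1_l.
        transitivity ((P ^^ (2 * n * (2 * n)) * y ^^ (2 * n) * (W ^ 2) ^^ (k + 1)) * (2 / (1 - W ^ 2))); last by field.
        rewrite C. field. repeat split => //. by have -> : 1 - - W = 1 + W by ring.
    (* For odd u, 1/(1 - W) minus (n even) or plus (n odd) 1/(1 + W) is 2W/(1 - X) or 2/(1 - X); the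
       exponents of P then differ by 3. *)
    - apply: HS_ext (HS_scal (- / P ^ 3) (HS_minus HTp HTm)) => n.
      rewrite /T; cbv beta; rewrite !Q8 /t /th Xo sgn_odd.
      have Wp := no n. have Wm := no' n.
      have W2 : 1 - (P ^ 4 * y * P ^^ (8 * n)) ^ 2 <> 0 by rewrite -Xo; exact: X1.
      have Y4 : (P ^ 2) ^ 2 * y = P ^ 4 * y by ring.
      rewrite Y4 (sgn_base (P ^ 4 * y)).
      set W := P ^ 4 * y * P ^^ (8 * n) in Wp Wm W2 *.
      have W0 : W <> 0 by apply: Cmult_neq_0; [apply: Cmult_neq_0 => //; exact: Cpow_nz | exact: pz_nz].
      have Wpow k : (W ^ 2) ^^ k = P ^^ (4 * (2 * k)) * y ^^ (2 * k) * P ^^ (8 * n * (2 * k)).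
      { rewrite pow_pz // /W (pz_base_mul (P ^ 4 * y)) (pz_base_mul (P ^ 4)) (pow_pz 4 _ HP0) -pz_mul //. }
      have Ypow k : (P ^ 4 * y) ^^ k = P ^^ (4 * k) * y ^^ k.
      { rewrite (pz_base_mul (P ^ 4)) (pow_pz 4 _ HP0) //. }
      have Wmy : - (P ^ 4 * y) * P ^^ (8 * n) = - W by rewrite /W; ring.
      rewrite Wmy (pow_pz 2 _ HP0) Ypow. ofnat.
      have P3 : P ^ 3 <> 0 by exact: Cpow_nz.
      have iP3 : / P ^ 3 = P ^^ (-3) by rewrite -(pz_negnat P 3).
      have [k [Ek|Ek]] : exists k, (n = 2 * k \/ n = 2 * k + 1)%Z.
      { exists (n / 2)%Z. have := Z.div_mod n 2 ltac:(lia). have := Z.mod_pos_bound n 2 ltac:(lia). lia. }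
      + have -> : ((2 * n + 1) / 4 = k)%Z by rewrite Ek; symmetry; apply: (Z.div_unique _ _ _ 1); lia.
        have -> : ((2 * n + 1) mod 4 = 1)%Z by rewrite Ek; symmetry; apply: (Z.mod_unique _ _ k 1); lia.
        case: Z.eq_dec => // _.
        have -> : (-(1)) ^^ (3 * n + 2) = 1 by rewrite Ek (_ : 3 * (2 * k) + 2 = 2 * (3 * k + 1))%Z; [exact: sgn_even | ring].
        have C : P ^^ ((2 * n + 1) * (2 * n + 1)) * y ^^ (2 * n + 1) * (W ^ 2) ^^ (k + 1) =
            / P ^ 3 * (P ^^ (2 * (6 * n * n + 2 * n)) * (P ^^ (4 * (3 * n + 2)) * y ^^ (3 * n + 2))) * W.
        { rewrite Wpow /W iP3 P4.
          transitivity ((P ^^ ((2 * n + 1) * (2 * n + 1)) * P ^^ (4 * (2 * (k + 1))) * P ^^ (8 * n * (2 * (k + 1)))) * (y ^^ (2 * n + 1) * y ^^ (2 * (k + 1)))); first ring.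
          transitivity ((P ^^ (-3) * P ^^ (2 * (6 * n * n + 2 * n)) * P ^^ (4 * (3 * n + 2)) * P ^^ 4 * P ^^ (8 * n)) * (y ^^ (3 * n + 2) * y ^^ 1)); last by rewrite pz_1; ring.
          rewrite -!pz_add //. congr (_ ^^ _ * _ ^^ _); rewrite Ek; ring. }
        transitivity (- (P ^^ ((2 * n + 1) * (2 * n + 1)) * y ^^ (2 * n + 1) * (W ^ 2) ^^ (k + 1)) * (2 / (1 - W ^ 2))); last by field.
        rewrite C. field. repeat split => //. by have -> : 1 - - W = 1 + W by ring.
      + have -> : ((2 * n + 1) / 4 = k)%Z by rewrite Ek; symmetry; apply: (Z.div_unique _ _ _ 3); lia.
        have -> : ((2 * n + 1) mod 4 = 3)%Z by rewrite Ek; symmetry; apply: (Z.mod_unique _ _ k 3); lia.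
        case: Z.eq_dec => // _.
        have -> : (-(1)) ^^ (3 * n + 2) = -(1) by rewrite Ek (_ : 3 * (2 * k + 1) + 2 = 2 * (3 * k + 2) + 1)%Z; [exact: sgn_odd | ring].
        have C : P ^^ ((2 * n + 1) * (2 * n + 1)) * y ^^ (2 * n + 1) * (W ^ 2) ^^ (k + 1) =
            / P ^ 3 * (P ^^ (2 * (6 * n * n + 2 * n)) * (P ^^ (4 * (3 * n + 2)) * y ^^ (3 * n + 2))).
        { rewrite Wpow iP3.
          transitivity ((P ^^ ((2 * n + 1) * (2 * n + 1)) * P ^^ (4 * (2 * (k + 1))) * P ^^ (8 * n * (2 * (k + 1)))) * (y ^^ (2 * n + 1) * y ^^ (2 * (k + 1)))); first ring.
          transitivity ((P ^^ (-3) * P ^^ (2 * (6 * n * n + 2 * n)) * P ^^ (4 * (3 * n + 2))) * y ^^ (3 * n + 2)); last ring.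
          rewrite -!pz_add //. congr (_ ^^ _ * _ ^^ _); rewrite Ek; ring. }
        transitivity (- (P ^^ ((2 * n + 1) * (2 * n + 1)) * y ^^ (2 * n + 1) * (W ^ 2) ^^ (k + 1)) * (2 / (1 - W ^ 2))); last by field.
        rewrite C. field. repeat split => //. by have -> : 1 - - W = 1 + W by ring. }
  have K := HS_minus (HS_scal 2 HF) HB.
  have -> : 2 * F1 - / 2 * (Dp + Dm) + / P ^ 3 * (Tp - Tm) = 2 * F1 - (/ 2 * (Dp + Dm) + - / P ^ 3 * (Tp - Tm)) by ring.
  apply: (HS_unique HL1). apply: HS_ext K => u. rewrite -/(X u) -/(t u). field. exact: X1.
Qed.

End Hecke.

Lemma Ci_sqr : Ci * Ci = -(1).
Proof. rewrite /Ci /Cmult /Copp /=; f_equal; ring. Qed.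

Lemma Ci_nz : Ci <> 0.
Proof. move=> E. have := Cmod_Ci. rewrite E Cmod_0; lra. Qed.

(** * The Lambert sum as a combination of theta quotients *)

Section Lambert.
Variables q v : C.
Hypothesis Hq : nome q.
Hypothesis Hv : v <> 0.
Hypothesis g1 : generic q v.
Hypothesis g2 : generic q (- v).
Hypothesis g3 : generic q (Ci * v).
Hypothesis g4 : generic q (- (Ci * v)).
Let Hq0 := nome_nz Hq.
Let Hiv : Ci * v <> 0 := Cmult_neq_0 _ _ Ci_nz Hv.

Notation a := (jtheta (v ^ 2) (q ^ 4)).
Notation b := (jtheta (- v ^ 2) (q ^ 4)).
Notation c := (jtheta (q ^ 2 * v ^ 2) (q ^ 4)).
Notation d := (jtheta (- (q ^ 2 * v ^ 2)) (q ^ 4)).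

Lemma two_nz : 2 <> 0 :> C.
Proof. move=> /RtoC_inj; lra. Qed.

Lemma j_sq4 (x : C) : x <> 0 ->
  jtheta x q * jtheta (- x) q * euler (q ^ 4) ^ 2 =
  jtheta (x ^ 2) (q ^ 4) * jtheta (q ^ 2 * x ^ 2) (q ^ 4) * euler q ^ 2.
Proof.
  move=> Hx. have H1 := j_sq Hq Hx. have H2 := j_dup (nome2 Hq) (Cpow_nz x 2 Hx).
  have E2 : (q ^ 2) ^ 2 = q ^ 4 by ring. rewrite E2 in H2.
  have HE := euler_nz (nome2 Hq).
  apply: Csub_eq. apply: (Cmult_integral (v := euler (q ^ 2))) => //.
  transitivity ((jtheta x q * jtheta (- x) q * euler (q ^ 2)) * euler (q ^ 4) ^ 2
    - (jtheta (x ^ 2) (q ^ 4) * jtheta (q ^ 2 * x ^ 2) (q ^ 4) * euler (q ^ 2)) * euler q ^ 2); first ring.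
  rewrite H1 -H2; ring.
Qed.

Lemma pair_nz (x : C) : x <> 0 -> generic q x -> generic q (- x) ->
  jtheta x q <> 0 /\ jtheta (- x) q <> 0.
Proof. move=> Hx H1 H2; split; apply: j_nz => //; exact: Copp_nz. Qed.

Lemma Ci_v2 : (Ci * v) ^ 2 = - v ^ 2.
Proof. transitivity ((Ci * Ci) * v ^ 2); [ring | rewrite Ci_sqr; ring]. Qed.

Lemma prod_v : jtheta v q * jtheta (- v) q = a * c * euler q ^ 2 / euler (q ^ 4) ^ 2.
Proof. rewrite -j_sq4 //. field. exact: euler_nz (nome4 Hq). Qed.

Lemma prod_iv : jtheta (Ci * v) q * jtheta (- (Ci * v)) q = b * d * euler q ^ 2 / euler (q ^ 4) ^ 2.
Proof.
  have := j_sq4 Hiv. rewrite Ci_v2 (_ : q ^ 2 * - v ^ 2 = - (q ^ 2 * v ^ 2)); last by ring.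
  move=> <-. field. exact: euler_nz (nome4 Hq).
Qed.

(** With T = v q^u, the average over the fourth roots of unity zeta of zeta^(-r)/(1 - zeta T) equals
    T^r/(1 - T^4); here e = (-1)^r and s = (-i)^r. Summing over u uses [j_reciprocal] at v, -v, iv
    and -iv. *)
Lemma lambert (F e s : C) (r : nat) :
  (forall T, 1 - T <> 0 -> 1 + T <> 0 -> 1 - Ci * T <> 0 -> 1 + Ci * T <> 0 ->
     T ^ r / (1 - T ^ 4) = / 4 * (/ (1 - T) + e / (1 + T) + s * (/ (1 - Ci * T) + e / (1 + Ci * T)))) ->
  HS (fun u => th q q u * q ^^ (Z.of_nat r * u) / (1 - q ^^ (4 * u) * v ^ 4)) F ->
  4 * v ^ r * F = euler q ^ 3 * (/ jtheta v q + e / jtheta (- v) q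
     + s * (/ jtheta (Ci * v) q + e / jtheta (- (Ci * v)) q)).
Proof.
  move=> HT HF.
  have Hmv := Copp_nz Hv. have Hmiv := Copp_nz Hiv.
  have K1 := j_reciprocal Hq Hv g1. have K2 := j_reciprocal Hq Hmv g2.
  have K3 := j_reciprocal Hq Hiv g3. have K4 := j_reciprocal Hq Hmiv g4.
  have [N1 N2] := pair_nz Hv g1 g2. have [N3 N4] := pair_nz Hiv g3 g4.
  have K := HS_plus (HS_plus K1 (HS_scal e K2)) (HS_scal s (HS_plus K3 (HS_scal e K4))).
  have E := HS_unique (HS_scal (4 * v ^ r) HF) (HS_ext _ K).
  rewrite E; first by field.
  move=> u. have Hu := pz_nz (n := u) Hq0.
  have G1 := @g1 u. have G2 := @g2 u. have G3 := @g3 u. have G4 := @g4 u.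
  have G2' : 1 + v * q ^^ u <> 0 by have -> : 1 + v * q ^^ u = 1 - - v * q ^^ u by ring.
  have G3' : 1 - Ci * (v * q ^^ u) <> 0 by rewrite Cmult_assoc.
  have G4' : 1 + Ci * (v * q ^^ u) <> 0 by have -> : 1 + Ci * (v * q ^^ u) = 1 - - (Ci * v) * q ^^ u by ring.
  have T := HT (v * q ^^ u) G1 G2' G3' G4'.
  have P1 : (v * q ^^ u) ^ r = v ^ r * q ^^ (Z.of_nat r * u) by rewrite Cpow_mult_l pz_pow // Z.mul_comm.
  have P2 : (v * q ^^ u) ^ 4 = q ^^ (4 * u) * v ^ 4.
  { rewrite Cpow_mult_l pz_pow // Z.mul_comm. ofnat. ring. }
  rewrite P1 P2 in T.
  transitivity (4 * th q q u * (v ^ r * q ^^ (Z.of_nat r * u) / (1 - q ^^ (4 * u) * v ^ 4))); last by rewrite /Cdiv; ring.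
  rewrite T.
  have -> : 1 - - v * q ^^ u = 1 + v * q ^^ u by ring.
  have -> : 1 - Ci * v * q ^^ u = 1 - Ci * (v * q ^^ u) by ring.
  have -> : 1 - - (Ci * v) * q ^^ u = 1 + Ci * (v * q ^^ u) by ring.
  by field.
Qed.

Lemma T4_nz T : 1 - T <> 0 -> 1 + T <> 0 -> 1 - Ci * T <> 0 -> 1 + Ci * T <> 0 -> 1 - T ^ 2 <> 0 /\ 1 + T ^ 2 <> 0.
Proof.
  move=> H1 H2 H3 H4; split.
  - have -> : 1 - T ^ 2 = (1 - T) * (1 + T) by ring. exact: Cmult_neq_0.
  - have -> : 1 + T ^ 2 = (1 - Ci * T) * (1 + Ci * T).
    { transitivity (1 - (Ci * Ci) * T ^ 2); [rewrite Ci_sqr; ring | ring]. }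
    exact: Cmult_neq_0.
Qed.

Lemma half_sum (u : C) : 1 - u <> 0 -> 1 + u <> 0 -> / (1 - u) + 1 / (1 + u) = 2 / (1 - u * u).
Proof. move=> H1 H2. field. repeat split => //. have -> : 1 - u * u = (1 - u) * (1 + u) by ring. exact: Cmult_neq_0. Qed.

Lemma half_diff (u : C) : 1 - u <> 0 -> 1 + u <> 0 -> / (1 - u) + -(1) / (1 + u) = 2 * u / (1 - u * u).
Proof. move=> H1 H2. field. repeat split => //. have -> : 1 - u * u = (1 - u) * (1 + u) by ring. exact: Cmult_neq_0. Qed.

Lemma pf_even T (s : C) r : (r = 0%nat /\ s = 1) \/ (r = 2%nat /\ s = -(1)) ->
  1 - T <> 0 -> 1 + T <> 0 -> 1 - Ci * T <> 0 -> 1 + Ci * T <> 0 ->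
  T ^ r / (1 - T ^ 4) = / 4 * (/ (1 - T) + 1 / (1 + T) + s * (/ (1 - Ci * T) + 1 / (1 + Ci * T))).
Proof.
  move=> Hr H1 H2 H3 H4. have [N1 N2] := T4_nz H1 H2 H3 H4.
  rewrite half_sum // half_sum //.
  have -> : Ci * T * (Ci * T) = - T ^ 2 by transitivity ((Ci * Ci) * T ^ 2); [ring | rewrite Ci_sqr; ring].
  have -> : 1 - - T ^ 2 = 1 + T ^ 2 by ring. have -> : 1 - T * T = 1 - T ^ 2 by ring.
  have -> : 1 - T ^ 4 = (1 - T ^ 2) * (1 + T ^ 2) by ring.
  case: Hr => [[-> ->]|[-> ->]]; by field.
Qed.

Lemma pf_odd T (s : C) r : (r = 1%nat /\ s = - Ci) \/ (r = 3%nat /\ s = Ci) ->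
  1 - T <> 0 -> 1 + T <> 0 -> 1 - Ci * T <> 0 -> 1 + Ci * T <> 0 ->
  T ^ r / (1 - T ^ 4) = / 4 * (/ (1 - T) + -(1) / (1 + T) + s * (/ (1 - Ci * T) + -(1) / (1 + Ci * T))).
Proof.
  move=> Hr H1 H2 H3 H4. have [N1 N2] := T4_nz H1 H2 H3 H4.
  rewrite half_diff // half_diff //.
  have -> : Ci * T * (Ci * T) = - T ^ 2 by transitivity ((Ci * Ci) * T ^ 2); [ring | rewrite Ci_sqr; ring].
  have -> : 1 - - T ^ 2 = 1 + T ^ 2 by ring. have -> : 1 - T * T = 1 - T ^ 2 by ring.
  have -> : 1 - T ^ 4 = (1 - T ^ 2) * (1 + T ^ 2) by ring.
  case: Hr => [[-> ->]|[-> ->]].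
  - transitivity (/ 4 * (2 * T / (1 - T ^ 2) + - (Ci * Ci) * (2 * T / (1 + T ^ 2)))); last by field.
    rewrite Ci_sqr. by field.
  - transitivity (/ 4 * (2 * T / (1 - T ^ 2) + (Ci * Ci) * (2 * T / (1 + T ^ 2)))); last by field.
    rewrite Ci_sqr. by field.
Qed.

Lemma abcd_nz : a <> 0 /\ b <> 0 /\ c <> 0 /\ d <> 0.
Proof.
  have [N1 N2] := pair_nz Hv g1 g2. have [N3 N4] := pair_nz Hiv g3 g4.
  have M1 := Cmult_neq_0 _ _ N1 N2. have M2 := Cmult_neq_0 _ _ N3 N4.
  rewrite prod_v /Cdiv in M1. rewrite prod_iv /Cdiv in M2.
  split; [|split; [|split]] => Z; [apply: M1 | apply: M2 | apply: M1 | apply: M2]; rewrite Z; ring.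
Qed.

(** Over the common denominator j(v) j(-v) the numerator is j(v) + j(-v), twice the even part in
    [j_split]; likewise at iv. *)
Lemma lambert_even (F s : C) r : (r = 0%nat /\ s = 1) \/ (r = 2%nat /\ s = -(1)) ->
  HS (fun u => th q q u * q ^^ (Z.of_nat r * u) / (1 - q ^^ (4 * u) * v ^ 4)) F ->
  2 * v ^ r * F = euler q * euler (q ^ 4) ^ 2 *
    (jtheta (- (q * v ^ 2)) (q ^ 4) / (a * c) + s * (jtheta (q * v ^ 2) (q ^ 4) / (b * d))).
Proof.
  move=> Hr HF.
  have H := lambert (fun T => @pf_even T s r Hr) HF.
  have [N1 N2] := pair_nz Hv g1 g2. have [N3 N4] := pair_nz Hiv g3 g4.
  have [A [B [Cc D]]] := abcd_nz.
  have HE := euler_nz Hq. have HE4 := euler_nz (nome4 Hq).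
  have S1 := j_split Hq Hv. have S2 := j_split Hq (Copp_nz Hv).
  have S3 := j_split Hq Hiv. have S4 := j_split Hq (Copp_nz Hiv).
  have V2 : (- v) ^ 2 = v ^ 2 by ring. rewrite V2 in S2.
  have V4 : (- (Ci * v)) ^ 2 = - v ^ 2 by rewrite -Ci_v2; ring. rewrite V4 in S4. rewrite Ci_v2 in S3.
  have V5 : - (q * - v ^ 2) = q * v ^ 2 by ring. rewrite V5 in S3 S4.
  have E1 : / jtheta v q + 1 / jtheta (- v) q = 2 * jtheta (- (q * v ^ 2)) (q ^ 4) * euler (q ^ 4) ^ 2 / (a * c * euler q ^ 2).
  { transitivity ((jtheta v q + jtheta (- v) q) / (jtheta v q * jtheta (- v) q)); first by field.
    rewrite prod_v S1 S2. by field. }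
  have E2 : / jtheta (Ci * v) q + 1 / jtheta (- (Ci * v)) q = 2 * jtheta (q * v ^ 2) (q ^ 4) * euler (q ^ 4) ^ 2 / (b * d * euler q ^ 2).
  { transitivity ((jtheta (Ci * v) q + jtheta (- (Ci * v)) q) / (jtheta (Ci * v) q * jtheta (- (Ci * v)) q)); first by field.
    rewrite prod_iv S3 S4. by field. }
  rewrite E1 E2 in H.
  transitivity (/ 2 * (4 * v ^ r * F)); first by field; exact: two_nz.
  rewrite H. by field.
Qed.

Lemma lambert_odd (F s : C) r : (r = 1%nat /\ s = 1) \/ (r = 3%nat /\ s = -(1)) ->
  HS (fun u => th q q u * q ^^ (Z.of_nat r * u) / (1 - q ^^ (4 * u) * v ^ 4)) F ->
  2 * v ^ r * F = v * (euler q * euler (q ^ 4) ^ 2) *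
    (jtheta (- (q ^ 3 * v ^ 2)) (q ^ 4) / (a * c) + s * (jtheta (q ^ 3 * v ^ 2) (q ^ 4) / (b * d))).
Proof.
  move=> Hr HF.
  (* The pair at iT and -iT has weight -s i, and the odd part of j(iv) carries another i; their
     product is s. *)
  have Hr' : (r = 1%nat /\ - s * Ci = - Ci) \/ (r = 3%nat /\ - s * Ci = Ci).
  { case: Hr => [[-> ->]|[-> ->]]; [left | right]; split => //; ring. }
  have H := lambert (fun T => @pf_odd T (- s * Ci) r Hr') HF.
  have [N1 N2] := pair_nz Hv g1 g2. have [N3 N4] := pair_nz Hiv g3 g4.
  have [A [B [Cc D]]] := abcd_nz.
  have HE := euler_nz Hq. have HE4 := euler_nz (nome4 Hq).
  have S1 := j_split Hq Hv. have S2 := j_split Hq (Copp_nz Hv).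
  have S3 := j_split Hq Hiv. have S4 := j_split Hq (Copp_nz Hiv).
  have V2 : (- v) ^ 2 = v ^ 2 by ring. rewrite V2 in S2.
  have V4 : (- (Ci * v)) ^ 2 = - v ^ 2 by rewrite -Ci_v2; ring. rewrite V4 in S4. rewrite Ci_v2 in S3.
  have V5 : - (q ^ 3 * - v ^ 2) = q ^ 3 * v ^ 2 by ring. rewrite V5 in S3 S4.
  have E1 : / jtheta v q + -(1) / jtheta (- v) q = 2 * v * jtheta (- (q ^ 3 * v ^ 2)) (q ^ 4) * euler (q ^ 4) ^ 2 / (a * c * euler q ^ 2).
  { transitivity ((jtheta (- v) q - jtheta v q) / (jtheta v q * jtheta (- v) q)); first by field.
    rewrite prod_v S1 S2. by field. }
  have E2 : / jtheta (Ci * v) q + -(1) / jtheta (- (Ci * v)) q = Ci * (2 * v * jtheta (q ^ 3 * v ^ 2) (q ^ 4) * euler (q ^ 4) ^ 2 / (b * d * euler q ^ 2)).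
  { transitivity ((jtheta (- (Ci * v)) q - jtheta (Ci * v) q) / (jtheta (Ci * v) q * jtheta (- (Ci * v)) q)); first by field.
    rewrite prod_iv S3 S4. by field. }
  rewrite E1 E2 in H.
  transitivity (/ 2 * (4 * v ^ r * F)); first by field; exact: two_nz.
  rewrite H.
  set U := 2 * v * jtheta (q ^ 3 * v ^ 2) (q ^ 4) * _ / _.
  have -> : - s * Ci * (Ci * U) = s * U by transitivity (- (Ci * Ci) * s * U); [ring | rewrite Ci_sqr; ring].
  rewrite /U. by field.
Qed.

End Lambert.

(** * Theta identities *)

Section Algebra.
Variables a b c d P tau kappa : C.
Hypotheses (Ha : a <> 0) (Hb : b <> 0) (Hc : c <> 0) (Hd : d <> 0) (HP : P <> 0) (Ht : tau <> 0).
Hypothesis R1 : a * d = tau * (c * d - P * (a * b)).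
Hypothesis R2 : b * c = tau * (c * d + P * (a * b)).
Hypothesis R3 : kappa * (b * d) ^ 2 = / tau + 2 * P * tau.
Hypothesis R4 : kappa * (a * c) ^ 2 = / tau - 2 * P * tau.

(** Adding [R1] and [R2] eliminates P, and S turns out to be a nonzero multiple of tau. With S in
    denominators, tau, P and kappa become rational functions of a, b, c, d. *)
Let S := a * d + b * c.
Let N : 2 <> 0 :> C := two_nz.

Lemma S_tau : S = 2 * tau * (c * d).
Proof. rewrite /S R1 R2; ring. Qed.

Lemma S_nz : S <> 0.
Proof. rewrite S_tau. by repeat apply: Cmult_neq_0. Qed.

Lemma tau_S : tau = S / (2 * (c * d)).
Proof. rewrite S_tau. by field. Qed.

Lemma P_S : P = c * d * (b * c - a * d) / (a * b * S).
Proof. rewrite S_tau R1 R2. by field. Qed.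

Lemma kappa_S : kappa = (2 * (c * d) / S + (b * c - a * d) / (a * b)) / (b * d) ^ 2.
Proof.
  have HS := S_nz.
  have -> : kappa = kappa * (b * d) ^ 2 / (b * d) ^ 2 by field.
  rewrite R3 {1}P_S !tau_S. by field.
Qed.

(* what remains of R1-R4 once tau, P and kappa are eliminated *)
Let curve := (b * d) ^ 2 * ((a * d) ^ 2 + 2 * (a * b * c * d) - (b * c) ^ 2)
  - (a * c) ^ 2 * ((b * c) ^ 2 + 2 * (a * b * c * d) - (a * d) ^ 2).

(** Cross-multiplying [R3] and [R4] eliminates kappa; tau and P are then replaced by their rational
    expressions. *)
Lemma curve_0 : curve = 0.
Proof.
  have HS := S_nz.
  have E : (a * c) ^ 2 * (/ tau + 2 * P * tau) = (b * d) ^ 2 * (/ tau - 2 * P * tau) by rewrite -R3 -R4; ring.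
  have T : 2 * P * tau = (b * c - a * d) / (a * b) by rewrite {1}P_S tau_S; field.
  have T' : / tau = 2 * (c * d) / S by rewrite tau_S; field.
  rewrite T T' in E.
  have -> : curve = a * b * S * ((b * d) ^ 2 * (2 * (c * d) / S - (b * c - a * d) / (a * b))
     - (a * c) ^ 2 * (2 * (c * d) / S + (b * c - a * d) / (a * b))).
  { rewrite /curve. field_simplify; [| by []]. rewrite /S. ring. }
  rewrite E; ring.
Qed.

(** After elimination of kappa, tau and P the difference of the two sides is an explicit multiple of
    [curve]. The identities numbered 0 to 3 are what the theta part amounts to for r = 0, 1, 2,
    3. *)
Lemma identity_0 : a * b * c * d * (d / (a * c) + c / (b * d)) =
  tau * (c * d) / (2 * (a * b)) * (b ^ 2 * d + a ^ 2 * c)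
  + a * b / (4 * tau * (c * d)) * (c ^ 3 + d ^ 3)
  + kappa / 4 * (a * b * c * d) * (a * b * (c + d)).
Proof.
  have HS := S_nz. apply: Csub_eq. rewrite kappa_S tau_S.
  transitivity (curve / (4 * a * b * d * S)); last by rewrite curve_0; field.
  rewrite /curve /S. field. repeat split => //.
Qed.

Lemma identity_1 : P * (a * b * c * d) * (b / (a * c) - a / (b * d)) =
  P ^ 2 * tau * (a * b) / (2 * (c * d)) * (d ^ 2 * b + c ^ 2 * a)
  + c * d / (4 * tau * (a * b)) * (a ^ 3 + b ^ 3)
  - kappa / 4 * (a * b * c * d) * (c * d * (a + b)).
Proof.
  have HS := S_nz. apply: Csub_eq. rewrite kappa_S tau_S P_S.
  transitivity (- curve / (4 * a * b ^ 2 * S)); last by rewrite curve_0; field.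
  rewrite /curve /S. field. repeat split => //.
Qed.

Lemma identity_2 : - P * (a * b * c * d) * (b / (a * c) + a / (b * d)) =
  - (P ^ 2 * tau * (a * b)) / (2 * (c * d)) * (d ^ 2 * b - c ^ 2 * a)
  - c * d / (4 * tau * (a * b)) * (b ^ 3 - a ^ 3)
  - kappa / 4 * (a * b * c * d) * (c * d * (b - a)).
Proof.
  have HS := S_nz. apply: Csub_eq. rewrite kappa_S tau_S P_S.
  transitivity (curve / (4 * a * b ^ 2 * S)); last by rewrite curve_0; field.
  rewrite /curve /S. field. repeat split => //.
Qed.

Lemma identity_3 : a * b * c * d * (c / (b * d) - d / (a * c)) =
  - (tau * (c * d)) / (2 * (a * b)) * (b ^ 2 * d - a ^ 2 * c)
  - a * b / (4 * tau * (c * d)) * (d ^ 3 - c ^ 3)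
  + kappa / 4 * (a * b * c * d) * (a * b * (d - c)).
Proof.
  have HS := S_nz. apply: Csub_eq. rewrite kappa_S tau_S.
  transitivity (- curve / (4 * a * b * d * S)); last by rewrite curve_0; field.
  rewrite /curve /S. field. repeat split => //.
Qed.
End Algebra.

(** * Relations between the four theta values at P, -P, P^3, -P^3 in base P^8 *)

Section Values.
Variable P : C.
Hypothesis HPn : nome P.
Let HP := nome_nz HPn.
Let N2 : nome (P ^ 2).
Proof. apply: nome_pow => //; lia. Qed.
Let N4 : nome (P ^ 4).
Proof. apply: nome_pow => //; lia. Qed.
Let N8 : nome (P ^ 8).
Proof. apply: nome_pow => //; lia. Qed.
Let Npow k : P ^ k <> 0.
Proof. exact: Cpow_nz. Qed.

Notation j x := (jtheta x (P ^ 8)).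
Let a := j P.
Let b := j (- P).
Let c := j (P ^ 3).
Let d := j (- P ^ 3).
Let e1 := euler (P ^ 2).
Let e2 := euler (P ^ 4).
Let e4 := euler (P ^ 8).
Let e8 := euler (P ^ 16).
Let eo := euler (- P ^ 4).

Lemma gen8 m (s : C) : Cmod s = 1%R -> (m mod 8 <> 0)%nat -> generic (P ^ 8) (s * P ^ m).
Proof.
  move=> Hs Hm. rewrite -(pz_nat P m). apply: generic_pz => //; first lia.
  rewrite -Nat2Z.inj_mod; lia.
Qed.

Lemma gen8p m : (m mod 8 <> 0)%nat -> generic (P ^ 8) (P ^ m).
Proof. move=> Hm. have := gen8 Cmod_1 Hm. by rewrite Cmult_1_l. Qed.

Lemma gen8m m : (m mod 8 <> 0)%nat -> generic (P ^ 8) (- P ^ m).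
Proof. move=> Hm. have := gen8 Cmod_m1 Hm. by rewrite (_ : -(1) * P ^ m = - P ^ m); [|ring]. Qed.

Lemma j8_nz m : (m mod 8 <> 0)%nat -> j (P ^ m) <> 0 /\ j (- P ^ m) <> 0.
Proof.
  move=> Hm; split; apply: j_nz => //; [exact: gen8p | exact: Copp_nz | exact: gen8m].
Qed.

Lemma base_nz : a <> 0 /\ b <> 0 /\ c <> 0 /\ d <> 0.
Proof.
  have [A B] := @j8_nz 1 ltac:(by []). have [Cc D] := @j8_nz 3 ltac:(by []).
  by rewrite Cpow_1_r in A B.
Qed.

Lemma j8_refl m n : (m + n = 8)%nat -> j (P ^ m) = j (P ^ n) /\ j (- P ^ m) = j (- P ^ n).
Proof.
  move=> E. have Em : P ^ 8 = P ^ m * P ^ n by rewrite -E Cpow_add_r.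
  have Hm := @Npow m. have Hn := @Npow n. split.
  - rewrite -(j_refl N8 (@Npow n)). congr jtheta. rewrite Em. by field.
  - rewrite -(j_refl N8 (Copp_nz (@Npow n))). congr jtheta. rewrite Em. by field.
Qed.

Lemma j8_shift m : j (P ^ (8 + m)) = - j (P ^ m) / P ^ m /\ j (- P ^ (8 + m)) = j (- P ^ m) / P ^ m.
Proof.
  have Hm := @Npow m. rewrite Cpow_add_r; split.
  - by rewrite j_q.
  - have -> : - (P ^ 8 * P ^ m) = P ^ 8 * - P ^ m by ring. rewrite j_q //; last exact: Copp_nz. by field.
Qed.

Lemma eo_rel : e2 * eo * e8 = e4 ^ 3.
Proof. have := euler_opp N4. have -> : (P ^ 4) ^ 4 = P ^ 16 by ring. have -> : (P ^ 4) ^ 2 = P ^ 8 by ring. done. Qed.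

Lemma e_nz : e1 <> 0 /\ e2 <> 0 /\ e4 <> 0 /\ e8 <> 0 /\ eo <> 0.
Proof.
  repeat split; apply: euler_nz => //; last exact: nome_opp. apply: nome_pow => //; lia.
Qed.

Let tau := e8 / eo.

(** The functions j(P;-P^4) and j(-P;-P^4) are evaluated twice: [j_dup] gives the products ad and
    bc, and [j_split] gives two theta values in base P^16, which [j_sq] identifies with cd and ab.
    The negative base makes both sides meet in base P^8. *)
Lemma rel_tau : a * d = tau * (c * d - P * (a * b)) /\ b * c = tau * (c * d + P * (a * b)).
Proof.
  have [_ [_ [E4 [E8 Eo]]]] := e_nz.
  have Ns := nome_opp N4. have N16 : nome (P ^ 16) by apply: nome_pow => //; lia.
  have s2 : (- P ^ 4) ^ 2 = P ^ 8 by ring. have s4 : (- P ^ 4) ^ 4 = P ^ 16 by ring.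
  have Hm := Copp_nz HP.
  have D1 := j_dup Ns HP. have D2 := j_dup Ns Hm. rewrite s2 in D1 D2.
  have S1 := j_split Ns HP. have S2 := j_split Ns Hm. rewrite s4 in S1 S2.
  have A1 : - P ^ 4 * P = - P ^ 5 by ring. have A2 : - P ^ 4 * - P = P ^ 5 by ring.
  rewrite A1 in D1. rewrite A2 in D2.
  have [R5 R5'] := @j8_refl 5 3 ltac:(by []). rewrite R5' in D1. rewrite R5 in D2.
  have B1 : - (- P ^ 4 * P ^ 2) = P ^ 6 by ring. have B2 : - (- P ^ 4 * (- P) ^ 2) = P ^ 6 by ring.
  have B3 : - ((- P ^ 4) ^ 3 * P ^ 2) = P ^ 14 by ring. have B4 : - ((- P ^ 4) ^ 3 * (- P) ^ 2) = P ^ 14 by ring.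
  rewrite B1 B3 in S1. rewrite B2 B4 in S2.
  have R14 : jtheta (P ^ 14) (P ^ 16) = jtheta (P ^ 2) (P ^ 16).
  { rewrite -(j_refl N16 (@Npow 2)). congr jtheta. have -> : P ^ 16 = P ^ 14 * P ^ 2 by ring. by field. }
  rewrite R14 in S1 S2.
  have Q1 := j_sq N8 HP. have Q3 := j_sq N8 (@Npow 3).
  have C1 : (P ^ 8) ^ 2 = P ^ 16 by ring. have C2 : (P ^ 3) ^ 2 = P ^ 6 by ring.
  rewrite C1 in Q1 Q3. rewrite C2 in Q3.
  rewrite -/a -/b -/e8 -/e4 in Q1. rewrite -/c -/d -/e8 -/e4 in Q3.
  rewrite -/a -/d -/eo -/e4 S1 in D1. rewrite -/b -/c -/eo -/e4 S2 in D2.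
  split; rewrite /tau.
  - apply: Csub_eq; apply: (Cmult_integral (v := eo)) => //.
    transitivity (a * d * eo - (c * d * e8 - P * (a * b * e8))); first by field.
    rewrite Q1 Q3 -D1; ring.
  - apply: Csub_eq; apply: (Cmult_integral (v := eo)) => //.
    transitivity (b * c * eo - (c * d * e8 + P * (a * b * e8))); first by field.
    rewrite Q1 Q3 -D2; ring.
Qed.

Let alpha := j (-(1)).
Let gamma := j (- P ^ 4).
(** Ramanujan's theta function psi at P^4. The constants [alpha] and [gamma] become 2 tau psi and
    psi / tau, so that only tau enters the relations. *)
Let psi := e4 ^ 2 / e2.

Lemma alpha_eq : alpha = 2 * tau * psi.
Proof.
  have [_ [E2 [E4 [E8 Eo]]]] := e_nz. have H := j_m1 N8. have R := eo_rel.
  have E : (P ^ 8) ^ 2 = P ^ 16 by ring. rewrite E in H. rewrite -/e4 -/e8 -/alpha in H.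
  have -> : alpha = alpha * e4 / e4 by field. rewrite H /tau /psi.
  have -> : e4 = e2 * eo * e8 / e4 ^ 2 by rewrite R; field.
  have X : e2 * eo * e8 / e4 ^ 2 <> 0 by rewrite R; have -> : e4 ^ 3 / e4 ^ 2 = e4 by field.
  transitivity (2 * e8 * e4 ^ 2 / (e2 * eo)); first by field.
  have Y : e4 ^ 2 = (e2 * eo * e8 / e4 ^ 2) ^ 2 by rewrite R; field.
  rewrite {1}Y. field. done.
Qed.

Lemma gamma_eq : gamma = psi / tau.
Proof.
  have [_ [E2 [E4 [E8 Eo]]]] := e_nz. have H := j_half (nome_opp N4). have R := eo_rel.
  have E : (- P ^ 4) ^ 2 = P ^ 8 by ring. rewrite E in H. rewrite -/e4 -/eo -/gamma in H.
  have -> : gamma = gamma * e4 / e4 by field. rewrite H /tau /psi.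
  apply: Csub_eq; apply: (Cmult_integral (v := e2 * e8 * e4)); last by repeat apply: Cmult_neq_0.
  transitivity (eo * (e2 * eo * e8 - e4 ^ 3)); first by field. rewrite R; ring.
Qed.

Let kappa := e1 / (e4 ^ 4 * psi).

Lemma psi_nz : psi <> 0.
Proof.
  have [_ [E2 [E4 _]]] := e_nz. apply: Cmult_neq_0; [exact: Cpow_nz | exact: Cinv_nz].
Qed.

Lemma tau_nz : tau <> 0.
Proof. have [_ [_ [_ [E8 Eo]]]] := e_nz. apply: Cmult_neq_0 => //; exact: Cinv_nz. Qed.

(* Split the theta function of base P^2 at -s into its even and odd parts. *)
Lemma rel_kappa_aux (s u v : C) : s ^ 2 = P ^ 2 -> s <> 0 -> u = j (- s) -> v = j (- (P ^ 4 * s)) ->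
  gamma + s * alpha = (u * v) ^ 2 * e1 / e4 ^ 4.
Proof.
  move=> Hs Hs0 Hu Hv. have [E1 [E2 [E4 [E8 Eo]]]] := e_nz. have Hms := Copp_nz Hs0.
  have S := j_split N2 Hms.
  have A0 : (- s) ^ 2 = P ^ 2 by rewrite -Hs; ring.
  have A1 : - (P ^ 2 * (- s) ^ 2) = - P ^ 4 by rewrite A0; ring.
  have A2 : - ((P ^ 2) ^ 3 * (- s) ^ 2) = - P ^ 8 by rewrite A0; ring.
  have A3 : (P ^ 2) ^ 4 = P ^ 8 by ring.
  rewrite A1 A2 A3 (j_neg_base N8) -/alpha -/gamma in S.
  have D1 := j_dup N2 Hms. have B1 : (P ^ 2) ^ 2 = P ^ 4 by ring. rewrite B1 in D1.
  have R : jtheta (P ^ 2 * - s) (P ^ 4) = jtheta (- s) (P ^ 4).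
  { rewrite -(j_refl N4 Hms). congr jtheta.
    have -> : P ^ 4 = P ^ 2 * s ^ 2 by rewrite Hs; ring. by field. }
  rewrite R -/e1 -/e2 in D1.
  have D2 := j_dup N4 Hms. have B2 : (P ^ 4) ^ 2 = P ^ 8 by ring. rewrite B2 in D2.
  have B3 : P ^ 4 * - s = - (P ^ 4 * s) by ring. rewrite B3 -Hu -Hv -/e2 -/e4 in D2.
  have -> : gamma + s * alpha = jtheta (- s) (P ^ 2) by rewrite S; ring.
  have -> : jtheta (- s) (P ^ 2) = jtheta (- s) (P ^ 2) * e2 ^ 2 / e2 ^ 2 by field.
  rewrite D1.
  have -> : jtheta (- s) (P ^ 4) = jtheta (- s) (P ^ 4) * e4 ^ 2 / e4 ^ 2 by field.
  rewrite D2. by field.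
Qed.

Lemma rel_kappa : kappa * (b * d) ^ 2 = / tau + 2 * P * tau /\ kappa * (a * c) ^ 2 = / tau - 2 * P * tau.
Proof.
  have [E1 [E2 [E4 [E8 Eo]]]] := e_nz. have Hp := psi_nz. have Ht := tau_nz.
  have [R5 R5'] := @j8_refl 5 3 ltac:(by []).
  have K1 : gamma + P * alpha = (b * d) ^ 2 * e1 / e4 ^ 4.
  { apply: rel_kappa_aux => //. rewrite (_ : P ^ 4 * P = P ^ 5); last by ring. by rewrite R5'. }
  have K2 : gamma + - P * alpha = (a * c) ^ 2 * e1 / e4 ^ 4.
  { apply: rel_kappa_aux => //; [ring | exact: Copp_nz | congr jtheta; ring |].
    rewrite (_ : - (P ^ 4 * - P) = P ^ 5); last by ring. by rewrite R5. }
  rewrite alpha_eq gamma_eq in K1 K2. rewrite /kappa. split.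
  - transitivity (((b * d) ^ 2 * e1 / e4 ^ 4) / psi); first by field. rewrite -K1. by field.
  - transitivity (((a * c) ^ 2 * e1 / e4 ^ 4) / psi); first by field. rewrite -K2. by field.
Qed.

(** By [j_dup] the products ac and bd are j(P;P^4) and j(-P;P^4) up to Euler factors; by [j_sq]
    these multiply to j(P^2;P^8), which [j_quarter] evaluates. *)
Lemma rel_abcd : a * b * c * d = e1 * e4 ^ 4 / e2.
Proof.
  have [E1 [E2 [E4 _]]] := e_nz. have Hm := Copp_nz HP.
  have [R5 R5'] := @j8_refl 5 3 ltac:(by []).
  have D1 := j_dup N4 HP. have D2 := j_dup N4 Hm. have Q := j_sq N4 HP. have R := j_quarter N2.
  have B2 : (P ^ 4) ^ 2 = P ^ 8 by ring. have B3 : P ^ 4 * P = P ^ 5 by ring. have B4 : P ^ 4 * - P = - P ^ 5 by ring.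
  have B5 : (P ^ 2) ^ 4 = P ^ 8 by ring. have B6 : (P ^ 2) ^ 2 = P ^ 4 by ring.
  rewrite B2 B3 R5 in D1. rewrite B2 B4 R5' in D2. rewrite B2 in Q. rewrite B5 B6 in R.
  rewrite -/a -/c -/e4 -/e2 in D1. rewrite -/b -/d -/e4 -/e2 in D2. rewrite -/e4 -/e2 in Q. rewrite -/e1 -/e2 -/e4 in R.
  apply: Csub_eq; apply: (Cmult_integral (v := e2 ^ 2 * e4)).
  - transitivity ((a * c * e2) * (b * d * e2) * e4 - e1 * e4 ^ 5 * e2); first by field.
    rewrite -D1 -D2.
    transitivity ((jtheta P (P ^ 4) * jtheta (- P) (P ^ 4) * e4) * e4 ^ 4 - e1 * e4 ^ 5 * e2); first ring.
    rewrite Q.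
    transitivity ((jtheta (P ^ 2) (P ^ 8) * e2) * e2 * e4 ^ 4 - e1 * e4 ^ 5 * e2); first ring.
    rewrite R; ring.
  - apply: Cmult_neq_0 => //; exact: Cpow_nz.
Qed.

End Values.

(** Through [j_dup] and [j_sq] both sides become multiples of j(x;Q^2) j(-x;Q^2) j(Qx;Q^2). At Q =
    q^8 and x = y^2 this removes J_32 from the coefficient of omega_3; [theta_product_shift] does so
    for f_3. *)
Lemma theta_product_half Q (x : C) : nome Q -> x <> 0 ->
  jtheta x Q * jtheta (- x) (Q ^ 2) * euler (Q ^ 4) =
  euler Q * (jtheta (Q * x) (Q ^ 2) * jtheta (x ^ 2) (Q ^ 4)).
Proof.
  move=> HQ Hx. have D := j_dup HQ Hx. have S := j_sq (nome2 HQ) Hx.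
  have E : (Q ^ 2) ^ 2 = Q ^ 4 by ring. rewrite E in S.
  have N := euler_nz (nome2 HQ).
  apply: Csub_eq; apply: (Cmult_integral (v := euler (Q ^ 2) ^ 2)); last exact: Cpow_nz.
  transitivity ((jtheta x Q * euler (Q ^ 2) ^ 2) * (jtheta (- x) (Q ^ 2) * euler (Q ^ 4))
    - euler Q * jtheta (Q * x) (Q ^ 2) * (jtheta (x ^ 2) (Q ^ 4) * euler (Q ^ 2) ^ 2)); first ring.
  rewrite D -S; ring.
Qed.

Lemma theta_product_shift Q (x : C) : nome Q -> x <> 0 ->
  jtheta x Q * jtheta (- (Q * x)) (Q ^ 2) * euler (Q ^ 4) =
  euler Q * (jtheta x (Q ^ 2) * jtheta (Q ^ 2 * x ^ 2) (Q ^ 4)).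
Proof.
  move=> HQ Hx. have Hqx := Cmult_neq_0 _ _ (nome_nz HQ) Hx.
  have D := j_dup HQ Hx. have S := j_sq (nome2 HQ) Hqx.
  have E : (Q ^ 2) ^ 2 = Q ^ 4 by ring. have E' : (Q * x) ^ 2 = Q ^ 2 * x ^ 2 by ring. rewrite E E' in S.
  have N := euler_nz (nome2 HQ).
  apply: Csub_eq; apply: (Cmult_integral (v := euler (Q ^ 2) ^ 2)); last exact: Cpow_nz.
  transitivity ((jtheta x Q * euler (Q ^ 2) ^ 2) * (jtheta (- (Q * x)) (Q ^ 2) * euler (Q ^ 4))
    - euler Q * jtheta x (Q ^ 2) * (jtheta (Q ^ 2 * x ^ 2) (Q ^ 4) * euler (Q ^ 2) ^ 2)); first ring.
  rewrite D -S; ring.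
Qed.

(** * The mock theta coefficients *)

Section MockPart.
Variables P y : C.
Hypotheses (HPn : nome P) (Hy : y <> 0).
Let q := P ^ 2.
Let HP := nome_nz HPn.
Let Hq : nome q := nome2 HPn.
Let Hqz := nome_nz Hq.
Let HQ : nome (q ^ 4) := nome4 Hq.
Notation j x := (jtheta x (q ^ 4)).
Let a := j y.
Let b := j (- y).
Let c := j (q ^ 2 * y).
Let d := j (- (q ^ 2 * y)).
Hypotheses (g1 : generic (q ^ 4) y) (g2 : generic (q ^ 4) (- y))
  (g3 : generic (q ^ 4) (q ^ 2 * y)) (g4 : generic (q ^ 4) (- (q ^ 2 * y))).

Lemma mock_nz : a <> 0 /\ b <> 0 /\ c <> 0 /\ d <> 0.
Proof.
  have H2 : q ^ 2 * y <> 0 by apply: Cmult_neq_0 => //; exact: Cpow_nz.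
  by repeat split; apply: j_nz => //; exact: Copp_nz.
Qed.

Lemma mock_ab : a * b * euler (q ^ 8) = jtheta (y ^ 2) (q ^ 8) * euler (q ^ 4) ^ 2.
Proof. have := j_sq HQ Hy. by rewrite (_ : (q ^ 4) ^ 2 = q ^ 8); last ring. Qed.

(** Sum and difference isolate the two parts in [j_split]. In the second equation q^16 stays
    uncancelled so that [j_q] can bring the argument back to -y^2. *)
Lemma mock_cd : c + d = 2 * jtheta (- (q ^ 8 * y ^ 2)) (q ^ 16) /\
  y * (d - c) = 2 * q ^ 2 * (q ^ 16 * y ^ 2 * jtheta (- (q ^ 16 * y ^ 2)) (q ^ 16)) / q ^ 16.
Proof.
  have H2 : q ^ 2 * y <> 0 by apply: Cmult_neq_0 => //; exact: Cpow_nz.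
  have S := j_split HQ H2. have S' := j_split HQ (Copp_nz H2).
  have E1 : - (q ^ 4 * (q ^ 2 * y) ^ 2) = - (q ^ 8 * y ^ 2) by ring.
  have E2 : - (q ^ 4 * (- (q ^ 2 * y)) ^ 2) = - (q ^ 8 * y ^ 2) by ring.
  have E3 : - ((q ^ 4) ^ 3 * (q ^ 2 * y) ^ 2) = - (q ^ 16 * y ^ 2) by ring.
  have E4 : - ((q ^ 4) ^ 3 * (- (q ^ 2 * y)) ^ 2) = - (q ^ 16 * y ^ 2) by ring.
  have E5 : (q ^ 4) ^ 4 = q ^ 16 by ring.
  rewrite E1 E3 E5 in S. rewrite E2 E4 E5 in S'. rewrite /c /d S S'. split; first ring. by field.
Qed.

(** The mock parts of the Appell sums at opposite points differ by exchanging c and d up to sign, so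
    they combine to multiples of ab(d - c) for omega_3 and ab(c + d) for f_3. The non-mock parts
    stay, together with [F1], in the first three terms. *)
Lemma hecke_value (L F1 : C) : HS (hecke_term P y) L ->
  HS (fun u => (-(1)) ^^ u * P ^^ (u * u) * y ^^ u / (1 - P ^^ (8 * u) * y ^ 2)) F1 ->
  L = 2 * F1
    - c * d / (2 * j (- q ^ 2) * (a * b)) * (b ^ 2 * d + a ^ 2 * c)
    - P / y * (a * b / (2 * j (-(1)) * (c * d))) * (c ^ 3 + d ^ 3)
    - q ^ 4 / y ^ 2 * (jtheta (q ^ 8 * y ^ 2) (q ^ 16) * jtheta (y ^ 4) (q ^ 32) / euler (q ^ 32)) * omega3 (- q ^ 2)
    + P / y * (jtheta (y ^ 2) (q ^ 16) * jtheta (q ^ 16 * y ^ 4) (q ^ 32) / euler (q ^ 32)) * (/ 2 * f3 (q ^ 4)).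
Proof.
  move=> HL HF1.
  have [A [B [Cc D]]] := mock_nz.
  have H2 : q ^ 2 * y <> 0 by apply: Cmult_neq_0 => //; exact: Cpow_nz.
  have [De [He Ee]] := even_appell Hq. have [Do [Ho Eo]] := odd_appell Hq.
  have Hmy := Copp_nz Hy. have Hm2 := Copp_nz H2.
  have K := hecke_split HPn Hy g1 g2 g3 g4 HL HF1 (He _ Hy g1) (He _ Hmy g2) (Ho _ H2 g3) (Ho _ Hm2 g4).
  have al := alpha_nz Hq. have ga := gamma_nz Hq.
  rewrite {}K (Ee _ Hy g1) (Ee _ Hmy g2) (Eo _ H2 g3) (Eo _ Hm2 g4).
  have r1 : - - y = y by ring. have r2 : q ^ 2 * - y = - (q ^ 2 * y) by ring.
  have r3 : - q ^ 2 * y = - (q ^ 2 * y) by ring. have r4 : - q ^ 2 * - y = q ^ 2 * y by ring.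
  have r5 : - - (q ^ 2 * y) = q ^ 2 * y by ring. have r6 : q ^ 2 * (q ^ 2 * y) = q ^ 4 * y by ring.
  have r7 : - q ^ 2 * (q ^ 2 * y) = q ^ 4 * - y by ring. have r8 : q ^ 2 * - (q ^ 2 * y) = q ^ 4 * - y by ring.
  have r9 : - q ^ 2 * - (q ^ 2 * y) = q ^ 4 * y by ring.
  rewrite !r1 !r2 !r3 !r4 !r5 !r6 !r7 !r8 !r9 !(j_q HQ Hy) !(j_q HQ Hmy).
  fold a b c d.
  have [M1 M2] := mock_cd. have M3 := mock_ab.
  have N4 := euler_nz HQ. have N8 : euler (q ^ 8) <> 0 by apply: euler_nz; apply: nome_pow => //; lia.
  have N32 : euler (q ^ 32) <> 0 by apply: euler_nz; apply: nome_pow => //; lia.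
  have Hx : y ^ 2 <> 0 by exact: Cpow_nz.
  have H8 : nome (q ^ 8) by apply: nome_pow => //; lia.
  have H16 : nome (q ^ 16) by apply: nome_pow => //; lia.
  have Q1 := theta_product_half H8 Hx. have Q2 := theta_product_shift H8 Hx.
  have s1 : (q ^ 8) ^ 2 = q ^ 16 by ring. have s2 : (q ^ 8) ^ 4 = q ^ 32 by ring. have s3 : (y ^ 2) ^ 2 = y ^ 4 by ring.
  rewrite s1 s2 s3 in Q1 Q2.
  have s4 : - (q ^ 16 * y ^ 2) = q ^ 16 * - y ^ 2 by ring. rewrite s4 (j_q H16 (Copp_nz Hx)) in M2.
  set w := omega3 _. set f := f3 _. set al' := j (-(1)) in al *. set ga' := j (- q ^ 2) in ga *.
  set X1 := jtheta (y ^ 2) (q ^ 8) in M3 Q1 Q2. set X2 := jtheta (- y ^ 2) _ in M2 Q1.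
  set X3 := jtheta (- (q ^ 8 * y ^ 2)) _ in M1 Q2.
  have -> : jtheta (q ^ 8 * y ^ 2) (q ^ 16) * jtheta (y ^ 4) (q ^ 32) / euler (q ^ 32) = X1 * X2 / euler (q ^ 8).
  { transitivity (euler (q ^ 8) * (jtheta (q ^ 8 * y ^ 2) (q ^ 16) * jtheta (y ^ 4) (q ^ 32)) / (euler (q ^ 32) * euler (q ^ 8))).
    - by field.
    - rewrite -Q1. by field. }
  have -> : jtheta (y ^ 2) (q ^ 16) * jtheta (q ^ 16 * y ^ 4) (q ^ 32) / euler (q ^ 32) = X1 * X3 / euler (q ^ 8).
  { transitivity (euler (q ^ 8) * (jtheta (y ^ 2) (q ^ 16) * jtheta (q ^ 16 * y ^ 4) (q ^ 32)) / (euler (q ^ 32) * euler (q ^ 8))).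
    - by field.
    - rewrite -Q2. by field. }
  have -> : X1 = a * b * euler (q ^ 8) / euler (q ^ 4) ^ 2 by rewrite M3; field.
  have -> : X3 = (c + d) / 2 by rewrite M1; field.
  have -> : X2 = y * (d - c) / (2 * q ^ 2) by rewrite M2; field.
  have HP0 := HP. rewrite /q. field. by repeat split.
Qed.

End MockPart.

(** * Evaluation of the theta part at y = P^(2r+1) *)

Section ThetaPart.
Variable p : C.
Hypothesis Hp : nome p.
Let P := p ^ 2.
Let HP : nome P := nome2 Hp.
Let HPz := nome_nz HP.
Let q := P ^ 2.
Let Hq : nome q := nome2 HP.
Notation j x := (jtheta x (P ^ 8)).

Let K := euler q ^ 2 * euler (q ^ 2) / euler (q ^ 4) ^ 4.

(** The assertion that the first three terms of [hecke_value] at y = P^k collapse to a single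
    product; s is the sign (-1)^floor((r+1)/2) with k = 2r + 1. *)
Definition theta_part (k : nat) (s F1 : C) :=
  2 * F1
    - j (P ^ (4 + k)) * j (- P ^ (4 + k)) / (2 * j (- q ^ 2) * (j (P ^ k) * j (- P ^ k)))
       * (j (- P ^ k) ^ 2 * j (- P ^ (4 + k)) + j (P ^ k) ^ 2 * j (P ^ (4 + k)))
    - P / P ^ k * (j (P ^ k) * j (- P ^ k) / (2 * j (-(1)) * (j (P ^ (4 + k)) * j (- P ^ (4 + k)))))
       * (j (P ^ (4 + k)) ^ 3 + j (- P ^ (4 + k)) ^ 3)
  = s * (P / P ^ k) / 4 * K * (j (P ^ k) * j (- P ^ k) * (j (P ^ (4 + k)) + j (- P ^ (4 + k)))).

Lemma generic_zeta (k : nat) (s : C) : Cmod s = 1%R -> Nat.odd k = true -> generic q (s * p ^ k).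
Proof.
  move=> Hs Hk. rewrite -(pz_nat p k) /q /P. have -> : (p ^ 2) ^ 2 = p ^ 4 by ring.
  apply: generic_pz => //; first lia.
  move/Nat.odd_spec: Hk => [m ->]. change (Z.of_nat 4) with 4%Z.
  have := Z.div_mod (Z.of_nat (2 * m + 1)) 4 ltac:(lia). lia.
Qed.

Lemma Cmod_Ci : Cmod Ci = 1%R.
Proof. rewrite /Cmod /Ci /=. have -> : (0 * (0 * 1) + 1 * (1 * 1) = 1)%R by ring. exact: sqrt_1. Qed.

(** Here p^k is a square root of y = P^k, and P^(u^2) y^u = q^(u(u+1)/2) q^(r u) when k = 2r + 1. *)
Lemma lambert_term (r k : nat) F1 : k = (2 * r + 1)%nat ->
  HS (fun u => (-(1)) ^^ u * P ^^ (u * u) * (P ^ k) ^^ u / (1 - P ^^ (8 * u) * (P ^ k) ^ 2)) F1 ->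
  HS (fun u => th q q u * q ^^ (Z.of_nat r * u) / (1 - q ^^ (4 * u) * (p ^ k) ^ 4)) F1.
Proof.
  move=> Hk. apply: HS_ext => u. rewrite /th. have Hqz := nome_nz Hq.
  have E : (P ^ k) ^ 2 = (p ^ k) ^ 4 by rewrite /P -!Cpow_mult_r; congr (p ^ _)%C; lia.
  rewrite E. rewrite /q !(pow_pz _ _ HPz). ofnat.
  have T := tri_double u. have -> : (2 * (4 * u) = 8 * u)%Z by lia.
  congr Cdiv. rewrite -!Cmult_assoc -!(pz_add _ _ HPz). congr Cmult. congr Cpowz. subst k. lia.
Qed.

Let Pk k : P ^ k = (p ^ k) ^ 2.
Proof. rewrite /P -!Cpow_mult_r; congr (p ^ _)%C; lia. Qed.

(** The two parities of r are stated together: m is the exponent of q y or of q^3 y, and for odd r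
    one factor p^k cancels on both sides, which leaves an integral power of P. *)
Lemma lambert_value (r : nat) (s F1 : C) : let k := (2 * r + 1)%nat in
  (((r = 0%nat /\ s = 1) \/ (r = 2%nat /\ s = -(1))) \/ ((r = 1%nat /\ s = 1) \/ (r = 3%nat /\ s = -(1)))) ->
  HS (fun u => (-(1)) ^^ u * P ^^ (u * u) * (P ^ k) ^^ u / (1 - P ^^ (8 * u) * (P ^ k) ^ 2)) F1 ->
  let m := (if Nat.even r then 2 + k else 6 + k)%nat in
  2 * P ^ (k * (r / 2)) * F1 = euler (P ^ 2) * euler (P ^ 8) ^ 2 *
    (j (- P ^ m) / (j (P ^ k) * j (P ^ (4 + k))) + s * (j (P ^ m) / (j (- P ^ k) * j (- P ^ (4 + k))))).
Proof.
  move=> k Hr HF m. have HL := @lambert_term r k F1 eq_refl HF.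
  have Hpz := nome_nz Hp. have Hv : p ^ k <> 0 by exact: Cpow_nz.
  have Ho : Nat.odd k = true by rewrite /k; apply/Nat.odd_spec; exists r.
  have g1 : generic q (p ^ k) by have := generic_zeta Cmod_1 Ho; rewrite Cmult_1_l.
  have g2 : generic q (- p ^ k) by have := generic_zeta Cmod_m1 Ho; rewrite (_ : -(1) * p ^ k = - p ^ k); [|ring].
  have g3 := generic_zeta Cmod_Ci Ho.
  have g4 : generic q (- (Ci * p ^ k)).
  { have := @generic_zeta k (- Ci) _ Ho. rewrite (_ : - Ci * p ^ k = - (Ci * p ^ k)); last ring. apply. by rewrite Cmod_opp Cmod_Ci. }
  have e1 : q ^ 4 = P ^ 8 by rewrite /q; ring. have e2 : (p ^ k) ^ 2 = P ^ k by rewrite Pk.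
  have e3 : q ^ 2 * P ^ k = P ^ (4 + k) by rewrite Cpow_add_r /q; ring.
  have e4 : q * P ^ k = P ^ (2 + k) by rewrite Cpow_add_r /q; ring.
  have e5 : q ^ 3 * P ^ k = P ^ (6 + k) by rewrite Cpow_add_r /q; ring.
  case: Hr => Hr.
  - have V := lambert_even Hq Hv g1 g2 g3 g4 Hr HL. rewrite e1 e2 e3 e4 in V.
    have -> : P ^ (k * (r / 2)) = (p ^ k) ^ r.
    { rewrite Cpow_mult_r Pk -Cpow_mult_r. by case: Hr => [[-> _]|[-> _]]. }
    rewrite V. have -> : m = (2 + k)%nat by rewrite /m; case: Hr => [[-> _]|[-> _]]. done.
  - have V := lambert_odd Hq Hv g1 g2 g3 g4 Hr HL. rewrite e1 e2 e3 e5 in V.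
    apply: Csub_eq; apply: (Cmult_integral (v := p ^ k)) => //.
    have E : P ^ (k * (r / 2)) * p ^ k = (p ^ k) ^ r.
    { rewrite Cpow_mult_r Pk -Cpow_mult_r. case: Hr => [[-> _]|[-> _]]; [change (2 * (1/2))%nat with 0%nat | change (2 * (3/2))%nat with 2%nat]; ring. }
    have -> : m = (6 + k)%nat by rewrite /m; case: Hr => [[-> _]|[-> _]].
    transitivity (2 * (P ^ (k * (r / 2)) * p ^ k) * F1 - p ^ k * (euler q * euler (P ^ 8) ^ 2) *
      (j (- P ^ (6 + k)) / (j (P ^ k) * j (P ^ (4 + k))) + s * (j (P ^ (6 + k)) / (j (- P ^ k) * j (- P ^ (4 + k)))))); first by rewrite /q; ring.
    rewrite E V. ring.
Qed.

Let psi := euler (P ^ 8) ^ 2 / euler (P ^ 4).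
Let tau := euler (P ^ 16) / euler (- P ^ 4).
Let kappa := euler (P ^ 2) / (euler (P ^ 8) ^ 4 * psi).
Let a := j P.
Let b := j (- P).
Let c := j (P ^ 3).
Let d := j (- P ^ 3).

Lemma theta_constants_at_P : j (- q ^ 2) = psi / tau /\ j (-(1)) = 2 * tau * psi /\
  euler (P ^ 2) * euler (P ^ 8) ^ 2 = a * b * c * d / psi /\ K = kappa * (a * b * c * d) / psi.
Proof.
  have A := alpha_eq HP. have G := gamma_eq HP. have R := rel_abcd HP.
  have [E1 [E2 [E4 [E8 Eo]]]] := e_nz HP.
  have -> : - q ^ 2 = - P ^ 4 by rewrite /q; ring.
  split; [exact: G | split; [exact: A|]].
  rewrite /a /b /c /d R /K /kappa /psi /q.
  have -> : (P ^ 2) ^ 2 = P ^ 4 by ring. have -> : (P ^ 2) ^ 4 = P ^ 8 by ring.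
  split; by field.
Qed.

(** [j8_refl] and [j8_shift] reduce all exponents modulo 8 to 1 and 3, that is, to a, b, c, d; with
    the constants from [theta_constants_at_P] the claim becomes [identity_0]. The other r are
    treated alike. *)
Lemma theta_part_0 F1 :
  HS (fun u => (-(1)) ^^ u * P ^^ (u * u) * (P ^ 1) ^^ u / (1 - P ^^ (8 * u) * (P ^ 1) ^ 2)) F1 ->
  theta_part 1 1 F1.
Proof.
  move=> H. have V := @lambert_value 0 _ F1 (or_introl (or_introl (conj eq_refl eq_refl))) H.
  cbv beta zeta in V. change (2 * 0 + 1)%nat with 1%nat in V. change (Nat.even 0) with true in V. cbv iota in V.
  change (1 * (0 / 2))%nat with 0%nat in V. change (2 + 1)%nat with 3%nat in V.
  rewrite /theta_part. change (4 + 1)%nat with 5%nat in *.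
  have [R5 R5'] := @j8_refl P HP 5 3 eq_refl. rewrite R5 R5' Cpow_1_r in V *.
  rewrite -/a -/b -/c -/d in V *.
  have [Sg [Sa [Se SK]]] := theta_constants_at_P. rewrite Se in V. rewrite Sg Sa SK.
  have [A [B [Cc D]]] := base_nz HP. have [R1 R2] := rel_tau HP. have [R3 R4] := rel_kappa HP.
  have Tn := tau_nz HP. have Pn := psi_nz HP.
  have I := identity_0 A B Cc D Tn R1 R2 R3 R4.
  rewrite -/a -/b -/c -/d -/tau -/kappa in A B Cc D I Tn.
  rewrite -/psi in Pn.
  have Hz := HPz.
  have E : 2 * F1 = 2 * P ^ 0 * F1 / P ^ 0 by field.
  rewrite E {}V {E}.
  move: (tau) (kappa) (psi) (a) (b) (c) (d) (P) I A B Cc D Tn Pn Hz => t k ps a0 b0 c0 d0 z I A B Cc D Tn Pn Hz {R1 R2 R3 R4 Sg Sa Se SK H}.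
  apply: Csub_eq.
  (* The claim is the algebraic identity divided by psi and by a power of P that depends on r, being
     left over from the reduction modulo 8. *)
  match type of I with ?l = ?r => transitivity ((l - r) / (ps * z ^ 0)) end; first by cfield.
  rewrite I; cfield.
Qed.

Lemma theta_part_1 F1 :
  HS (fun u => (-(1)) ^^ u * P ^^ (u * u) * (P ^ 3) ^^ u / (1 - P ^^ (8 * u) * (P ^ 3) ^ 2)) F1 ->
  theta_part 3 (-(1)) F1.
Proof.
  move=> H. have V := @lambert_value 1 _ F1 (or_intror (or_introl (conj eq_refl eq_refl))) H.
  cbv beta zeta in V. change (2 * 1 + 1)%nat with 3%nat in V. change (Nat.even 1) with false in V. cbv iota in V.
  change (3 * (1 / 2))%nat with 0%nat in V. change (6 + 3)%nat with 9%nat in V.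
  rewrite /theta_part. change (4 + 3)%nat with 7%nat in *.
  have [R7 R7'] := @j8_refl P HP 7 1 eq_refl. have [S1 S1'] := @j8_shift P HP 1.
  change (8 + 1)%nat with 9%nat in *. rewrite R7 R7' S1 S1' !Cpow_1_r in V *.
  rewrite -/a -/b -/c -/d in V *.
  have [Sg [Sa [Se SK]]] := theta_constants_at_P. rewrite Se in V. rewrite Sg Sa SK.
  have [A [B [Cc D]]] := base_nz HP. have [R1 R2] := rel_tau HP. have [R3 R4] := rel_kappa HP.
  have Tn := tau_nz HP. have Pn := psi_nz HP.
  have I := identity_1 A B Cc D Tn R1 R2 R3 R4.
  rewrite -/a -/b -/c -/d -/tau -/kappa in A B Cc D I Tn.
  rewrite -/psi in Pn.
  have Hz := HPz.
  have E : 2 * F1 = 2 * P ^ 0 * F1 / P ^ 0 by field.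
  rewrite E {}V {E}.
  move: (tau) (kappa) (psi) (a) (b) (c) (d) (P) I A B Cc D Tn Pn Hz => t k ps a0 b0 c0 d0 z I A B Cc D Tn Pn Hz {R1 R2 R3 R4 Sg Sa Se SK H}.
  apply: Csub_eq.
  match type of I with ?l = ?r => transitivity ((l - r) / (ps * z ^ 2)) end; first by cfield.
  rewrite I; cfield.
Qed.

Lemma theta_part_2 F1 :
  HS (fun u => (-(1)) ^^ u * P ^^ (u * u) * (P ^ 5) ^^ u / (1 - P ^^ (8 * u) * (P ^ 5) ^ 2)) F1 ->
  theta_part 5 (-(1)) F1.
Proof.
  move=> H. have V := @lambert_value 2 _ F1 (or_introl (or_intror (conj eq_refl eq_refl))) H.
  cbv beta zeta in V. change (2 * 2 + 1)%nat with 5%nat in V. change (Nat.even 2) with true in V. cbv iota in V.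
  change (5 * (2 / 2))%nat with 5%nat in V. change (2 + 5)%nat with 7%nat in V.
  rewrite /theta_part. change (4 + 5)%nat with 9%nat in *.
  have [R5 R5'] := @j8_refl P HP 5 3 eq_refl. have [R7 R7'] := @j8_refl P HP 7 1 eq_refl. have [S1 S1'] := @j8_shift P HP 1.
  change (8 + 1)%nat with 9%nat in *. rewrite R7 R7' R5 R5' S1 S1' !Cpow_1_r in V *.
  rewrite -/a -/b -/c -/d in V *.
  have [Sg [Sa [Se SK]]] := theta_constants_at_P. rewrite Se in V. rewrite Sg Sa SK.
  have [A [B [Cc D]]] := base_nz HP. have [R1 R2] := rel_tau HP. have [R3 R4] := rel_kappa HP.
  have Tn := tau_nz HP. have Pn := psi_nz HP.
  have I := identity_2 A B Cc D Tn R1 R2 R3 R4.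
  rewrite -/a -/b -/c -/d -/tau -/kappa in A B Cc D I Tn.
  rewrite -/psi in Pn.
  have Hz := HPz.
  have E : 2 * F1 = 2 * P ^ 5 * F1 / P ^ 5 by field.
  rewrite E {}V {E}.
  move: (tau) (kappa) (psi) (a) (b) (c) (d) (P) I A B Cc D Tn Pn Hz => t k ps a0 b0 c0 d0 z I A B Cc D Tn Pn Hz {R1 R2 R3 R4 Sg Sa Se SK H}.
  apply: Csub_eq.
  match type of I with ?l = ?r => transitivity ((l - r) / (ps * z ^ 5)) end; first by cfield.
  rewrite I; cfield.
Qed.

Lemma theta_part_3 F1 :
  HS (fun u => (-(1)) ^^ u * P ^^ (u * u) * (P ^ 7) ^^ u / (1 - P ^^ (8 * u) * (P ^ 7) ^ 2)) F1 ->
  theta_part 7 1 F1.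
Proof.
  move=> H. have V := @lambert_value 3 _ F1 (or_intror (or_intror (conj eq_refl eq_refl))) H.
  cbv beta zeta in V. change (2 * 3 + 1)%nat with 7%nat in V. change (Nat.even 3) with false in V. cbv iota in V.
  change (7 * (3 / 2))%nat with 7%nat in V. change (6 + 7)%nat with 13%nat in V.
  rewrite /theta_part. change (4 + 7)%nat with 11%nat in *.
  have [R5 R5'] := @j8_refl P HP 5 3 eq_refl. have [R7 R7'] := @j8_refl P HP 7 1 eq_refl.
  have [S3 S3'] := @j8_shift P HP 3. have [S5 S5'] := @j8_shift P HP 5.
  change (8 + 3)%nat with 11%nat in *. change (8 + 5)%nat with 13%nat in *.
  rewrite R7 R7' S3 S3' S5 S5' R5 R5' !Cpow_1_r in V *.
  rewrite -/a -/b -/c -/d in V *.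
  have [Sg [Sa [Se SK]]] := theta_constants_at_P. rewrite Se in V. rewrite Sg Sa SK.
  have [A [B [Cc D]]] := base_nz HP. have [R1 R2] := rel_tau HP. have [R3 R4] := rel_kappa HP.
  have Tn := tau_nz HP. have Pn := psi_nz HP.
  have I := identity_3 A B Cc D Tn R1 R2 R3 R4.
  rewrite -/a -/b -/c -/d -/tau -/kappa in A B Cc D I Tn.
  rewrite -/psi in Pn.
  have Hz := HPz.
  have E : 2 * F1 = 2 * P ^ 7 * F1 / P ^ 7 by field.
  rewrite E {}V {E}.
  move: (tau) (kappa) (psi) (a) (b) (c) (d) (P) I A B Cc D Tn Pn Hz => t k ps a0 b0 c0 d0 z I A B Cc D Tn Pn Hz {R1 R2 R3 R4 Sg Sa Se SK H}.
  apply: Csub_eq.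
  match type of I with ?l = ?r => transitivity ((l - r) / (ps * z ^ 9)) end; first by cfield.
  rewrite I; cfield.
Qed.

End ThetaPart.

Lemma lambert_summable P (y : C) : nome P -> y <> 0 ->
  exists F1, HS (fun u => (-(1)) ^^ u * P ^^ (u * u) * y ^^ u / (1 - P ^^ (8 * u) * y ^ 2)) F1.
Proof.
  move=> HP Hy. have HPz := nome_nz HP. apply: summable_HS.
  have H8 : nome (P ^ 8) by apply: nome_pow => //; lia.
  have [B [HB Bk]] := inv_bounded H8 (Cpow_nz _ 2 Hy).
  have K := @summable_q P y (fun n => n * n)%Z (fun n => (-(1)) ^^ n) 1 0 0 1 HP Hy ltac:(lia) _ _.
  have S := summable_bounded_mul Bk (K _ _).
  have E : (fun u => (-(1)) ^^ u * P ^^ (u * u) * y ^^ u / (1 - P ^^ (8 * u) * y ^ 2)) =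
    (fun i => / (1 - y ^ 2 * (P ^ 8) ^^ i) * ((-(1)) ^^ i * P ^^ (i * i) * y ^^ i)).
  { apply: functional_extensionality => u. rewrite (pow_pz 8 _ HPz). change (Z.of_nat 8) with 8%Z.
    rewrite /Cdiv (Cmult_comm (y ^ 2)). ring. }
  rewrite E. apply: S.
  - move=> n; rewrite Cmod_sgn; lra.
  - move=> n; lia.
Qed.

(** [theta_part] leaves ab(c + d), and [mock_ab] and [mock_cd] convert this into the product j(-q^8
    y^2;q^16) j(y^2;q^8). *)
Lemma hecke_theta_mock (p : C) (r : nat) (L : C) : nome p -> (r <= 3)%nat ->
  let P := p ^ 2 in let q := P ^ 2 in let y := P ^ (2 * r + 1) in
  HS (hecke_term P y) L ->
  L = (-(1)) ^ ((r + 1) / 2) * (P / y / 2)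
        * (euler q ^ 2 * euler (q ^ 2) / (euler (q ^ 4) ^ 2 * euler (q ^ 8)))
        * jtheta (- (q ^ 8 * y ^ 2)) (q ^ 16) * jtheta (y ^ 2) (q ^ 8)
    - q ^ 4 / y ^ 2 * (jtheta (q ^ 8 * y ^ 2) (q ^ 16) * jtheta (y ^ 4) (q ^ 32) / euler (q ^ 32)) * omega3 (- q ^ 2)
    + P / y * (jtheta (y ^ 2) (q ^ 16) * jtheta (q ^ 16 * y ^ 4) (q ^ 32) / euler (q ^ 32)) * (/ 2 * f3 (q ^ 4)).
Proof.
  move=> Hp Hr P q y HL. have HP : nome P := nome2 Hp. have Hq : nome q := nome2 HP.
  have HPz := nome_nz HP. have Hy : y <> 0 by exact: Cpow_nz.
  have E8 : q ^ 4 = P ^ 8 by rewrite /q; ring.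
  have hm m : (m mod 8 <> 0)%nat -> generic (q ^ 4) (P ^ m) /\ generic (q ^ 4) (- P ^ m).
  { rewrite E8 => Hm; split; [exact: gen8p | exact: gen8m]. }
  have [g1 g2] : generic (q ^ 4) y /\ generic (q ^ 4) (- y).
  { apply: hm. clear -Hr; move: Hr. do 4 (case: r => [|r]; first done). lia. }
  have E4 : q ^ 2 * y = P ^ (4 + (2 * r + 1)) by rewrite Cpow_add_r /q /y; ring.
  have [g3 g4] : generic (q ^ 4) (q ^ 2 * y) /\ generic (q ^ 4) (- (q ^ 2 * y)).
  { rewrite E4. apply: hm. clear -Hr; move: Hr. do 4 (case: r => [|r]; first done). lia. }
  have [F1 HF] := lambert_summable HP Hy.
  rewrite (hecke_value HP Hy g1 g2 g3 g4 HL HF).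
  have [M _] := mock_cd HP Hy. have M3 := mock_ab HP Hy.
  have T : theta_part p (2 * r + 1) ((-(1)) ^ ((r + 1) / 2)) F1.
  { rewrite /y in HF. clear -Hp HF Hr. move: Hr HF.
    case: r => [|[|[|[|r]]]] Hr HF; last by lia.
    - have -> : (-(1)) ^ ((0 + 1) / 2) = 1 by change ((0 + 1) / 2)%nat with 0%nat; ring. exact: theta_part_0.
    - have -> : (-(1)) ^ ((1 + 1) / 2) = -(1) by change ((1 + 1) / 2)%nat with 1%nat; ring. exact: theta_part_1.
    - have -> : (-(1)) ^ ((2 + 1) / 2) = -(1) by change ((2 + 1) / 2)%nat with 1%nat; ring. exact: theta_part_2.
    - have -> : (-(1)) ^ ((3 + 1) / 2) = 1 by change ((3 + 1) / 2)%nat with 2%nat; ring. exact: theta_part_3. }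
  rewrite /theta_part -/P -/q -/y -E4 -E8 in T.
  set a := jtheta y (q ^ 4) in T M3 *. set b := jtheta (- y) (q ^ 4) in T M3 *.
  rewrite -/q in M M3.
  set c := jtheta (q ^ 2 * y) (q ^ 4) in T M *. set d := jtheta (- (q ^ 2 * y)) (q ^ 4) in T M *.
  rewrite T. congr (_ - _ + _).
  have N4 := euler_nz (nome4 Hq). have N8 : euler (q ^ 8) <> 0 by apply: euler_nz; apply: nome_pow => //; lia.
  have -> : jtheta (- (q ^ 8 * y ^ 2)) (q ^ 16) = (c + d) / 2 by rewrite M; field.
  have -> : jtheta (y ^ 2) (q ^ 8) = a * b * euler (q ^ 8) / euler (q ^ 4) ^ 2 by rewrite M3; field.
  by field.
Qed.

Lemma summable_exp_abs (c : R) : (c < 0)%R -> summable (fun m : Z => RtoC (exp (Rabs (IZR m) * c))).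
Proof.
  move=> Hc.
  have K (s : Z) : (s = 1 \/ s = -1)%Z -> summable (fun n : nat => RtoC (exp (Rabs (IZR (s * Z.of_nat n)) * c))).
  { move=> Hs. apply: (@summable_nat_geom _ 1 (exp c)).
    - have := exp_pos c. have := exp_increasing c 0 Hc. rewrite exp_0. lra.
    - move=> n. rewrite Cmod_exp Rmult_1_l mult_IZR Rabs_mult -INR_IZR_INZ.
      have -> : Rabs (IZR s) = 1%R by case: Hs => ->; [rewrite Rabs_R1 | rewrite Rabs_left; lra].
      rewrite Rmult_1_l (Rabs_pos_eq _ (pos_INR n)). elim: n => [|n IH]; first by rewrite Rmult_0_l exp_0 /=; lra.
      rewrite S_INR Rmult_plus_distr_r Rmult_1_l exp_plus /=. have := exp_pos c. nra. }
  apply: summable_Z_split.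
  - apply: (summable_le _ (K 1%Z (or_introl eq_refl))) => n. rewrite Z.mul_1_l. exact: Rle_refl.
  - apply: (summable_le _ (K (-1)%Z (or_intror eq_refl))) => n.
    have -> : (-1 * Z.of_nat n = - Z.of_nat n)%Z by lia. exact: Rle_refl.
Qed.

Lemma HS_indicator (a : Z) (c : C) : HS (fun m : Z => if eqd m a then c else 0) c.
Proof.
  have := @HS_single _ (fun m : Z => if eqd m a then c else 0) a.
  case: (eqd a a) => // _; apply=> i Hi. by case: (eqd i a).
Qed.

Lemma geometric_nonneg (x : C) : x <> 0 -> (Cmod x < 1)%R ->
  HS (fun m : Z => if Z_le_dec 0 m then x ^^ m else 0) (/ (1 - x)).
Proof.
  move=> Hx H1. have Hn : nome x by split => //; exact/Cmod_gt_0.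
  have H1x : 1 - x <> 0 by have := nome_1m (n := 1) Hn ltac:(lia); rewrite Cpow_1_r.
  set f := fun m : Z => _.
  have [s Hs] : exists s, HS f s.
  { apply: summable_HS. apply: (summable_le _ (summable_exp_abs (nome_ln Hn))) => m. rewrite Cmod_exp /f.
    case: Z_le_dec => Hm; last by rewrite Cmod_0; apply: Rlt_le; exact: exp_pos.
    rewrite Cmod_pz // Rabs_pos_eq; [exact: Rle_refl | exact: IZR_le]. }
  have D := HS_minus Hs (HS_scal x (HS_shift (-1) Hs)).
  have U := HS_indicator 0 1.
  have E : s - x * s = 1.
  { apply: (HS_unique D). apply: HS_ext U => m. rewrite /f.
    case: eqd => Hm; case: Z_le_dec => A; case: Z_le_dec => B; try lia; [by rewrite Hm pz_0; ring | | by ring].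
    have {1}-> : (m = (m + -1) + 1)%Z by lia. rewrite pz_S //. ring. }
  have -> : / (1 - x) = s; last by [].
  have -> : / (1 - x) = (s - x * s) / (1 - x) by rewrite E; field. by field.
Qed.

Lemma geometric_neg (x : C) : (1 < Cmod x)%R ->
  HS (fun m : Z => if Z_lt_dec m 0 then - x ^^ m else 0) (/ (1 - x)).
Proof.
  move=> H1. have Hx : x <> 0 by apply/Cmod_gt_0; lra.
  have Hi : (Cmod (/ x) < 1)%R by rewrite Cmod_inv // -Rinv_1; apply: Rinv_lt_contravar; lra.
  have H := HS_scal (- / x) (HS_refl (-1) (geometric_nonneg (Cinv_nz Hx) Hi)).
  have Hn : nome (/ x) by split => //; apply/Cmod_gt_0; exact: Cinv_nz.
  have Hix : 1 - / x <> 0 by have := nome_1m (n := 1) Hn ltac:(lia); rewrite Cpow_1_r.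
  have H1x : 1 - x <> 0.
  { move=> E. apply: Hix. have -> : x = 1 by apply: eq_sym; apply: Csub_eq. by field. }
  have -> : / (1 - x) = - / x * / (1 - / x).
  { field. split => //. split => // E. apply: H1x. have -> : x = x - 1 + 1 by ring. rewrite E; ring. }
  apply: HS_ext H => m. case: Z_le_dec => A; case: Z_lt_dec => B; try lia; last by ring.
  rewrite pz_base_inv. have -> : (- (-1 - m) = m + 1)%Z by lia. rewrite pz_S //. by field.
Qed.

(** * The string function *)

Definition annulus (q z : C) : Prop := (Cmod q < Cmod z < / Cmod q)%R.

(** Signs in the expansion of 1/(1 - z q^k) in the annulus: nonnegative powers for k > 0, negative
    powers with a minus sign for k < 0. The term k = 0 is left out, because its expansion would
    depend on the side of |z| = 1. *)
Definition quadrant (k m : Z) : C :=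
  if Z_lt_dec 0 k then (if Z_le_dec 0 m then 1 else 0)
  else if Z_lt_dec k 0 then (if Z_lt_dec m 0 then -(1) else 0) else 0.

Section Annulus.
Variable q : C.
Hypothesis Hq : nome q.
Let Hq0 := nome_nz Hq.

Lemma annulus_nz z : annulus q z -> z <> 0.
Proof. move=> [H _]. apply/Cmod_gt_0. have := Cmod_ge_0 q; lra. Qed.

Lemma annulus_ln z : annulus q z -> (ln (Cmod q) + Rabs (ln (Cmod z)) < 0)%R.
Proof.
  move=> H. have Hz := proj1 (Cmod_gt_0 z) (annulus_nz H). have [Hq1 _] := Hq. have [H1 H2] := H.
  have L1 := ln_increasing _ _ Hq1 H1. have L2 := ln_increasing _ _ Hz H2. rewrite ln_Rinv // in L2.
  rewrite /Rabs. case: Rcase_abs => _; lra.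
Qed.

Definition recip_term (z : C) (p : Z * Z) : C :=
  quadrant (fst p) (snd p) * th q q (fst p) * q ^^ (fst p * snd p) * z ^^ snd p.

(** On the support of [quadrant] one has k m >= |m|, so |q^(km) z^m| is at most the |m|-th power of
    |q| max(|z|, 1/|z|), which is below 1 in the annulus. *)
Lemma recip_summable z : annulus q z -> summable (recip_term z).
Proof.
  move=> Hz. have Hz0 := annulus_nz Hz. have L := annulus_ln Hz. have Lq := nome_ln Hq.
  have S := summable_prod (proj1 (HS_j Hq Hq0)) (summable_exp_abs L).
  apply: (summable_le _ S) => -[k m]. rewrite /recip_term. cbn [fst snd]. generalize (th q q k) => T.
  rewrite !Cmod_mult Cmod_exp (Cmod_pz _ Hq0) (Cmod_pz _ Hz0).
  have P := Cmod_ge_0 T.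
  set E := exp (Rabs _ * _). have HE := exp_pos (Rabs (IZR m) * (ln (Cmod q) + Rabs (ln (Cmod z)))). rewrite -/E in HE.
  have Ez := Rle_abs (ln (Cmod z)). have Ez' := Rle_abs (- ln (Cmod z)). rewrite Rabs_Ropp in Ez'.
  have key : (0 < k)%Z /\ (0 <= m)%Z \/ (k < 0)%Z /\ (m < 0)%Z ->
    (exp (IZR (k * m) * ln (Cmod q)) * exp (IZR m * ln (Cmod z)) <= E)%R.
  { move=> Hkm. rewrite -exp_plus. apply: exp_mono.
    have B : (Rabs (IZR m) <= IZR (k * m))%R by rewrite -abs_IZR; apply: IZR_le; nia.
    have C1 : (IZR m * ln (Cmod z) <= Rabs (IZR m) * Rabs (ln (Cmod z)))%R by rewrite -Rabs_mult; exact: Rle_abs.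
    nra. }
  rewrite /quadrant. case: Z_lt_dec => A; [case: Z_le_dec => B | case: Z_lt_dec => A'; [case: Z_lt_dec => B|]];
    rewrite ?Cmod_opp ?Cmod_1 ?Cmod_0 ?Rmult_0_l ?Rmult_1_l; try nra.
  - have := key (or_introl (conj A B)). nra.
  - have := key (or_intror (conj A' B)). nra.
Qed.

Lemma recip_HS z R : annulus q z -> generic q z -> HS (recip_term z) R ->
  R = euler q ^ 3 / jtheta z q - / (1 - z).
Proof.
  move=> Hz Hg HR. have Hz0 := annulus_nz Hz. have L := annulus_ln Hz. have Lq := nome_ln Hq.
  have Ez := Rle_abs (ln (Cmod z)). have Ez' := Rle_abs (- ln (Cmod z)). rewrite Rabs_Ropp in Ez'.
  have Hx k : z * q ^^ k <> 0 by apply: Cmult_neq_0 => //; exact: pz_nz.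
  have Mx k : Cmod (z * q ^^ k) = exp (ln (Cmod z) + IZR k * ln (Cmod q)).
  { rewrite Cmod_mult Cmod_pz // exp_plus exp_ln //. exact: (proj1 (Cmod_gt_0 z)). }
  have F := HS_fubini (g := fun k => th q q k / (1 - z * q ^^ k) - (if eqd k 0%Z then / (1 - z) else 0)) HR _.
  have U := HS_indicator 0 (/ (1 - z)).
  apply: (HS_unique (F _) (HS_minus (j_reciprocal Hq Hz0 Hg) U)) => k.
  case: (Z.lt_total k 0) => [Hk|[->|Hk]].
  - case: eqd => E; first by lia.
    have M1 : (1 < Cmod (z * q ^^ k))%R.
    { rewrite Mx -exp_0. apply: exp_increasing. have Hk1 : (IZR k <= -1)%R by apply: IZR_le; lia. nra. }
    have -> : th q q k / (1 - z * q ^^ k) - 0 = th q q k * / (1 - z * q ^^ k) by rewrite /Cdiv; ring.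
    apply: HS_ext (HS_scal (th q q k) (geometric_neg M1)) => m. rewrite /recip_term /quadrant /=.
    case: (Z_lt_dec 0 k) => A; first by lia. case: (Z_lt_dec k 0) => A' //. case: (Z_lt_dec m 0) => B; last by ring.
    rewrite pz_base_mul -pz_mul //. ring.
  - case: eqd => // _. rewrite pz_0 Cmult_1_r /th pz_0 pz_0 /=.
    have -> : 1 * 1 * 1 / (1 - z) - / (1 - z) = 0 by rewrite /Cdiv; ring.
    apply: HS_ext HS_zero => m. rewrite /recip_term /quadrant /=. ring.
  - case: eqd => E; first by lia.
    have M1 : (Cmod (z * q ^^ k) < 1)%R.
    { rewrite Mx -exp_0. apply: exp_increasing. have Hk1 : (1 <= IZR k)%R by apply: IZR_le; lia. nra. }
    have -> : th q q k / (1 - z * q ^^ k) - 0 = th q q k * / (1 - z * q ^^ k) by rewrite /Cdiv; ring.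
    apply: HS_ext (HS_scal (th q q k) (geometric_nonneg (Hx k) M1)) => m. rewrite /recip_term /quadrant /=.
    case: (Z_lt_dec 0 k) => A //. case: (Z_le_dec 0 m) => B; last by ring.
    rewrite pz_base_mul -pz_mul //. ring.
Qed.

(** One family g has to serve every z. It is read off at the single point z0 by dividing the grouped
    sums by z0^t; at any other z the groups are these values times z^t. *)
Lemma laurent_regroup {I} (phi : I -> Z) (coef : I -> C) z0 : annulus q z0 ->
  (forall z, annulus q z -> summable (fun p => coef p * z ^^ phi p)) ->
  exists g : Z -> C, (forall t, HS (fun p => if eqd (phi p) t then coef p else 0) (g t)) /\
    forall z s, annulus q z -> HS (fun p => coef p * z ^^ phi p) s -> HS (fun t => g t * z ^^ t) s.
Proof.
  move=> Hz0 Hs. have [s0 HS0] := summable_HS (Hs _ Hz0). have Z0 := annulus_nz Hz0.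
  have [g0 [G0 _]] := HS_regroup phi HS0. pose g t := g0 t / z0 ^^ t.
  have G t : HS (fun p => if eqd (phi p) t then coef p else 0) (g t).
  { have N := pz_nz (n := t) Z0. have -> : g t = / z0 ^^ t * g0 t by rewrite /g /Cdiv; ring.
    apply: HS_ext (HS_scal (/ z0 ^^ t) (G0 t)) => p. case: eqd => [->|_]; [by field | by ring]. }
  exists g; split => // z s Hz H. have Nz := annulus_nz Hz.
  have [g' [G' S']] := HS_regroup phi H. apply: HS_ext S' => t.
  apply: (HS_unique (G' t)). have -> : g t * z ^^ t = z ^^ t * g t by ring.
  apply: HS_ext (HS_scal (z ^^ t) (G t)) => p. case: eqd => [->|_]; ring.
Qed.

Variable Y : C.
Hypothesis HY : Y <> 0.
Variable r : Z.

Let A (i : Z) : C := q ^^ (24 * i * i) * Y ^^ i.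
Let s (i : Z) : Z := (r + 8 * i)%Z.

(* coefficient of z^t in (z^(-s) - z^(s+1)) / (1 - z) *)
Definition delta (s t : Z) : C :=
  if Z_le_dec (Z.abs t) s then 1 else if Z_lt_dec s (- Z.abs t) then (if Z_lt_dec s t then -(1) else 0) else 0.

Lemma weight_summable z (e : Z) (B : Z) : annulus q z -> summable (fun i => A i * z ^^ (e * i + B)).
Proof.
  move=> Hz. have Nz := annulus_nz Hz. have Ne := pz_nz (n := e) Nz.
  have K := @summable_q q (Y * z ^^ e) (fun i => 24 * i * i)%Z (fun _ => z ^^ B) 1 0 0 (Cmod (z ^^ B)) Hq (Cmult_neq_0 _ _ HY Ne) ltac:(lia) _ _.
  apply: (summable_le _ (K _ _)).
  - move=> i. rewrite /A pz_add // (pz_mul e i Nz) pz_base_mul. apply: Req_le. congr Cmod. ring.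
  - move=> i; exact: Rle_refl.
  - move=> i; nia.
Qed.

Lemma shifted_summable z (e : Z) : annulus q z ->
  summable (fun p => A (fst p) * z ^^ (e * s (fst p) + (e + 1) / 2) * recip_term z (snd p)).
Proof.
  move=> Hz. have K := weight_summable (8 * e) (e * r + (e + 1) / 2) Hz.
  have E : (fun i => A i * z ^^ (8 * e * i + (e * r + (e + 1) / 2))) = (fun i => A i * z ^^ (e * s i + (e + 1) / 2)).
  { apply: functional_extensionality => i. congr (_ * _ ^^ _). rewrite /s. ring. }
  rewrite E in K. exact: summable_prod K (recip_summable Hz).
Qed.

Hypothesis Hr : (0 <= r < 8)%Z.

Lemma delta_summable z : annulus q z -> summable (fun p : Z * Z => A (fst p) * delta (s (fst p)) (snd p) * z ^^ snd p).
Proof.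
  move=> Hz. have Nz := annulus_nz Hz.
  (* [delta] vanishes for |t| > 8|i| + 9, where the exponent may be replaced by any coercive one. In
     the remaining range t^2 <= 64 i^2 + 144|i| + 81, so 3 times 24 i^2 controls i^2 + t^2 up to
     linear terms. *)
  pose e i t := (if Z_le_dec (Z.abs t) (8 * Z.abs i + 9) then 24 * i * i else i * i + t * t)%Z.
  have K := @summable_q2 q Y z e (fun p => delta (s (fst p)) (snd p)) 3 160 81 1 Hq HY Nz ltac:(lia) _ _.
  apply: (summable_le _ (K _ _)).
  - move=> [i t]. cbn [fst snd]. apply: Req_le. congr Cmod. rewrite /A /e.
    case: Z_le_dec => B; first by ring.
    have -> : delta (s i) t = 0; last by ring.
    rewrite /delta /s. case: Z_le_dec => B1; first by lia. case: Z_lt_dec => B2 //. lia.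
  - move=> [i t]; rewrite /delta. cbn [fst snd].
    case: Z_le_dec => _; [|case: Z_lt_dec => _; [case: Z_lt_dec => _|]]; rewrite ?Cmod_opp ?Cmod_1 ?Cmod_0; lra.
  - move=> i t. rewrite /e. case: Z_le_dec => B; last by nia.
    have B2 : (Z.abs t * Z.abs t <= (8 * Z.abs i + 9) * (8 * Z.abs i + 9))%Z by apply: Z.mul_le_mono_nonneg; lia.
    have := Z.abs_square t. have := Z.abs_square i. nia.
Qed.

Lemma delta_HS (z : C) (u : Z) : z <> 0 -> 1 - z <> 0 ->
  HS (fun t => delta u t * z ^^ t) ((z ^^ (- u) - z ^^ (u + 1)) / (1 - z)).
Proof.
  move=> Hz H1.
  have [S HS0] : exists S, HS (fun t => delta u t * z ^^ t) S.
  { apply: summable_HS. apply: (@summable_finite _ (Z.abs u)) => t Ht. have -> : delta u t = 0; last by ring.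
    rewrite /delta. case: Z_le_dec => B1; first by lia. case: Z_lt_dec => B2 //. case: Z_lt_dec => B3 //. lia. }
  have D := HS_minus HS0 (HS_scal z (HS_shift (-1) HS0)).
  have U := HS_minus (HS_indicator (- u) (z ^^ (- u))) (HS_indicator (u + 1) (z ^^ (u + 1))).
  have E : S - z * S = z ^^ (- u) - z ^^ (u + 1).
  { apply: (HS_unique D). apply: HS_ext U => t.
    have X : z * (delta u (t + -1) * z ^^ (t + -1)) = delta u (t + -1) * z ^^ t.
    { have -> : z ^^ t = z ^^ (t + -1) * z by rewrite -(@pz_S z (t + -1) Hz); f_equal; lia. ring. }
    rewrite X /delta. case: eqd => [->|B1]; case: eqd => [E|B2]; first by lia.
    all: repeat (case: Z_le_dec => ?); repeat (case: Z_lt_dec => ?); try lia; try ring.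
    all: by rewrite E; ring. }
  rewrite -E. have -> : (S - z * S) / (1 - z) = S by field. done.
Qed.

Lemma annulus_1 : annulus q 1.
Proof.
  have [H1 H2] := Hq. rewrite /annulus Cmod_1. split => //. rewrite -Rinv_1. apply: Rinv_lt_contravar; lra.
Qed.

(** One statement for the two monomials of the numerator: e s + (e + 1)/2 is -s for e = -1 and s + 1
    for e = 1. In the constant coefficient m is forced, and k is replaced by -e k so that the signs
    of both cases are handled at once. *)
Lemma shifted_laurent (e : Z) : (e = 1 \/ e = -1)%Z -> exists g : Z -> C,
  (forall z M R, annulus q z -> HS (fun i => A i * z ^^ (e * s i + (e + 1) / 2)) M -> HS (recip_term z) R ->
     HS (fun t => g t * z ^^ t) (M * R)) /\
  HS (fun p : Z * Z => A (fst p) * (quadrant (- e * snd p) (- (e * s (fst p) + (e + 1) / 2))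
     * th q q (- e * snd p) * q ^^ (e * snd p * (e * s (fst p) + (e + 1) / 2)))) (g 0%Z).
Proof.
  move=> He. pose f i := (e * s i + (e + 1) / 2)%Z.
  pose phi (p : Z * (Z * Z)) := (f (fst p) + snd (snd p))%Z.
  pose coef (p : Z * (Z * Z)) := A (fst p) * (quadrant (fst (snd p)) (snd (snd p)) * th q q (fst (snd p)) * q ^^ (fst (snd p) * snd (snd p))).
  have E (z : C) : z <> 0 -> (fun p => A (fst p) * z ^^ f (fst p) * recip_term z (snd p)) = (fun p => coef p * z ^^ phi p).
  { move=> Hz. apply: functional_extensionality => -[i [k m]]. rewrite /coef /phi /recip_term. cbn [fst snd].
    rewrite (pz_add (f i) m Hz). ring. }
  have Hs (z : C) : annulus q z -> summable (fun p => coef p * z ^^ phi p).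
  { move=> Hz. rewrite -(E z (annulus_nz Hz)). exact: shifted_summable. }
  have [g [G0 G]] := laurent_regroup annulus_1 Hs.
  exists g; split.
  - move=> z M R Hz HM HR. apply: G => //. rewrite -(E z (annulus_nz Hz)). exact: (HS_prod HM HR).
  - pose psi (p : Z * Z) : Z * (Z * Z) := (fst p, (- e * snd p, - f (fst p)))%Z.
    have inj : forall p p', psi p = psi p' -> p = p'.
    { move=> [i k] [i' k'] [Ei Ek _]. subst i'. f_equal. case: He => He; subst e; lia. }
    have zero : forall p, (forall p', psi p' <> p) -> (if eqd (phi p) 0%Z then coef p else 0) = 0.
    { move=> [i [k m]] Hp. case: eqd => // H0. case: (Hp (i, (- e * k)%Z)). rewrite /psi /phi in H0 *. cbn [fst snd] in *.
      do 2 f_equal; [case: He => ->; lia | lia]. }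
    have H := proj2 (@HS_inj _ _ _ _ _ inj zero) (G0 0%Z).
    apply: HS_ext H => -[i k]. rewrite /psi /phi. cbn [fst snd]. case: eqd => [_|[]]; last by lia.
    rewrite /coef. cbn [fst snd]. congr (_ * (_ * _)). congr Cpowz. rewrite /f. ring.
Qed.

Lemma delta_laurent : exists g : Z -> C,
  (forall z N, annulus q z -> 1 - z <> 0 -> HS (fun i => A i * (z ^^ (- s i) - z ^^ (s i + 1))) N ->
     HS (fun t => g t * z ^^ t) (N / (1 - z))) /\
  HS (fun p : Z * Z => if eqd (snd p) 0%Z then A (fst p) * delta (s (fst p)) (snd p) else 0) (g 0%Z).
Proof.
  have [g [G0 G]] := @laurent_regroup _ (fun p : Z * Z => snd p) (fun p => A (fst p) * delta (s (fst p)) (snd p)) 1 annulus_1 delta_summable.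
  exists g; split; last exact: G0.
  move=> z N Hz H1 HN. have Nz := annulus_nz Hz. have [S3 H3] := summable_HS (delta_summable Hz).
  have -> : N / (1 - z) = S3; last exact: G.
  have F := HS_fubini (g := fun i => / (1 - z) * (A i * (z ^^ (- s i) - z ^^ (s i + 1)))) H3 _.
  have -> : N / (1 - z) = / (1 - z) * N by rewrite /Cdiv; ring.
  apply: (HS_unique (HS_scal (/ (1 - z)) HN)). apply: F => i. cbn [fst snd].
  have -> : / (1 - z) * (A i * (z ^^ (- s i) - z ^^ (s i + 1))) = A i * ((z ^^ (- s i) - z ^^ (s i + 1)) / (1 - z)) by rewrite /Cdiv; ring.
  apply: HS_ext (HS_scal (A i) (delta_HS (s i) Nz H1)) => t. ring.
Qed.

(** The numerator is multiplied by the expanded terms k <> 0 and by 1/(1 - z). The latter quotient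
    is a Laurent polynomial for each i, so the apparent pole at z = 1 disappears. *)
Lemma character_laurent : exists g : Z -> C,
  (forall z N, annulus q z -> generic q z -> HS (fun i => A i * (z ^^ (- s i) - z ^^ (s i + 1))) N ->
     HS (fun t => g t * z ^^ t) (euler q ^ 3 / jtheta z q * N)) /\
  HS (fun p : Z * Z => A (fst p) * (cone (fst p) (snd p) * th q q (snd p) * q ^^ (snd p * s (fst p)))) (g 0%Z).
Proof.
  have [g1 [H1 K1]] := shifted_laurent (or_intror eq_refl : (-1 = 1 \/ -1 = -1)%Z).
  have [g2 [H2 K2]] := shifted_laurent (or_introl eq_refl : (1 = 1 \/ 1 = -1)%Z).
  have [g3 [H3 K3]] := delta_laurent.
  exists (fun t => g1 t - g2 t + g3 t); split.
  - move=> z N Hz Hg HN. have Nz := annulus_nz Hz.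
    have N1 : 1 - z <> 0 by have := @Hg 0%Z; rewrite pz_0 Cmult_1_r.
    have [R HR] := summable_HS (recip_summable Hz). have ER := recip_HS Hz Hg HR.
    have S1 := weight_summable (8 * -1) (-1 * r + (-1 + 1) / 2) Hz. have S2 := weight_summable (8 * 1) (1 * r + (1 + 1) / 2) Hz.
    have [M1 HM1] := summable_HS S1. have [M2 HM2] := summable_HS S2.
    have HM1' : HS (fun i => A i * z ^^ (-1 * s i + (-1 + 1) / 2)) M1.
    { apply: HS_ext HM1 => i. congr (_ * _ ^^ _). rewrite /s. ring. }
    have HM2' : HS (fun i => A i * z ^^ (1 * s i + (1 + 1) / 2)) M2.
    { apply: HS_ext HM2 => i. congr (_ * _ ^^ _). rewrite /s. ring. }
    have EN : N = M1 - M2.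
    { apply: (HS_unique HN). apply: HS_ext (HS_minus HM1' HM2') => i.
      have -> : (-1 * s i + (-1 + 1) / 2 = - s i)%Z by change ((-1 + 1) / 2)%Z with 0%Z; ring.
      have -> : (1 * s i + (1 + 1) / 2 = s i + 1)%Z by change ((1 + 1) / 2)%Z with 1%Z; ring. ring. }
    have -> : euler q ^ 3 / jtheta z q * N = M1 * R - M2 * R + N / (1 - z) by rewrite ER EN; field; split => //; exact: j_nz.
    apply: HS_ext (HS_plus (HS_minus (H1 _ _ _ Hz HM1' HR) (H2 _ _ _ Hz HM2' HR)) (H3 _ _ Hz N1 HN)) => t. ring.
  - apply: HS_ext (HS_plus (HS_minus K1 K2) K3) => -[i k]. cbn [fst snd].
    change ((-1 + 1) / 2)%Z with 0%Z. change ((1 + 1) / 2)%Z with 1%Z.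
    have -> : (- -1 * k = k)%Z by ring. have -> : (-(1) * k = - k)%Z by ring.
    have -> : (- (-1 * s i + 0) = s i)%Z by ring. have -> : (- (1 * s i + 1) = - s i - 1)%Z by ring.
    have -> : (-1 * k * (-1 * s i + 0) = k * s i)%Z by ring.
    rewrite -!(Cmult_assoc (quadrant _ _)) -(Cmult_assoc (cone _ _)).
    have -> : th q q (- k) * q ^^ (k * (1 * s i + 1)) = th q q k * q ^^ (k * s i).
    { rewrite (th_opp k Hq) (th_1 q k). rewrite -Cmult_assoc -(pz_add _ _ Hq0). congr (_ * _ ^^ _). ring. }
    (* For k <> 0 the two monomials contribute equally, hence the weight 2; for k = 0 only [delta]
       contributes, with weight 1. Since 0 <= r < 8, the sign of s i is decided by that of i. *)
    have X : cone i k * (th q q k * q ^^ (k * s i)) = (quadrant k (s i) - quadrant (- k) (- s i - 1)) * (th q q k * q ^^ (k * s i))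
      + (if eqd k 0%Z then delta (s i) k else 0).
    { rewrite /cone /quadrant /delta /s. case: eqd => [->|B0].
      - rewrite Z.mul_0_l pz_0 /th !pz_0.
        repeat (case: Z_le_dec => ?); repeat (case: Z_lt_dec => ?); repeat (case: Z.eq_dec => ?); try lia; ring.
      - repeat (case: Z_le_dec => ?); repeat (case: Z_lt_dec => ?); repeat (case: Z.eq_dec => ?); try lia; ring. }
    rewrite X. case: eqd => _; ring.
Qed.

End Annulus.

Lemma is_Zseries_scal (c : C) (f : Z -> C) (s : C) : is_Zseries f s -> is_Zseries (fun k => c * f k) (c * s).
Proof.
  move=> [s1 [s2 [H1 [H2 ->]]]]. exists (c * s1), (c * s2). split; [|split]; last by ring.
  - exact: (is_series_scal c _ _ H1).
  - exact: (is_series_scal c _ _ H2).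
Qed.

Lemma is_Zseries_minus (f g : Z -> C) (s t : C) : is_Zseries f s -> is_Zseries g t ->
  is_Zseries (fun k => f k - g k) (s - t).
Proof.
  move=> [s1 [s2 [H1 [H2 ->]]]] [t1 [t2 [K1 [K2 ->]]]]. exists (s1 - t1), (s2 - t2). split; [|split]; last by ring.
  - exact: (is_series_minus _ _ _ _ H1 K1).
  - exact: (is_series_minus _ _ _ _ H2 K2).
Qed.

Lemma is_series_bounded (f : nat -> C) (s : C) : @is_series C_AbsRing C_NormedModule f s ->
  exists B, (0 <= B)%R /\ forall n, (Cmod (f n) <= B)%R.
Proof.
  move=> /is_series_clim H. have [M [HM B]] := clim_bounded H. exists (M + M)%R. split; first lra.
  case=> [|n].
  - have := B 0%nat. rewrite /= Cplus_0_r. lra.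
  - have -> : f (S n) = lsum f (seq 0 (S (S n))) + - lsum f (seq 0 (S n)).
    { rewrite (seq_S (S n)) lsum_app. rewrite /= . ring. }
    apply: Rle_trans (Cmod_triangle _ _) _. rewrite Cmod_opp. exact: Rplus_le_compat.
Qed.

Lemma Cmod_polar (rho t : R) : (0 < rho)%R -> Cmod (RtoC rho * cis t) = rho.
Proof. move=> H. rewrite Cmod_mult Cmod_cis Cmod_R Rabs_pos_eq; lra. Qed.

(** Abel's lemma: bounded terms at an outer and at an inner radius give geometric, hence absolute,
    convergence on the circle in between, where Fourier uniqueness applies. *)
Lemma annulus_unique (d : Z -> C) (a : R) : (1 < a)%R ->
  (forall rho t, (1 < rho < a)%R -> is_Zseries (fun k => d k * (RtoC rho * cis t) ^^ k) 0) ->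
  forall k, d k = 0.
Proof.
  move=> Ha H.
  pose r1 := ((3 + a) / 4)%R. pose r2 := ((1 + a) / 2)%R. pose r3 := ((1 + 3 * a) / 4)%R.
  have Hr : (1 < r1 /\ r1 < r2 /\ r2 < r3 /\ r3 < a)%R by rewrite /r1 /r2 /r3; lra.
  have nz (rho t : R) : (1 < rho)%R -> RtoC rho * cis t <> 0.
  { move=> Hp. apply/Cmod_gt_0. rewrite Cmod_polar; lra. }
  have md (rho t : R) k : (1 < rho)%R -> Cmod ((RtoC rho * cis t) ^^ k) = exp (IZR k * ln rho).
  { move=> Hp. rewrite Cmod_pz; last exact: nz. rewrite Cmod_polar //; lra. }
  have mono (u v : R) (n : nat) : exp (INR n * (u - v)) = (exp (u - v) ^ n)%R.
  { elim: n => [|n IH]; first by rewrite Rmult_0_l exp_0. rewrite S_INR Rmult_plus_distr_r Rmult_1_l exp_plus IH /=. ring. }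
  have S t : summable (fun k => d k * (RtoC r2 * cis t) ^^ k).
  { have L12 := ln_increasing r1 r2 ltac:(lra) ltac:(lra). have L23 := ln_increasing r2 r3 ltac:(lra) ltac:(lra).
    apply: summable_Z_split.
    - have [s1 [_ [H1 _]]] := H r3 0%R ltac:(lra). have [B [HB Bn]] := is_series_bounded H1.
      apply: (@summable_nat_geom _ B (exp (ln r2 - ln r3))).
      + split; first exact: Rlt_le (exp_pos _). rewrite -exp_0. apply: exp_increasing. lra.
      + move=> n. rewrite -mono. have := Bn n. rewrite !Cmod_mult !md; try lra. rewrite -!INR_IZR_INZ => X.
        have -> : (INR n * ln r2 = INR n * ln r3 + INR n * (ln r2 - ln r3))%R by ring.
        rewrite exp_plus -Rmult_assoc. apply: Rmult_le_compat_r => //. exact: Rlt_le (exp_pos _).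
    - have [_ [s2 [_ [H2 _]]]] := H r1 0%R ltac:(lra). have [B [HB Bn]] := is_series_bounded H2.
      apply: (@summable_nat_geom _ (B + Cmod (d 0%Z)) (exp (ln r1 - ln r2))).
      + split; first exact: Rlt_le (exp_pos _). rewrite -exp_0. apply: exp_increasing. lra.
      + case=> [|n].
        * rewrite Cmod_mult md; last lra. rewrite Rmult_0_l exp_0 /=. lra.
        * rewrite -mono. have := Bn n. rewrite !Cmod_mult !md; try lra. rewrite !opp_IZR -!INR_IZR_INZ => X.
          have D0 := Cmod_ge_0 (d 0%Z).
          have -> : (- INR (S n) * ln r2 = - INR (S n) * ln r1 + INR (S n) * (ln r1 - ln r2))%R by ring.
          rewrite exp_plus -Rmult_assoc. apply: Rmult_le_compat_r; [exact: Rlt_le (exp_pos _) | lra]. }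
  apply: (@laurent_zero d (RtoC r2)).
  - have := nz r2 0%R ltac:(lra). rewrite cis_0 Cmult_1_r. done.
  - move=> t. have [s Hs] := summable_HS (S t).
    by rewrite -(is_Zseries_unique (is_Zseries_HS Hs) (H r2 t ltac:(lra))).
Qed.

(** * Exponentials and fractional powers of q and z *)

Lemma Cexp_plus (x y : C) : Cexp (x + y) = Cexp x * Cexp y.
Proof. case: x y => [a b] [c d]. rewrite /Cexp /Cplus /Cmult /Re /Im /= exp_plus cos_plus sin_plus. f_equal; ring. Qed.

Lemma epow_add (t : C) (a b : R) : epow t (a + b) = epow t a * epow t b.
Proof. rewrite /epow -Cexp_plus RtoC_plus. congr Cexp. ring. Qed.

Lemma epow_0 (t : C) : epow t 0 = 1.
Proof. rewrite /epow. have -> : RtoC (2 * PI) * Ci * 0 * t = 0 by ring. by rewrite /Cexp /= exp_0 cos_0 sin_0 Rmult_1_l Rmult_0_r. Qed.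

Lemma epow_nz (t : C) (a : R) : epow t a <> 0.
Proof.
  move=> E. apply: C1_nz. have H : epow t (a + - a) = 1 by rewrite Rplus_opp_r epow_0. rewrite -H epow_add E. ring.
Qed.

Arguments epow_nz : clear implicits.

Lemma epow_pz (t : C) (a : R) (n : Z) : epow t (IZR n * a) = epow t a ^^ n.
Proof.
  have Hn (m : nat) : epow t (INR m * a) = epow t a ^ m.
  { elim: m => [|m IH]; first by rewrite Rmult_0_l epow_0.
    rewrite S_INR Rmult_plus_distr_r Rmult_1_l epow_add IH Cpow_S. ring. }
  case: (Z_le_dec 0 n) => H.
  - have -> : n = Z.of_nat (Z.to_nat n) by lia. by rewrite -INR_IZR_INZ Hn pz_nat.
  - have -> : n = (- Z.of_nat (Z.to_nat (- n)))%Z by lia. rewrite opp_IZR -INR_IZR_INZ pz_negnat -Hn.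
    set m := Z.to_nat _. have N := @epow_nz t (INR m * a).
    transitivity (epow t (- INR m * a) * epow t (INR m * a) / epow t (INR m * a)); first by field.
    rewrite -epow_add. have -> : (- INR m * a + INR m * a = 0)%R by ring. rewrite epow_0. by field.
Qed.

Lemma epow_int (t : C) (a : R) (n : Z) : epow t (a + IZR n) = epow t a * epow t 1 ^^ n.
Proof. by rewrite epow_add -(Rmult_1_r (IZR n)) epow_pz. Qed.

Lemma epow_scale (t : C) (c a : R) : epow (RtoC c * t) a = epow t (c * a).
Proof. rewrite /epow (RtoC_mult c a). congr Cexp. ring. Qed.

Lemma Cmod_epow (t : C) (a : R) : Cmod (epow t a) = exp (- (2 * PI * a * Im t)).
Proof.
  rewrite /epow /Cexp. set u := _ * _ * _ * t.
  have -> : Re u = (- (2 * PI * a * Im t))%R by rewrite /u /Ci; case: t {u} => x y /=; ring.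
  have -> : (exp (- (2 * PI * a * Im t)) * cos (Im u), exp (- (2 * PI * a * Im t)) * sin (Im u))%R
    = RtoC (exp (- (2 * PI * a * Im t))) * cis (Im u).
  { rewrite /cis /RtoC /Cmult /=. f_equal; ring. }
  rewrite Cmod_polar //. exact: exp_pos.
Qed.

Lemma epow_nome (t : C) (a : R) : (0 < Im t)%R -> (0 < a)%R -> nome (epow t a).
Proof.
  move=> Ht Ha. rewrite /nome Cmod_epow. split; first exact: exp_pos.
  rewrite -exp_0. apply: exp_increasing. have := PI_RGT_0 => P. have : (0 < 2 * PI * a * Im t)%R by repeat apply: Rmult_lt_0_compat => //; lra. lra.
Qed.

Lemma epow_polar (rho t : R) : (0 < rho)%R -> exists w, epow w 1 = RtoC rho * cis t.
Proof.
  move=> H. have P := PI_RGT_0. exists (t / (2 * PI), - ln rho / (2 * PI))%R.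
  rewrite /epow /Cexp.
  have -> : RtoC (2 * PI) * Ci * 1 * (t / (2 * PI), - ln rho / (2 * PI))%R = (ln rho, t).
  { rewrite /Ci /RtoC /Cmult /=. f_equal; field; lra. }
  rewrite /= exp_ln // /cis /RtoC /Cmult /=. f_equal; ring.
Qed.

(** * From the Weyl-Kac quotient to the constant Laurent coefficient *)

Section Character.
Variable tau : C.
Hypothesis Htau : (0 < Im tau)%R.
Let q := epow tau 1.
Let Hq : nome q := epow_nome Htau Rlt_0_1.
Let Hq0 := nome_nz Hq.

(** The even and the odd indices of the theta series form, after reflection, the two terms of the
    denominator. *)
Lemma char_den_jtheta (w : C) :
  char_den w tau = epow tau (1 / 8) * epow w (- (1 / 2)) * jtheta (epow w 1) q.
Proof.
  set z := epow w 1. have Hz : z <> 0 by exact: epow_nz.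
  have S := HS_j Hq Hz.
  have [s1 H1] := summable_HS (summable_inj (phi := fun i => (2 * i)%Z) ltac:(by move=> i k; cbv beta; lia) (proj1 S)).
  have [s2 H2] := summable_HS (summable_inj (phi := fun i => (2 * i + 1)%Z) ltac:(by move=> i k; cbv beta; lia) (proj1 S)).
  rewrite -(HS_unique (HS_even_odd H1 H2) S).
  have T1 : Theta 1 2 w tau = epow tau (1 / 8) * epow w (- (1 / 2)) * s1.
  { apply: Zseries_HS. apply: HS_ext (HS_scal (epow tau (1 / 8) * epow w (- (1 / 2))) (HS_refl 0 H1)) => i.
    have E1 : (INR 2 * (IZR i + 1 / (2 * INR 2)) ^ 2 = 1 / 8 + IZR (2 * i * i + i))%R.
    { rewrite plus_IZR !mult_IZR /=. field. }
    have E2 : (- (INR 2 * (IZR i + 1 / (2 * INR 2))) = - (1 / 2) + IZR (- (2 * i)))%R.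
    { rewrite opp_IZR mult_IZR /=. field. }
    cbv beta zeta. rewrite E1 E2 !epow_int -/z -/q /th sgn_even.
    have -> : (2 * (0 - i) * (2 * (0 - i) - 1) / 2 = 2 * i * i + i)%Z by apply: tri_eq; ring.
    have -> : (2 * (0 - i) = - (2 * i))%Z by ring. ring. }
  have T2 : Theta (-1) 2 w tau = epow tau (1 / 8) * epow w (- (1 / 2)) * - s2.
  { apply: Zseries_HS. apply: HS_ext (HS_scal (epow tau (1 / 8) * epow w (- (1 / 2))) (HS_opp (HS_refl 0 H2))) => i.
    have E1 : (INR 2 * (IZR i + -1 / (2 * INR 2)) ^ 2 = 1 / 8 + IZR (2 * i * i - i))%R.
    { rewrite minus_IZR !mult_IZR /=. field. }
    have E2 : (- (INR 2 * (IZR i + -1 / (2 * INR 2))) = - (1 / 2) + IZR (1 - 2 * i))%R.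
    { rewrite minus_IZR mult_IZR /=. field. }
    cbv beta zeta. rewrite E1 E2 !epow_int -/z -/q /th sgn_odd.
    have -> : ((2 * (0 - i) + 1) * (2 * (0 - i) + 1 - 1) / 2 = 2 * i * i - i)%Z by apply: tri_eq; ring.
    have -> : (2 * (0 - i) + 1 = 1 - 2 * i)%Z by ring. ring. }
  rewrite /char_den T1 T2. ring.
Qed.

Variable r : nat.
Let n := Z.of_nat (2 * r + 1).
Let Y := q ^^ (3 * n).
Let A (i : Z) : C := q ^^ (24 * i * i) * Y ^^ i.
Let s (i : Z) : Z := (Z.of_nat r + 8 * i)%Z.
(** This is p (l+1)^2/(4p') for (p, p') = (3, 8) and l = 2r. *)
Let e0 : R := (3 * IZR n ^ 2 / 32)%R.

Lemma char_num_sum (w : C) : annulus q (epow w 1) ->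
  exists N, HS (fun i => A i * (epow w 1 ^^ (- s i) - epow w 1 ^^ (s i + 1))) N /\
    char_num 3 8 (2 * r) w tau = epow tau e0 * epow w (- (1 / 2)) * N.
Proof.
  set z := epow w 1 => Hz. have Hz0 : z <> 0 by exact: epow_nz.
  have HY : Y <> 0 by exact: pz_nz.
  have [M1 H1] := summable_HS (weight_summable Hq HY (-8) (- Z.of_nat r) Hz).
  have [M2 H2] := summable_HS (weight_summable Hq HY 8 (Z.of_nat r + 1) Hz).
  exists (M1 - M2). split.
  - apply: HS_ext (HS_minus H1 H2) => i. rewrite -/(A i).
    have -> : (-8 * i + - Z.of_nat r = - s i)%Z by rewrite /s; ring.
    have -> : (8 * i + (Z.of_nat r + 1) = s i + 1)%Z by rewrite /s; ring. ring.
  - have En : IZR n = (2 * INR r + 1)%R by rewrite /n -INR_IZR_INZ plus_INR mult_INR.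
    have Er : IZR (Z.of_nat r) = INR r by rewrite -INR_IZR_INZ.
    have T1 : Theta n 8 w (RtoC (INR 3) * tau) = epow tau e0 * epow w (- (1 / 2)) * M1.
    { apply: Zseries_HS. apply: HS_ext (HS_scal (epow tau e0 * epow w (- (1 / 2))) H1) => i.
      cbv beta zeta. rewrite epow_scale.
      have E1 : (INR 3 * (INR 8 * (IZR i + IZR n / (2 * INR 8)) ^ 2) = e0 + IZR (24 * i * i + 3 * n * i))%R.
      { rewrite /e0 plus_IZR !mult_IZR /=. field. }
      (* As n/2 = r + 1/2, the factor z^(-1/2) splits off; it does so in the other theta function
         and in the denominator too, so that it cancels. *)
      have E2 : (- (INR 8 * (IZR i + IZR n / (2 * INR 8))) = - (1 / 2) + IZR (-8 * i + - Z.of_nat r))%R.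
      { rewrite plus_IZR opp_IZR mult_IZR Er En /=. field. }
      rewrite E1 E2 !epow_int -/z -/q /Y -pz_mul // (pz_add (24 * i * i) (3 * n * i) Hq0). ring. }
    have T2 : Theta (- n) 8 w (RtoC (INR 3) * tau) = epow tau e0 * epow w (- (1 / 2)) * M2.
    { apply: Zseries_HS. apply: HS_ext (HS_scal (epow tau e0 * epow w (- (1 / 2))) (HS_refl 0 H2)) => i.
      cbv beta zeta. rewrite epow_scale.
      have E1 : (INR 3 * (INR 8 * (IZR i + IZR (- n) / (2 * INR 8)) ^ 2) = e0 + IZR (24 * i * i - 3 * n * i))%R.
      { rewrite /e0 minus_IZR opp_IZR !mult_IZR /=. field. }
      have E2 : (- (INR 8 * (IZR i + IZR (- n) / (2 * INR 8))) = - (1 / 2) + IZR (8 * (0 - i) + (Z.of_nat r + 1)))%R.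
      { rewrite !plus_IZR opp_IZR mult_IZR minus_IZR Er En /=. field. }
      rewrite E1 E2 !epow_int -/z -/q /Y -pz_mul //.
      have -> : (24 * (0 - i) * (0 - i) = 24 * i * i)%Z by ring.
      have -> : (24 * i * i - 3 * n * i = 24 * i * i + 3 * n * (0 - i))%Z by ring. rewrite (pz_add (24 * i * i) (3 * n * (0 - i)) Hq0). ring. }
    rewrite /char_num. have -> : Z.of_nat (2 * r + 1) = n by []. rewrite T1 T2. ring.
Qed.

Lemma generic_inside (z : C) : (Cmod q < Cmod z < 1)%R -> generic q z.
Proof.
  move=> [H1 H2] k E. have [Q1 _] := Hq. have Hz : z <> 0 by apply/Cmod_gt_0; lra.
  have Lq := nome_ln Hq. have L1 := ln_increasing _ _ Q1 H1.
  have L2 := ln_increasing _ _ (proj1 (Cmod_gt_0 z) Hz) H2. rewrite ln_1 in L2.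
  have M : Cmod (z * q ^^ k) = 1%R by rewrite -(Csub_eq E) Cmod_1.
  rewrite Cmod_mult Cmod_pz // -{1}(exp_ln (Cmod z)) in M; last exact: (proj1 (Cmod_gt_0 z)).
  rewrite -exp_plus -exp_0 in M. have M' := exp_inv _ _ M.
  have K1 : (IZR (-1) < IZR k)%R by nra. have K2 : (IZR k < IZR 0)%R by nra.
  have := lt_IZR _ _ K1. have := lt_IZR _ _ K2. lia.
Qed.

Lemma character_jtheta (w : C) : annulus q (epow w 1) -> char_den w tau <> 0 ->
  exists N, HS (fun i => A i * (epow w 1 ^^ (- s i) - epow w 1 ^^ (s i + 1))) N /\
    generic q (epow w 1) /\
    character 3 8 (2 * r) w tau = epow tau (e0 - 1 / 8) * N / jtheta (epow w 1) q.
Proof.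
  move=> Hz HD. have [N [HN EN]] := char_num_sum Hz. exists N. split => //.
  rewrite char_den_jtheta in HD. set j := jtheta _ _ in HD *.
  have Hj : j <> 0 by move=> E; apply: HD; rewrite E; ring.
  split; first by apply: j_generic => //; exact: epow_nz.
  rewrite /character EN char_den_jtheta -/j. have E1 := epow_nz tau (1 / 8). have E2 := epow_nz w (- (1 / 2)).
  have -> : epow tau e0 = epow tau (e0 - 1 / 8) * epow tau (1 / 8) by rewrite -epow_add; congr epow; ring.
  by field.
Qed.

Lemma level_3_8 : level 3 8 = (2 / 3)%R.
Proof. rewrite /level /=. field. Qed.

(** Both halves of [iota_unique]: the Laurent coefficients of the character give an expansion, and
    [annulus_unique] shows that any other has the same coefficient at m = 0. *)
Lemma string_function_coefficient (g : Z -> C) :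
  (forall z N, annulus q z -> generic q z -> HS (fun i => A i * (z ^^ (- s i) - z ^^ (s i + 1))) N ->
     HS (fun t => g t * z ^^ t) (euler q ^ 3 / jtheta z q * N)) ->
  string_function 3 8 (2 * r) 0 tau = epow tau (e0 - 1 / 8) / euler q ^ 3 * g 0%Z.
Proof.
  move=> Hg. set K := _ / _. have HE := euler_nz Hq.
  pose x m := (IZR m ^ 2 / (4 * level 3 8))%R.
  (* The power z^(-m/2) picks the Laurent coefficient at -m/2; the expansion carries q^(m^2/(4N))
     separately, hence the division. *)
  pose c (m : Z) := K * g (- (m / 2))%Z / epow tau (x m).
  have half k : ((2 * k + Z.of_nat (2 * r)) / 2 = k + Z.of_nat r)%Z.
  { have -> : (2 * k + Z.of_nat (2 * r) = (k + Z.of_nat r) * 2)%Z by lia. exact: Z_div_mult. }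
  have W (w : C) k : epow w (- (IZR (2 * k + Z.of_nat (2 * r)) / 2)) = epow w 1 ^^ (- (k + Z.of_nat r)).
  { rewrite -epow_pz. congr epow. rewrite opp_IZR !plus_IZR mult_IZR -!INR_IZR_INZ mult_INR /=. field. }
  have Hc : string_expansion 3 8 (2 * r) tau c.
  { move=> w Hz HD. have [N [HN [Gz ->]]] := character_jtheta Hz HD.
    have H := HS_scal K (HS_refl (- Z.of_nat r) (Hg _ _ Hz Gz HN)).
    have Hj := j_nz Hq (epow_nz w 1) Gz.
    have -> : epow tau (e0 - 1 / 8) * N / jtheta (epow w 1) q = K * (euler q ^ 3 / jtheta (epow w 1) q * N) by rewrite /K; field.
    apply: is_Zseries_HS. apply: HS_ext H => k. cbv beta zeta. rewrite W /c half -/(x _).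
    have Hx := epow_nz tau (x (2 * k + Z.of_nat (2 * r))%Z).
    have -> : (- Z.of_nat r - k = - (k + Z.of_nat r))%Z by ring. by field. }
  have C0 : c 0%Z = K * g 0%Z.
  { rewrite /c /x. have -> : (0 ^ 2 / (4 * level 3 8) = 0)%R by rewrite level_3_8; field. rewrite epow_0.
    change (- (0 / 2))%Z with 0%Z. by field. }
  rewrite /string_function; apply: iota_unique.
  - move=> v [c' [Hc' <-]].
    pose d k := (c' (2 * k + Z.of_nat (2 * r))%Z - c (2 * k + Z.of_nat (2 * r))%Z) * epow tau (x (2 * k + Z.of_nat (2 * r))%Z).
    have Hq1 : (1 < / Cmod q)%R by have [Q1 Q2] := Hq; rewrite -Rinv_1; apply: Rinv_lt_contravar; lra.
    have D : forall k, d k = 0.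
    { apply: (annulus_unique Hq1) => rho t [R1 R2].
      have [w Hw] := @epow_polar (/ rho) (- t) ltac:(apply: Rinv_0_lt_compat; lra).
      set X := RtoC rho * cis t.
      have XZ : epow w 1 = / X.
      { have E : epow w 1 * X = 1.
        { rewrite Hw /X. transitivity (RtoC (/ rho) * RtoC rho * (cis (- t) * cis t)); first ring.
          rewrite -cis_plus -RtoC_mult Rplus_opp_l cis_0 Rinv_l; [by rewrite Cmult_1_l | lra]. }
        have HX : X <> 0 by move=> E0; apply: C1_nz; rewrite -E E0; ring.
        transitivity (epow w 1 * X / X); [by field | rewrite E; by field]. }
      have MZ : Cmod (epow w 1) = (/ rho)%R by rewrite Hw Cmod_polar //; apply: Rinv_0_lt_compat; lra.
      have Q1 := proj1 Hq. have Q2 := proj2 Hq.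
      have R3 : (Cmod q < / rho)%R.
      { rewrite -(Rinv_inv (Cmod q)). apply: Rinv_lt_contravar => //. apply: Rmult_lt_0_compat; lra. }
      have R4 : (/ rho < 1)%R by rewrite -Rinv_1; apply: Rinv_lt_contravar; lra.
      have Gz : generic q (epow w 1) by apply: generic_inside; rewrite MZ.
      have Az : annulus q (epow w 1).
      { rewrite /annulus MZ. split => //. lra. }
      have HD : char_den w tau <> 0.
      { rewrite char_den_jtheta. repeat apply: Cmult_neq_0; try exact: epow_nz. apply: j_nz => //. exact: epow_nz. }
      have Z0 := is_Zseries_scal (/ X ^^ Z.of_nat r) (is_Zseries_minus (Hc' w Az HD) (Hc w Az HD)).
      have HX : X <> 0 by move=> E0; apply: (epow_nz w 1); rewrite XZ E0 Cinv_0.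
      move: Z0. have -> : / X ^^ Z.of_nat r * (character 3 8 (2 * r) w tau - character 3 8 (2 * r) w tau) = 0 by ring.
      congr is_Zseries. apply: functional_extensionality => k. cbv beta zeta. rewrite /d W XZ pz_base_inv.
      have -> : (- - (k + Z.of_nat r) = k + Z.of_nat r)%Z by ring. rewrite (pz_add k _ HX) -/(x _).
      have HXr := pz_nz (n := Z.of_nat r) HX. by field. }
    (* The index m = 2k + 2r is 0 at k = -r. *)
    have D0 := D (- Z.of_nat r)%Z. have E0 : (2 * - Z.of_nat r + Z.of_nat (2 * r) = 0)%Z by lia. rewrite /d E0 in D0.
    have D1 : c' 0%Z = c 0%Z by apply: Csub_eq; apply: (Cmult_integral D0); exact: epow_nz.
    rewrite D1; exact: C0.
  - by exists c.
Qed.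
End Character.

Lemma epow_nat (t : C) (a : R) (k : nat) : epow t (INR k * a) = epow t a ^ k.
Proof. by rewrite INR_IZR_INZ epow_pz pz_nat. Qed.

Unset Implicit Arguments.

Theorem theorem2p7 (tau : C) (Htau : (0 < Im tau)%R) (r : nat) (Hr : (r <= 3)%nat) :
  let q := epow tau 1 in
  let qp := epow tau in
  let x := INR r in
  qinf q ^ 3 * norm_string_function 3 8 (2 * r) 0 tau =
    (-(1)) ^ ((r + 1) / 2)
      * (qp (- x)%R / 2)
      * (J 1 q ^ 2 * J 2 q / (J 4 q ^ 2 * J 8 q))
      * jtheta (- qp (7 - 2 * x)%R) (q ^ 16)
      * jtheta (qp (1 + 2 * x)%R) (q ^ 8)
    - qp (3 - 2 * x)%R
      * (jtheta (qp (7 - 2 * x)%R) (q ^ 16)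
         * jtheta (qp (30 - 4 * x)%R) (q ^ 32) / J 32 q)
      * omega3 (- q ^ 2)
    + qp (- x)%R
      * (jtheta (qp (1 + 2 * x)%R) (q ^ 16)
         * jtheta (qp (18 + 4 * x)%R) (q ^ 32) / J 32 q)
      * (/ 2 * f3 (q ^ 4)).
Proof.
  move=> q qp x. have Hq : nome q := epow_nome Htau Rlt_0_1. have Hq0 := nome_nz Hq.
  (* A square root of y = q^(r+1/2) is p^(2r+1), as the Lambert sum demands. *)
  set p := epow tau (1 / 4). have Hp : nome p by apply: epow_nome => //; lra. have Hp0 := nome_nz Hp.
  have pw (k : nat) : epow tau (INR k * (1 / 4)) = p ^ k by exact: epow_nat.
  pose P := p ^ 2. pose y := P ^ (2 * r + 1).
  have Hy : y <> 0 by repeat apply: Cpow_nz.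
  have HP0 : P <> 0 by exact: Cpow_nz.
  have EQ : q = P ^ 2.
  { rewrite /q /P -Cpow_mult_r -pw. congr epow. rewrite mult_INR /=. field. }
  have EY : q ^^ (3 * Z.of_nat (2 * r + 1)) = y ^^ 6.
  { rewrite /y EQ !pow_pz //. congr Cpowz. lia. }
  have HY : q ^^ (3 * Z.of_nat (2 * r + 1)) <> 0 by exact: pz_nz.
  have [g [Hg G0]] := character_laurent Hq HY (ltac:(lia) : (0 <= Z.of_nat r < 8)%Z).
  (* Here q^(3(2r+1)i) = y^(6i), and [th q q N] times q^(N(r+8i)) is (-1)^N P^(N^2+16iN) y^N. *)
  have HL : HS (hecke_term P y) (g 0%Z).
  { apply: HS_ext G0 => -[i N]. rewrite /hecke_term. cbn [fst snd]. rewrite EY /th EQ.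
    have T := tri_double N. have Hi := Nat2Z.inj_add (2 * r) 1. set m := Z.of_nat (2 * r + 1) in Hi *.
    have Yz k : y ^^ k = P ^^ (m * k) by rewrite /y (pow_pz _ _ HP0).
    have Pz k : (P ^ 2) ^^ k = P ^^ (2 * k) by rewrite (pow_pz _ _ HP0).
    rewrite !Pz !Yz -(pz_mul _ i HP0).
    transitivity (cone i N * (-(1)) ^^ N * (P ^^ (2 * (24 * i * i)) * P ^^ (m * 6 * i) * P ^^ (2 * (N * (N - 1) / 2)) * P ^^ (2 * N) * P ^^ (2 * (N * (Z.of_nat r + 8 * i))))); first ring.
    rewrite -!(Cmult_assoc (cone i N * _)) -!(pz_add _ _ HP0). congr (_ * _ ^^ _). rewrite T Hi. lia. }
  have HE := euler_nz Hq.
  (* At m = 0 the normalising power of q cancels exactly the prefactor q^(3(2r+1)^2/32 - 1/8) of the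
     character. *)
  have E1 : epow tau (- string_exponent 3 8 (2 * r) 0) * epow tau (3 * IZR (Z.of_nat (2 * r + 1)) ^ 2 / 32 - 1 / 8) = 1.
  { rewrite -epow_add -(epow_0 tau). congr epow. rewrite /string_exponent level_3_8 -INR_IZR_INZ plus_INR mult_INR /=. field. }
  rewrite /norm_string_function (string_function_coefficient Htau Hg) qinf_euler -/q.
  set e := epow tau (3 * _ / 32 - _) in E1 *. set e' := epow tau (- _) in E1 *.
  transitivity (e' * e * g 0%Z); first by field.
  rewrite E1 Cmult_1_l. rewrite (hecke_theta_mock Hp Hr HL) -/P -EQ -/y !J_euler.
  have inv (a b : R) k : (a + b = INR k)%R -> epow tau a = q ^ k / epow tau b.
  { move=> H. have N := epow_nz tau b. rewrite -(epow_nat tau 1 k) Rmult_1_r -H epow_add. by field. }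
  have Y2 : y ^ 2 = qp (1 + 2 * x)%R.
  { rewrite /y /P -!Cpow_mult_r -pw. congr epow. rewrite !(mult_INR, plus_INR) /x /=. field. }
  have Y4 : y ^ 4 = qp (2 + 4 * x)%R.
  { have -> : y ^ 4 = y ^ 2 * y ^ 2 by ring. rewrite Y2 -epow_add. congr epow. ring. }
  have PY : P / y = qp (- x)%R.
  { have PX : P ^ (2 * r) = qp x.
    { rewrite /P -!Cpow_mult_r -pw. congr epow. rewrite !mult_INR /x /=. field. }
    rewrite /qp (inv _ x 0%nat) -/qp; last by rewrite /=; ring.
    rewrite -PX /y Cpow_add_r Cpow_1_r /=. field. split => //; exact: Cpow_nz. }
  have Hpw k : (0 < k)%nat -> nome (q ^ k) by move=> Hk; apply: nome_pow.
  have S7 : qp (7 - 2 * x)%R = q ^ 16 / (q ^ 8 * y ^ 2).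
  { rewrite /qp (inv _ (1 + 2 * x)%R 8%nat) -/qp -?Y2; [field; split => //; exact: Cpow_nz | rewrite /=; ring]. }
  have S30 : qp (30 - 4 * x)%R = q ^ 32 / y ^ 4.
  { rewrite /qp (inv _ (2 + 4 * x)%R 32%nat) -/qp -?Y4 //. rewrite (INR_IZR_INZ 32); change (Z.of_nat 32) with 32%Z; ring. }
  have S18 : qp (18 + 4 * x)%R = q ^ 16 * y ^ 4.
  { rewrite Y4 -(epow_nat tau 1) -epow_add. congr epow. rewrite (INR_IZR_INZ 16); change (Z.of_nat 16) with 16%Z; ring. }
  have S3 : qp (3 - 2 * x)%R = q ^ 4 / y ^ 2.
  { rewrite /qp (inv _ (1 + 2 * x)%R 4%nat) -/qp -?Y2 // /=; ring. }
  have H8 : q ^ 8 * y ^ 2 <> 0 by apply: Cmult_neq_0; exact: Cpow_nz.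
  have -> : - qp (7 - 2 * x)%R = q ^ 16 / - (q ^ 8 * y ^ 2) by rewrite S7; field; split => //; exact: Cpow_nz.
  (* Reflection in the base matches the arguments: 7 - 2r = 16 - (9 + 2r), where q^(9+2r) = q^8 y^2,
     and 30 - 4r = 32 - (2 + 4r), where q^(2+4r) = y^4. *)
  rewrite S7 S30 S18 S3 -Y2 -PY !j_refl //; try exact: Hpw; try exact: Copp_nz; try exact: Cpow_nz; try (apply: Hpw; lia).
  by have -> : q ^ 1 = q by ring.
Qed.
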